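(* For $n\ge1$ set $$m_n=e^{-n^4},\qquad K_n=\lceil e^{n^6}\rceil,\qquad\ell_n=\frac{m_n}{K_n},$$ $$C_n=\bigcup_{k=0}^{K_n-1}[n+2k\ell_n,\ n+(2k+1)\ell_n),\qquad A_*:=\bigcup_{n=1}^\infty C_n.$$ Then the following assertions hold. (1) $A_*$ is unbounded but has finite positive measure, and $\int_{A_*}|x|^q\,dx<\infty$ for every $q\ge0$. (2) $\operatorname{Per}_\gamma(A_* )=\infty$ for every $0<\gamma\le1$. (3) If $M_N=\int_{A_*}x^{2N}\,dx$, then $$\log M_N=\frac N2\log N+O(N)\qquad(N\to\infty).$$ (4) For fixed $c>0$, put $K_c=P_{cA_*}\mathcal FP_{A_*}$ and $S_c=K_c^*K_c=P_{A_*}Q_{cA_*}P_{A_*}$. Then $$\log s_{N+1}(K_c)\le-\frac N2\log N+O_c(N),$$ and, as $\epsilon\downarrow0$, $$\operatorname{Tr}\mathbf 1_{(\epsilon,1-\epsilon)}(S_c)=O_c\!\left(\frac{\log(1/\epsilon)}{\log\log(1/\epsilon)}\right).$$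
   Context: For measurable $E\subset\mathbb R$ and $0<\gamma\le1$, $$\operatorname{Per}_\gamma(E):=\sup_{h\in\mathbb R\setminus\{0\}}\frac{|E\mathbin{\triangle}(E+h)|}{|h|^\gamma}.$$ $P_E$ is multiplication by the indicator of $E$ on $L^2(\mathbb R)$; $(\mathcal Ff)(\xi)=\int_{\mathbb R}e^{-2\pi i x\xi}f(x)\,dx$; $Q_E=\mathcal F^{-1}P_E\mathcal F$. $s_1\ge s_2\ge\cdots$ are singular values with multiplicity. $O_c(\cdot)$ denotes a bound with constant depending only on $c$; the singular-value estimate is as $N\to\infty$. *)

(* Defs.v *)
From HB Require Import structures.
From mathcomp Require Import all_boot all_order all_algebra.
From mathcomp Require Import complex.
From mathcomp Require Import all_classical all_reals all_analysis.

Set Implicit Arguments.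
Unset Strict Implicit.
Unset Printing Implicit Defensive.

Import Order.TTheory GRing.Theory Num.Theory.
Import numFieldNormedType.Exports.

Local Open Scope classical_set_scope.
Local Open Scope ring_scope.
Local Open Scope complex_scope.

Definition mseq (R : realType) (n : nat) : R := expR (- (n%:R ^+ 4)).

Definition Kseq (R : realType) (n : nat) : nat :=
  `| Num.ceil (expR (n%:R ^+ 6 : R)) |%N.

Definition ellseq (R : realType) (n : nat) : R := mseq R n / (Kseq R n)%:R.

Definition Cset (R : realType) (n : nat) : set R :=
  \bigcup_(k in [set k : nat | (k < Kseq R n)%N])
    `[n%:R + (2 * k)%:R * ellseq R n, n%:R + (2 * k + 1)%:R * ellseq R n[%classic.
Arguments Cset : clear implicits.

Definition Astar (R : realType) : set R :=
  \bigcup_(n in [set n : nat | (1 <= n)%N]) Cset R n.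
Arguments Astar : clear implicits.

Definition Per (R : realType) (gamma : R) (E : set R) : \bar R :=
  ereal_sup [set (lebesgue_measure (E `+` [set (x + h)%R | x in E])
                   * ((`|h| `^ gamma)^-1)%:E)%E | h in [set h : R | h != 0]].

(* Elements of L^2(R; C) are represented by measurable functions R -> R[i] with
   [L2], equality in L^2 being [f = g %[ae lebesgue_measure]].  The measurable
   sets of R are the Borel sets; every class in L^2 has a Borel representative.
   An operator on L^2 is represented by a map on functions, whose values outside
   of [L2] are irrelevant.  The adjoint, the Fourier transform, its inverse and
   the spectral measure, which are unique up to a.e. equality, are selected by
   [xget]; the default value (zero) is used only when there is no such object. *)

Definition L2norm (R : realType) (f : R -> R[i]) : \bar R :=
  'N[lebesgue_measure]_(2%:E)[(fun x => (Normc.normc (f x))%:E)].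

Definition L2 (R : realType) (f : R -> R[i]) : Prop :=
  [/\ measurable_fun setT (fun x => complex.Re (f x)),
      measurable_fun setT (fun x => complex.Im (f x)) &
      (L2norm f < +oo)%E].

Definition cintegral (R : realType) (f : R -> R[i]) : R[i] :=
  (\int[lebesgue_measure]_x complex.Re (f x)) +i*
  (\int[lebesgue_measure]_x complex.Im (f x)).

Definition dotL2 (R : realType) (f g : R -> R[i]) : R[i] :=
  cintegral (fun x => f x * (g x)^*).

Definition operator (R : realType) := (R -> R[i]) -> (R -> R[i]).

Definition L2stable (R : realType) (T : operator R) : Prop :=
  forall f, L2 f -> L2 (T f).

Definition is_adjoint (R : realType) (T T' : operator R) : Prop :=
  [/\ L2stable T, L2stable T' &
      forall f g, L2 f -> L2 g -> dotL2 (T f) g = dotL2 f (T' g)].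

Definition adjoint (R : realType) (T : operator R) : operator R :=
  xget (fun _ _ => 0) [set T' | is_adjoint T T'].

Definition orthonormalL2 (R : realType) (I : eqType) (u : I -> R -> R[i]) : Prop :=
  (forall i, L2 (u i)) /\ (forall i j, dotL2 (u i) (u j) = (i == j)%:R).

Definition is_hilbert_basis (R : realType) (e : nat -> R -> R[i]) : Prop :=
  orthonormalL2 e /\
  (forall f, L2 f -> (forall n, dotL2 f (e n) = 0) ->
     f = (fun=> 0) %[ae lebesgue_measure]).

Definition cis (R : realType) (t : R) : R[i] := cos t +i* sin t.

Definition fourier_integral (R : realType) (f : R -> R[i]) (xi : R) : R[i] :=
  cintegral (fun x => cis (- (2 * pi * x * xi)) * f x).

Definition Pproj (R : realType) (E : set R) : operator R :=
  fun f x => (\1_E x)%:C * f x.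

(* Plancherel: on L^2 the Fourier integral is understood as the L^2 limit of
   the Fourier integrals of the truncations of f. *)
Definition is_fourier (R : realType) (f g : R -> R[i]) : Prop :=
  [/\ L2 f, L2 g &
      L2norm (fun xi => g xi -
        fourier_integral (Pproj `[- n%:R, n%:R]%classic f) xi) @[n --> \oo] --> 0%E].

Definition fourier (R : realType) : operator R :=
  fun f => xget (fun=> 0) [set g | is_fourier f g].

(* F^-1 is the inverse of the L^2 operator F: its graph is the transposed one. *)
Definition inv_fourier (R : realType) : operator R :=
  fun g => xget (fun=> 0) [set f | is_fourier f g].

Definition Qproj (R : realType) (E : set R) : operator R :=
  fun f => inv_fourier (Pproj E (fourier f)).

(* The n-th (n >= 1) term of the nonincreasing list of the singular values of a
   compact operator T on L^2, i.e. of the square roots sigma of the eigenvalues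
   of T^* T, repeated according to multiplicity: the supremum of the t >= 0 such
   that at least n terms of the list are >= t. *)
Definition singular_value (R : realType) (T : operator R) (n : nat) : \bar R :=
  ereal_sup [set t%:E | t in [set t : R | 0 <= t /\
    exists (u : 'I_n -> R -> R[i]) (sigma : 'I_n -> R),
      [/\ orthonormalL2 u, (forall i, t <= sigma i) &
          forall i, adjoint T (T (u i)) =
            (fun x => (sigma i ^+ 2)%:C * u i x) %[ae lebesgue_measure]]]].

(* E is the projection-valued spectral measure of the bounded self-adjoint
   operator S, that is S = \int lambda dE(lambda).  (Linearity of each E B and
   its compatibility with a.e. equality follow from self-adjointness.) *)
Definition is_spectral_measure (R : realType) (S : operator R)
    (E : set R -> operator R) : Prop :=
  [/\ (forall B, measurable B -> is_adjoint (E B) (E B)),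
      (forall B B' f, measurable B -> measurable B' -> L2 f ->
         E (B `&` B') f = E B (E B' f) %[ae lebesgue_measure]),
      (forall f, L2 f -> E setT f = f %[ae lebesgue_measure]) &
      forall f, L2 f -> exists nu : {measure set R -> \bar R},
        [/\ (forall B, measurable B -> nu B = (complex.Re (dotL2 (E B f) f))%:E),
            nu.-integrable setT (fun lambda : R => lambda%:E) &
            dotL2 (S f) f = (\int[nu]_lambda lambda)%:C]].

(* The operator \mathbf 1_B(S) of the Borel functional calculus. *)
Definition spectral_projection (R : realType) (S : operator R) (B : set R) :
    operator R :=
  (xget (fun _ _ _ => 0) [set E | is_spectral_measure S E]) B.

(* The trace of a nonnegative operator; it does not depend on the Hilbert
   basis in which it is computed. *)
Definition trace (R : realType) (T : operator R) : \bar R :=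
  let e : nat -> R -> R[i] := xget (fun _ _ => 0) [set e | is_hilbert_basis e] in
  (\sum_(0 <= n <oo) (complex.Re (dotL2 (T (e n)) (e n)))%:E)%E.

Definition dilate (R : realType) (c : R) (E : set R) : set R :=
  [set c * x | x in E].

Definition Kop (R : realType) (c : R) : operator R :=
  fun f => Pproj (dilate c (Astar R)) (fourier (Pproj (Astar R) f)).

Definition Sop (R : realType) (c : R) : operator R :=
  fun f => adjoint (Kop c) (Kop c f).

(* Main.v *)
(* Taylor expansion of the exponential in [e^(-2 i pi x xi)] splits [K_c], for
   every [N], into an operator of rank [N] and an operator whose
   Hilbert-Schmidt norm is at most [C^N M_N / N!]. Since [M_N] lies between
   [n^(2N) m_n] for [n^4] close to [N] and the sum of [(n+1)^(2N) m_n] over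
   [n], it equals [N^(N/2) e^O(N)], and the norm of the remainder is [N^(-N/2)
   e^O(N)]. This bounds the singular values. A vector of the spectral subspace
   of [S_c] above [eps] cannot be orthogonal to the [N] functions [x^j 1_A] as
   soon as the squared remainder is below [eps]; hence that subspace has
   dimension at most [N], with [N] of order [log (1/eps) / log log (1/eps)].
   Plancherel's theorem on [L^1] and [L^2] is obtained by pairing [|hat a|^2]
   with [e^(-d |xi|)], whose Fourier transform is the Poisson kernel, and
   letting [d] tend to zero. As for the perimeters, the translation by [l_n]
   moves [C_n] off [A], so that the quotient for [h = l_n] is at least [m_n /
   l_n^gamma >= e^(gamma n^6 - n^4)]. *)

Require Import Defs.
From HB Require Import structures.
From mathcomp Require Import all_boot all_order all_algebra.
From mathcomp Require Import complex.
From mathcomp Require Import all_classical all_reals all_analysis.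
From mathcomp Require Import measurable_realfun ring lra zify.

Set Implicit Arguments.
Unset Strict Implicit.
Unset Printing Implicit Defensive.

Import Order.TTheory GRing.Theory Num.Theory.
Import numFieldNormedType.Exports.

Local Open Scope classical_set_scope.
Local Open Scope ring_scope.

(** * Real integrals *)

Section RealIntegral.
Context {R : realType}.
Local Notation mu := (@lebesgue_measure R).
Implicit Types (f g h : R -> R).

(** The exponents are balanced against each other. The terms n^(2N) e^(-n^4) peak at n^4 = N/2 with
    value N^(N/2) e^(O(N)), whose logarithm is about half that of N!; the remaining half is the
    decay N^(-N/2). The number K_n of teeth does not change the measure m_n of C_n, so it can be as
    large as e^(n^6), which beats m_n after being raised to any power gamma > 0. A dilation by c
    multiplies the moments by c^(2N+1) only, which O_c(N) absorbs. The obstacle is that the adjoint,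
    the Fourier transform and its inverse are values of [xget]: nothing is known of them before a
    witness is exhibited, and then only up to almost everywhere equality. As A and cA have finite
    measure, the functions cut off to these sets lie in both L^1 and L^2, where Fourier integrals
    are explicit witnesses; Plancherel's theorem serves to show that they are. Identities between
    values of selected operators are then obtained by pairing with test functions. *)

Definition integ f : Prop := mu.-integrable setT (EFin \o f).

Definition sqi f : Prop :=
  measurable_fun setT f /\ integ (fun x => f x ^+ 2).

Lemma integ_measurable f : integ f -> measurable_fun setT f.
Proof. by move=> /measurable_int /measurable_EFinP. Qed.

Lemma integ0 : integ (fun=> 0).
Proof. exact: integrable0. Qed.

Lemma integD f g : integ f -> integ g -> integ (fun x => f x + g x).
Proof. by move=> fi gi; exact: (integrableD measurableT fi gi). Qed.

Lemma integZ (k : R) f : integ f -> integ (fun x => k * f x).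
Proof. by move=> fi; exact: (integrableZl measurableT k fi). Qed.

Lemma integN f : integ f -> integ (fun x => - f x).
Proof.
by move=> fi; rewrite (_ : (fun x => - f x) = (fun x => -1 * f x));
  [exact: integZ|apply/funext => x; rewrite mulN1r].
Qed.

Lemma integB f g : integ f -> integ g -> integ (fun x => f x - g x).
Proof. by move=> fi gi; apply: integD => //; exact: integN. Qed.

Lemma integ_le f g : measurable_fun setT f -> (forall x, `|f x| <= g x) ->
  integ g -> integ f.
Proof.
move=> mf fg; apply: le_integrable => //; first exact/measurable_EFinP.
by move=> x _ /=; rewrite lee_fin (le_trans (fg x))// ler_norm.
Qed.

Lemma integ_norm f : integ f -> integ (fun x => `|f x|).
Proof. exact: integrable_norm. Qed.

Lemma integ_mulb f h (M : R) : integ f -> measurable_fun setT h ->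
  (forall x, `|h x| <= M) -> integ (fun x => f x * h x).
Proof.
move=> fi mh hM; apply: (@integ_le _ (fun x => M * `|f x|)).
- by apply: measurable_funM => //; exact: integ_measurable.
- by move=> x; rewrite normrM mulrC ler_wpM2r.
- exact/integZ/integ_norm.
Qed.

Lemma ge0_integP f : measurable_fun setT f -> (forall x, 0 <= f x) ->
  (\int[mu]_x (f x)%:E < +oo)%E -> integ f.
Proof.
move=> mf f0 foo; apply/integrableP; split; first exact/measurable_EFinP.
by under eq_integral do rewrite /= ger0_norm//.
Qed.

Lemma integ_EFin f : integ f -> (\int[mu]_x (f x)%:E = (\int[mu]_x f x)%:E)%E.
Proof. by move=> fi; rewrite /Rintegral fineK//; exact: integrable_fin_num. Qed.

Lemma RintD f g : integ f -> integ g ->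
  \int[mu]_x (f x + g x) = \int[mu]_x f x + \int[mu]_x g x.
Proof. by move=> fi gi; rewrite RintegralD. Qed.

Lemma RintB f g : integ f -> integ g ->
  \int[mu]_x (f x - g x) = \int[mu]_x f x - \int[mu]_x g x.
Proof. by move=> fi gi; rewrite RintegralB. Qed.

Lemma RintZ (k : R) f : integ f ->
  \int[mu]_x (k * f x) = k * \int[mu]_x f x.
Proof. by move=> fi; rewrite RintegralZl. Qed.

Lemma Rint0 : \int[mu]_x (0 : R) = 0.
Proof. by rewrite /Rintegral integral0. Qed.

Lemma RintN f : integ f -> \int[mu]_x (- f x) = - \int[mu]_x f x.
Proof.
by move=> fi; rewrite -mulN1r -RintZ//; apply: eq_Rintegral => x _; rewrite mulN1r.
Qed.

Lemma le_Rint f g : integ f -> integ g -> (forall x, f x <= g x) ->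
  \int[mu]_x f x <= \int[mu]_x g x.
Proof. by move=> fi gi fg; apply: le_Rintegral. Qed.

Lemma Rint_ge0 f : (forall x, 0 <= f x) -> 0 <= \int[mu]_x f x.
Proof. by move=> f0; apply: Rintegral_ge0. Qed.

Lemma eq_Rint f g : f =1 g -> \int[mu]_x f x = \int[mu]_x g x.
Proof. by move=> fg; apply: eq_Rintegral => x _. Qed.

Lemma eq_integ f g : f =1 g -> integ f -> integ g.
Proof. by move=> /funext ->. Qed.

Lemma norm_Rint f : integ f -> `|\int[mu]_x f x| <= \int[mu]_x `|f x|.
Proof. by move=> fi; exact: le_normr_Rintegral. Qed.

Lemma norm_Rint_le f g : integ f -> integ g -> (forall x, `|f x| <= g x) ->
  `|\int[mu]_x f x| <= \int[mu]_x g x.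
Proof.
by move=> fi gi fg; apply: (le_trans (norm_Rint fi)); apply: le_Rint => //;
  exact: integ_norm.
Qed.

Lemma aeS (P Q : R -> Prop) : (forall x, P x -> Q x) ->
  {ae mu, forall x, P x} -> {ae mu, forall x, Q x}.
Proof. by move=> PQ; apply: (@filterS _ _ (ae_filter_ringOfSetsType mu)). Qed.

Lemma aeS2 (P Q S : R -> Prop) : (forall x, P x -> Q x -> S x) ->
  {ae mu, forall x, P x} -> {ae mu, forall x, Q x} -> {ae mu, forall x, S x}.
Proof.
move=> PQS p q; apply: (@aeS (fun x => P x /\ Q x)); first by move=> x [/PQS];
  exact.
exact: (@filterI _ _ (ae_filter_ringOfSetsType mu) _ _ p q).
Qed.

Lemma Rint_ae_eq f g : measurable_fun setT f -> measurable_fun setT g ->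
  f = g %[ae mu] -> \int[mu]_x f x = \int[mu]_x g x.
Proof.
move=> mf mg fg; rewrite /Rintegral; congr fine; apply: ae_eq_integral => //.
- exact/measurable_EFinP.
- exact/measurable_EFinP.
- by apply: aeS fg => x /= h _; rewrite h.
Qed.

Lemma Rint_sum (n : nat) (f : 'I_n -> R -> R) : (forall i, integ (f i)) ->
  integ (fun x => \sum_(i < n) f i x) /\
  \int[mu]_x (\sum_(i < n) f i x) = \sum_(i < n) \int[mu]_x f i x.
Proof.
elim: n f => [|n IH] f fi.
  split; first by apply: (eq_integ _ integ0) => x; rewrite big_ord0.
  by rewrite big_ord0 -[RHS]Rint0; apply: eq_Rint => x; rewrite big_ord0.
have [i1 e1] := IH (fun i => f (widen_ord (leqnSn n) i)) (fun i => fi _).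
split.
  by apply: (eq_integ _ (integD i1 (fi ord_max))) => x; rewrite big_ord_recr.
rewrite big_ord_recr/= -e1 -RintD//.
by apply: eq_Rint => x; rewrite big_ord_recr.
Qed.

Lemma sqi_mul f g : sqi f -> sqi g -> integ (fun x => f x * g x).
Proof.
move=> [mf fi] [mg gi]; apply: (@integ_le _ (fun x => f x ^+ 2 + g x ^+ 2)).
- exact: measurable_funM.
- move=> x; rewrite normrM -(real_normK (num_real (f x))) -(real_normK
    (num_real (g x))).
  by have := normr_ge0 (f x); have := normr_ge0 (g x); nra.
- exact: integD.
Qed.

Lemma sqiD f g : sqi f -> sqi g -> sqi (fun x => f x + g x).
Proof.
move=> fs gs; split; first exact: (measurable_funD fs.1 gs.1).
apply: (@eq_integ (fun x => f x ^+ 2 + (2 * (f x * g x) + g x ^+ 2))).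
  by move=> x; ring.
by apply: integD fs.2 _; apply: integD _ gs.2; apply: integZ; exact: sqi_mul.
Qed.

Lemma sqiZ (k : R) f : sqi f -> sqi (fun x => k * f x).
Proof.
move=> fs; split; first exact: (measurable_funM (measurable_cst _) fs.1).
by apply: (eq_integ _ (integZ (k ^+ 2) fs.2)) => x; ring.
Qed.

Lemma sqiN f : sqi f -> sqi (fun x => - f x).
Proof.
move=> fs; rewrite (_ : (fun x => - f x) = (fun x => -1 * f x)); first exact: sqiZ.
by apply/funext => x; rewrite mulN1r.
Qed.

Lemma sqiB f g : sqi f -> sqi g -> sqi (fun x => f x - g x).
Proof. by move=> fs gs; apply: sqiD => //; exact: sqiN. Qed.

Lemma sqi0 : sqi (fun=> 0).
Proof. by split => //; apply: (eq_integ _ integ0) => x; rewrite expr0n. Qed.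

Lemma sqi_mulb f h (M : R) : sqi f -> measurable_fun setT h ->
  (forall x, `|h x| <= M) -> sqi (fun x => f x * h x).
Proof.
move=> fs mh hM; split; first exact: (measurable_funM fs.1 mh).
apply: (@eq_integ (fun x => f x ^+ 2 * h x ^+ 2)); first by move=> x; ring.
apply: (@integ_mulb _ _ (M ^+ 2) fs.2); first exact: measurable_funX.
move=> x; rewrite normrX; have := hM x; have := normr_ge0 (h x); nra.
Qed.

Lemma Rint_sqrD f g : sqi f -> sqi g ->
  \int[mu]_x ((f x + g x) ^+ 2) =
  \int[mu]_x (f x ^+ 2) + 2 * \int[mu]_x (f x * g x) + \int[mu]_x (g x ^+ 2).
Proof.
move=> fs gs; have fg := sqi_mul fs gs.
rewrite -RintZ// -RintD//; [|exact: fs.2|exact: integZ].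
rewrite -RintD//; [|apply: integD; [exact: fs.2|exact: integZ]|exact: gs.2].
by apply: eq_Rint => x; ring.
Qed.

Lemma Rint_sqrZ (k : R) f : sqi f ->
  \int[mu]_x ((k * f x) ^+ 2) = k ^+ 2 * \int[mu]_x (f x ^+ 2).
Proof.
by move=> fs; rewrite -RintZ; [apply: eq_Rint => x; ring|exact: fs.2].
Qed.

Lemma Rint_sqr_ge0 f : 0 <= \int[mu]_x (f x ^+ 2).
Proof. by apply: Rint_ge0 => x; exact: sqr_ge0. Qed.

(** Discriminant of the nonnegative quadratic polynomial t -> |f + t g|^2. *)
Lemma Rint_CS f g : sqi f -> sqi g ->
  (\int[mu]_x (f x * g x)) ^+ 2 <=
  (\int[mu]_x (f x ^+ 2)) * (\int[mu]_x (g x ^+ 2)).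
Proof.
move=> fs gs; set b := \int[mu]_x (f x * g x).
set a := \int[mu]_x (f x ^+ 2); set c := \int[mu]_x (g x ^+ 2).
have key t : 0 <= a + 2 * t * b + t ^+ 2 * c.
  have <- : \int[mu]_x ((f x + t * g x) ^+ 2) = a + 2 * t * b + t ^+ 2 * c.
    rewrite (Rint_sqrD fs (sqiZ t gs)) Rint_sqrZ//; congr (_ + _ + _).
    rewrite -mulrA /b -(RintZ t (sqi_mul fs gs)); congr (_ * _).
    by apply: eq_Rint => x; ring.
  exact: Rint_sqr_ge0.
have a0 : 0 <= a := Rint_sqr_ge0 f.
have c0 : 0 <= c := Rint_sqr_ge0 g.
have [c_gt0|] := ltP 0 c.
  (* The minimum of the polynomial, attained at t = -b/c, is (ac - b^2)/c. *)
  have := key (- b / c).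
  rewrite (_ : a + _ + _ = (a * c - b ^+ 2) / c); last by field; lra.
  by rewrite pmulr_lge0 ?invr_gt0// subr_ge0.
move=> cle0; have c00 : c = 0 by lra.
suff -> : b = 0 by rewrite expr2 mul0r; exact: mulr_ge0.
(* For c = 0 the polynomial is affine; if b were nonzero, this t would give it the value -1. *)
have k1 := key (- (a + 1) / (2 * b)).
have [//|b0] := eqVneq b 0.
move: k1; rewrite c00 mulr0 addr0.
rewrite (_ : a + _ = -1); first by rewrite lerNr oppr0 ler10.
by field.
Qed.

Lemma Rint_sqr_eq0 f : sqi f -> \int[mu]_x (f x ^+ 2) = 0 ->
  f = (fun=> 0) %[ae mu].
Proof.
move=> fs f0.
have : (\int[mu]_x `|(f x ^+ 2)%:E| = 0)%E.
  under eq_integral do rewrite /= ger0_norm ?sqr_ge0//.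
  by rewrite integ_EFin ?f0//; exact: fs.2.
move=> /ae_eq_integral_abs => /(_ measurableT) h.
have {h} : ae_eq mu setT (fun x => (f x ^+ 2)%:E) (cst 0%E).
  by apply: h; apply/measurable_EFinP; exact: measurable_funX fs.1.
apply: aeS => x /= /(_ I) [] /eqP.
by rewrite sqrf_eq0 => /eqP.
Qed.
End RealIntegral.

(** * Affine changes of variable *)

Section Affine.
Context {R : realType}.
Local Notation mu := (@lebesgue_measure R).

Lemma measurable_affine (c b : R) :
  measurable_fun [set: R] (fun t : R => c * t + b).
Proof. by apply: measurable_funD => //; exact: measurable_funM. Qed.

(** Uniqueness of Lebesgue measure: the pushforward by the affine map, scaled by c, gives every
    half-open interval its length. *)
Lemma lebesgue_measure_affine (c b : R) (c0 : 0 < c) (A : set R) : measurable A ->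
  mu A = (c%:E * mu ((fun t : R => c * t + b)%R @^-1` A))%E.
Proof.
pose phi : measurableTypeR R -> measurableTypeR R := fun t => c * t + b.
have mphi : measurable_fun setT phi := measurable_affine c b.
move=> mA.
have := @lebesgue_measure_unique R (mscale (NngNum (ltW c0)) (pushforward mu phi)).
move=> /(_ mphi) -> //= _ [[x y]] _ <-.
rewrite /mscale/= /pushforward.
have -> : phi @^-1` `]x, y] = `](x - b) / c, (y - b) / c]%classic.
  apply/seteqP; split => t /=; rewrite !in_itv/= /phi ltr_pdivrMr// ler_pdivlMr//.
  - by move=> /andP[h1 h2]; apply/andP; split; lra.
  - by move=> /andP[h1 h2]; apply/andP; split; lra.
rewrite !lebesgue_measure_itv/= !lte_fin ltr_pM2r ?invr_gt0// ltrD2r.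
case: ifPn => _; last by rewrite mule0.
rewrite -!EFinD -EFinM; congr EFin; field; lra.
Qed.

Lemma ge0_integral_affine (c b : R) (f : R -> \bar R) : 0 < c ->
  measurable_fun setT f -> (forall x, 0 <= f x)%E ->
  (\int[mu]_x f x = c%:E * \int[mu]_t f (c * t + b)%R)%E.
Proof.
move=> c0 mf f0.
pose phi : measurableTypeR R -> measurableTypeR R := fun t => c * t + b.
have mphi : measurable_fun setT phi := measurable_affine c b.
have := @ge0_integral_pushforward _ _ _ _ _ phi mphi mu setT f measurableT mf.
move=> /(_ (fun y _ => f0 y)).
rewrite preimage_setT => h.
rewrite -[X in (_ * X)%E]h -(@ge0_integral_mscale _ _ _ _ _ measurableT (NngNum
  (ltW c0)))//.
apply: eq_measure_integral => A mA _ /=.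
by rewrite /mscale/= /pushforward; exact: lebesgue_measure_affine.
Qed.

Lemma integ_affine (c b : R) (f : R -> R) : 0 < c -> integ f ->
  integ (fun t => f (c * t + b)) /\
  \int[mu]_x f x = c * \int[mu]_t f (c * t + b).
Proof.
move=> c0 fi.
have mf := integ_measurable fi.
have mphi := measurable_affine c b.
have mfp : measurable_fun setT (fun t => f (c * t + b)).
  exact: (measurableT_comp mf mphi).
have fii : integ (fun t => f (c * t + b)).
  apply/integrableP; split; first exact/measurable_EFinP.
  move/integrableP : fi => [_ ].
  rewrite (@ge0_integral_affine c b)//; last first.
    by apply/measurable_EFinP; exact: measurableT_comp.
  move=> h; rewrite -(@lte_pmul2l _ c%:E) ?lte_fin// gt0_muley ?lte_fin//.
split=> //.
(* [f] is the difference of the nonnegative functions [f + |f|] and [|f|] *)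
pose p x := f x + `|f x|; pose n x := `|f x|.
have fpn x : f x = p x - n x by rewrite /p /n addrK.
have ni : integ n := integ_norm fi.
have pi_ : integ p := integD fi ni.
have p0 x : 0 <= p x by rewrite /p -lerBlDl sub0r -normrN ler_norm.
have n0 x : 0 <= n x by rewrite /n.
have ni' : integ (fun t => n (c * t + b)) := integ_norm fii.
have pi' : integ (fun t => p (c * t + b)) := integD fii ni'.
have key g : integ g -> (forall x, 0 <= g x) -> integ (fun t => g (c * t + b)) ->
    \int[mu]_x g x = c * \int[mu]_t g (c * t + b).
  move=> gi g0 gi'; apply: EFin_inj; rewrite EFinM -!integ_EFin//.
  rewrite (@ge0_integral_affine c b)//.
    exact: (measurable_int mu gi).
have -> : \int[mu]_t f (c * t + b) = \int[mu]_t (p (c * t + b) - n (c * t + b)).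
  by apply: eq_Rint => t; exact: fpn.
by rewrite (eq_Rint fpn) !RintB// mulrBr (key p)// (key n).
Qed.

End Affine.

(** * Fubini's theorem for bounded kernels *)

Section Kernel.
Context {R : realType}.
Local Notation mu := (@lebesgue_measure R).

Definition mkernel (k : R -> R -> R) :=
  measurable_fun [set: R * R] (fun z : R * R => k z.1 z.2).

Lemma mkernel1 k x : mkernel k -> measurable_fun setT (k x).
Proof. by move=> mk; exact: (measurableT_comp mk (measurable_pair1 x)). Qed.

Lemma mkernel2 k y : mkernel k -> measurable_fun setT (k ^~ y).
Proof. by move=> mk; exact: (measurableT_comp mk (measurable_pair2 y)). Qed.

(** The integrand f(x) g(y) k(x, y) is dominated by M |f(x)| |g(y)|, integrable on the plane. This
    one statement serves the cosine, sine and Poisson kernels. *)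
Lemma kernel_Fubini (k : R -> R -> R) (M : R) (f g : R -> R) :
  mkernel k -> (forall x y, `|k x y| <= M) -> integ f -> integ g ->
  [/\ measurable_fun setT (fun y => \int[mu]_x (f x * k x y)),
      (forall y, `|\int[mu]_x (f x * k x y)| <= M * \int[mu]_x `|f x|) &
      \int[mu]_y (g y * \int[mu]_x (f x * k x y)) =
      \int[mu]_x (f x * \int[mu]_y (g y * k x y))].
Proof.
move=> mk kM fi gi.
have mf := integ_measurable fi. have mg := integ_measurable gi.
have M0 : 0 <= M := le_trans (normr_ge0 _) (kM 0 0).
pose F (z : R * R) : \bar R := (f z.1 * g z.2 * k z.1 z.2)%:E.
have mF : measurable_fun setT F.
  apply/measurable_EFinP; apply: measurable_funM => //.
  by apply: measurable_funM; apply: measurableT_comp.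
have fk y : integ (fun x => f x * k x y).
  exact: (integ_mulb fi (mkernel2 y mk) (fun x => kM x y)).
have gk x : integ (fun y => g y * k x y).
  exact: (integ_mulb gi (mkernel1 x mk) (kM x)).
have bnd y : `|\int[mu]_x (f x * k x y)| <= M * \int[mu]_x `|f x|.
  rewrite -RintZ; last exact: integ_norm.
  apply: norm_Rint_le => //; first exact/integZ/integ_norm.
  by move=> x; rewrite normrM mulrC ler_wpM2r.
have iF : (mu \x mu)%E.-integrable setT F.
  apply/integrable12ltyP => //.
  apply: (@le_lt_trans _ _ (\int[mu]_x (`|f x| * (M * \int[mu]_y `|g y|))%:E)%E).
    apply: ge0_le_integral => //.
    - by move=> x _; apply: integral_ge0.
    - have mAF : measurable_fun setT (abse \o F) by exact: measurableT_comp.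
      exact: (@measurable_fun_fubini_tonelli_F _ _ _ _ _ mu (abse \o F) mAF
        (fun=> abse_ge0 _)).
    - apply/measurable_EFinP; apply: measurable_funM => //.
      exact: measurableT_comp.
    - move=> x _.
      apply: (@le_trans _ _ (\int[mu]_y (`|f x| * (M * `|g y|))%:E)%E).
        apply: ge0_le_integral => //.
        + apply: measurableT_comp => //.
          exact: (measurableT_comp mF (measurable_pair1 x)).
        + apply/measurable_EFinP; do 2 apply: measurable_funM => //.
          exact: measurableT_comp.
        + move=> y _; rewrite /F/= lee_fin !normrM -mulrA ler_wpM2l//.
          by rewrite mulrC ler_wpM2r.
      rewrite integ_EFin; last exact/integZ/integZ/integ_norm.
      by rewrite lee_fin RintZ ?RintZ//; [exact:
        integ_norm|exact/integZ/integ_norm].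
  rewrite (_ : (fun x => _) = (fun x => (M * (\int[mu]_y `|g y|) * `|f
    x|)%:E)); last first.
    by apply/funext => x; congr EFin; ring.
  by rewrite integ_EFin ?ltry//; exact/integZ/integ_norm.
have E1 : (\int[mu]_x \int[mu]_y F (x, y) =
   \int[mu]_x (f x * \int[mu]_y (g y * k x y))%:E)%E.
  apply: eq_integral => x _.
  rewrite -RintZ// -integ_EFin; last exact: integZ.
  by apply: eq_integral => y _; rewrite /F/= mulrA.
have E2 : (fun y => \int[mu]_x F (x, y))%E =
   (fun y => (g y * \int[mu]_x (f x * k x y))%:E)%E.
  apply/funext => y.
  rewrite -RintZ// -integ_EFin; last exact: integZ.
  by apply: eq_integral => x _; rewrite /F/= mulrCA mulrA.
split; [|exact: bnd|].
(* Tonelli's theorem gives measurable partial integrals for nonnegative functions, whence the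
   splitting into positive and negative parts. *)
- pose H (z : R * R) : \bar R := (f z.1 * k z.1 z.2)%:E.
  have mH : measurable_fun setT H.
    apply/measurable_EFinP; apply: measurable_funM => //.
    exact: measurableT_comp.
  have HE y : (\int[mu]_x H (x, y) =
      \int[mu]_x (H^\+ (x, y)) - \int[mu]_x (H^\- (x, y)))%E.
    rewrite [LHS]integralE.
    by under eq_integral do rewrite funepos_comp/=;
       under [X in (_ - X)%E = _]eq_integral do rewrite funeneg_comp/=.
  have : measurable_fun setT (fun y => \int[mu]_x H (x, y))%E.
    rewrite (funext HE); apply: emeasurable_funB.
    - have mHp : measurable_fun setT (H^\+)%E by exact: measurable_funepos.
      exact: (@measurable_fun_fubini_tonelli_G _ _ _ _ _ mu _ mHp (funepos_ge0 _)).
    - have mHn : measurable_fun setT (H^\-)%E by exact: measurable_funeneg.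
      exact: (@measurable_fun_fubini_tonelli_G _ _ _ _ _ mu _ mHn (funeneg_ge0 _)).
  by move=> mHH; apply: (measurableT_comp _ mHH); exact: fine_measurable.
- rewrite /Rintegral -E1; congr fine; rewrite (Fubini iF).
  by apply: eq_integral => y _; rewrite -[RHS]/((fun y =>
    \int[mu]_x F (x, y))%E y) E2.
Qed.

End Kernel.

(** * The Poisson kernel *)

Section PoissonKernel.
Context {R : realType}.
Local Notation mu := (@lebesgue_measure R).

Lemma measurable_cos : measurable_fun setT (@cos R).
Proof. by apply: continuous_measurable_fun; exact: continuous_cos. Qed.

Lemma measurable_sin : measurable_fun setT (@sin R).
Proof. by apply: continuous_measurable_fun; exact: continuous_sin. Qed.

Lemma itvcyE (a : R) : [set x : R | a <= x] = `[a, +oo[%classic.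
Proof. by apply/seteqP; split => x /=; rewrite in_itv/= andbT. Qed.

Lemma Rint_cauchy : integ (fun t : R => (1 + t ^+ 2)^-1) /\
  \int[mu]_t (1 + t ^+ 2)^-1 = pi.
Proof.
pose f (t : R) := (1 + t ^+ 2)^-1.
have f0 t : 0 <= f t by rewrite invr_ge0 addr_ge0// sqr_ge0.
have cf : continuous f.
  move=> t; apply: cvgV; first by rewrite gt_eqF// ltr_pwDl// sqr_ge0.
  by apply: cvgD; [exact: cvg_cst|apply: exprn_continuous].
have mf : measurable_fun setT f by exact: continuous_measurable_fun.
have E : (\int[mu]_x (f x)%:E = pi%:E)%E.
  rewrite ge0_symfun_integralT//; last by move=> t; rewrite /f/= sqrrN.
  rewrite itvcyE (@ge0_continuous_FTC2y _ f atan 0 (pi / 2))//.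
  - by rewrite atan0 -EFinB -EFinM subr0 mulrC divfK.
  - exact: continuous_subspaceT.
  - exact: cvgy_atan.
  - by apply: cvg_at_right_filter; exact: continuous_atan.
  - by move=> t _; rewrite derive1_atan.
have fi : integ f by apply: ge0_integP => //; rewrite E ltry.
by split=> //; apply: EFin_inj; rewrite -integ_EFin.
Qed.

Definition exp_weight (d xi : R) : R := expR (- (d * `|xi|)).

(* An antiderivative of [expR (- d x) * (1 + cos (b x))]; the added [1] makes the
   integrand nonnegative, as the improper fundamental theorem requires. *)
Let Fp (d b x : R) : R := - (d^-1 * expR (- (d * x))) +
  expR (- (d * x)) * ((d ^+ 2 + b ^+ 2)^-1 * (b * sin (b * x) - d * cos (b * x))).

Lemma is_derive_Fp (d b x : R) : 0 < d ->
  is_derive x 1 (Fp d b) (expR (- (d * x)) * (1 + cos (b * x))).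
Proof.
move=> d0.
have h1 : is_derive x 1 (fun x : R => - (d * x)) (- d).
  by apply: is_derive_eq; rewrite /GRing.scale/= !mulr1.
have h2 : is_derive x 1 (fun x : R => b * x) b.
  by apply: is_derive_eq; rewrite /GRing.scale/= !mulr1.
have h3 : is_derive x 1 (fun x : R => expR (- (d * x))) (- d * expR (- (d * x))).
  by apply: (is_derive_eq (is_derive1_comp (is_derive_expR _) h1)); rewrite mulrC.
have h4 : is_derive x 1 (fun x : R => sin (b * x)) (b * cos (b * x)).
  by apply: (is_derive_eq (is_derive1_comp (is_derive_sin _) h2)); rewrite mulrC.
have h5 : is_derive x 1 (fun x : R => cos (b * x)) (b * - sin (b * x)).
  by apply: (is_derive_eq (is_derive1_comp (is_derive_cos _) h2)); rewrite mulrC.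
apply: is_derive_eq; rewrite /GRing.scale/=.
have : d ^+ 2 + b ^+ 2 != 0 by rewrite gt_eqF// ltr_pwDl ?exprn_gt0// sqr_ge0.
by move=> db; field; rewrite db gt_eqF.
Qed.

Lemma cvg_expN (d : R) : 0 < d -> expR (- (d * x)) @[x --> +oo] --> (0 : R).
Proof.
move=> d0.
apply: (@cvg_comp _ _ _ (fun x => d * x) (fun x : R =>
  expR (- x)) _ (pinfty_nbhs R)).
  exact: gt0_cvgMry.
exact: cvgr_expR.
Qed.

Lemma cvg_Fp (d b : R) : 0 < d -> Fp d b x @[x --> +oo] --> (0 : R).
Proof.
move=> d0.
have e0 := cvg_expN d0.
rewrite -[X in _ --> X]addr0; apply: cvgD.
  rewrite -[X in _ --> X]oppr0 -[X in _ --> - X](mulr0 d^-1).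
  by apply: cvgN; apply: cvgM => //; exact: cvg_cst.
(* [K] bounds the trigonometric factor of [Fp] uniformly in x, so the exponential alone gives the
   limit. *)
pose K := (d ^+ 2 + b ^+ 2)^-1 * (`|b| + d).
apply/cvgrPdist_lt => e epos.
have K0 : 0 <= K by rewrite mulr_ge0 ?invr_ge0 ?addr_ge0 ?sqr_ge0// ltW.
have : 0 < e / (K + 1) by rewrite divr_gt0// ltr_wpDl.
move/cvgrPdist_lt : e0 => /[apply].
apply: filterS => x; rewrite !sub0r !normrN => h.
rewrite normrM; apply: (@le_lt_trans _ _ (`|expR (- (d * x))| * K)).
  rewrite ler_wpM2l// normrM ger0_norm ?invr_ge0 ?addr_ge0 ?sqr_ge0//.
  rewrite ler_wpM2l ?invr_ge0 ?addr_ge0 ?sqr_ge0//.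
  apply: (le_trans (ler_normB _ _)); rewrite !normrM (gtr0_norm d0).
  have hs : `|sin (b * x)| <= 1 by rewrite ler_norml sin_geN1 sin_le1.
  have hc : `|cos (b * x)| <= 1 by rewrite ler_norml cos_geN1 cos_le1.
  by apply: lerD; rewrite ler_piMr// ltW.
apply: (@le_lt_trans _ _ (`|expR (- (d * x))| * (K + 1))).
  by rewrite ler_wpM2l// lerDl.
by rewrite -ltr_pdivlMr// ltr_wpDl.
Qed.

Lemma ge0_int_expcos (d b : R) : 0 < d ->
  (\int[mu]_x (exp_weight d x * (1 + cos (b * x)))%:E =
   (2 / d + 2 * d / (d ^+ 2 + b ^+ 2))%:E)%E.
Proof.
move=> d0; pose f x := exp_weight d x * (1 + cos (b * x)).
have f0 t : 0 <= f t.
  by rewrite mulr_ge0 ?expR_ge0// -lerBlDl sub0r cos_geN1.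
have cew : continuous (exp_weight d).
  move=> x; apply: (@continuous_comp _ _ _ (fun x : R => - (d * `|x|)) expR).
    by apply: cvgN; apply: cvgM; [exact: cvg_cst|exact: norm_continuous].
  exact: continuous_expR.
have cf : continuous f.
  move=> x; apply: cvgM; first exact: cew.
  apply: cvgD; first exact: cvg_cst.
  apply: (@continuous_comp _ _ _ (fun x : R => b * x) cos);
    last exact: continuous_cos.
  exact: mulrl_continuous.
rewrite ge0_symfun_integralT//; last first.
  by move=> t; rewrite /f/exp_weight/= normrN mulrN cosN.
have dFp x : derivable (Fp d b) x 1 by have [] := is_derive_Fp b x d0.
rewrite itvcyE (@ge0_continuous_FTC2y _ f (Fp d b) 0 0)//.
- rewrite /Fp !mulr0 oppr0 expR0 sin0 cos0 -EFinB -EFinM; congr EFin.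
  have : d ^+ 2 + b ^+ 2 != 0 by rewrite gt_eqF// ltr_pwDl ?exprn_gt0// sqr_ge0.
  by move=> db; field; rewrite db gt_eqF.
- exact: continuous_subspaceT.
- exact: cvg_Fp.
- apply: cvg_at_right_filter; apply: differentiable_continuous.
  by apply/derivable1_diffP.
- move=> x; rewrite in_itv/= andbT => x0.
  rewrite derive1E (@derive_val _ _ _ _ _ _ _ (is_derive_Fp b x d0)).
  by rewrite /f /exp_weight gtr0_norm.
Qed.

Lemma measurable_exp_weight d : measurable_fun setT (exp_weight d).
Proof.
apply: continuous_measurable_fun.
move=> x; apply: (@continuous_comp _ _ _ (fun x : R => - (d * `|x|)) expR).
  by apply: cvgN; apply: cvgM; [exact: cvg_cst|exact: norm_continuous].
exact: continuous_expR.
Qed.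

Lemma integ_exp_weight d : 0 < d -> integ (exp_weight d).
Proof.
move=> d0.
apply: ge0_integP; [exact: measurable_exp_weight|by move=> x; exact: expR_ge0|].
apply: (@le_lt_trans _ _ (\int[mu]_x (exp_weight d x * (1 + cos (0 * x)))%:E)%E).
  apply: ge0_le_integral => //.
  - by move=> x _; rewrite lee_fin expR_ge0.
  - by apply/measurable_EFinP; exact: measurable_exp_weight.
  - apply/measurable_EFinP; apply: measurable_funM;
      first exact: measurable_exp_weight.
    rewrite (_ : (fun x => _) = cst (1 + cos 0)) //.
    by apply/funext => x /=; rewrite mul0r.
  - move=> x _; rewrite lee_fin mul0r cos0 ler_peMr ?expR_ge0//; lra.
by rewrite ge0_int_expcos// ltry.
Qed.

(** With h = d / (2 pi) this is h / (pi (h^2 + t^2)), the Poisson kernel of the half-plane at height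
    h, of mass one. *)
Definition poisson (d t : R) : R := 2 * d / (d ^+ 2 + (2 * pi * t) ^+ 2).

Lemma measurable_mulcos (b : R) : measurable_fun setT (fun x : R => cos (b * x)).
Proof. by apply: (measurableT_comp measurable_cos); exact: mulrl_measurable. Qed.

Lemma Rint_expcos (d t : R) : 0 < d ->
  \int[mu]_x (exp_weight d x * cos (2 * pi * t * x)) = poisson d t.
Proof.
move=> d0.
have ii b : integ (fun x => exp_weight d x * cos (b * x)).
  apply: (@integ_mulb _ _ _ 1 (integ_exp_weight d0));
    first exact: measurable_mulcos.
  by move=> x; rewrite ler_norml cos_geN1 cos_le1.
have key b : \int[mu]_x (exp_weight d x) + \int[mu]_x (exp_weight d x * cos (b
  * x)) =
    2 / d + 2 * d / (d ^+ 2 + b ^+ 2).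
  rewrite -(RintD (integ_exp_weight d0) (ii b)); apply: EFin_inj.
  rewrite -ge0_int_expcos// -integ_EFin.
    by apply: eq_integral => x _; rewrite mulrDr mulr1.
  exact: integD (integ_exp_weight d0) (ii b).
(* At b = 0 the cosine is 1 and [key] reads 2 I = 4 / d, which isolates the mass I of the weight. *)
have := key 0; rewrite (_ : \int[mu]_x (exp_weight d x * cos (0 * x)) =
  \int[mu]_x exp_weight d x); last first.
  by apply: eq_Rint => x; rewrite mul0r cos0 mulr1.
rewrite (_ : 2 / d + 2 * d / (d ^+ 2 + 0 ^+ 2) = 4 / d); last by field; lra.
have := key (2 * pi * t); rewrite -/(poisson d t); lra.
Qed.

Lemma poisson_ge0 d t : 0 < d -> 0 <= poisson d t.
Proof. by move=> d0; rewrite divr_ge0 ?mulr_ge0 ?addr_ge0 ?sqr_ge0// ltW. Qed.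

Lemma poisson_even d t : poisson d (- t) = poisson d t.
Proof. by rewrite /poisson mulrN sqrrN. Qed.

Lemma poisson_le d t : 0 < d -> poisson d t <= 2 / d.
Proof.
move=> d0; rewrite /poisson -mulrA ler_wpM2l//.
rewrite ler_pdivrMr; last by rewrite ltr_pwDl ?exprn_gt0 ?sqr_ge0.
rewrite mulrDr expr2 mulKf ?gt_eqF// lerDl mulr_ge0 ?invr_ge0 ?sqr_ge0//; lra.
Qed.

Lemma measurable_poisson d : 0 < d -> measurable_fun setT (poisson d).
Proof.
move=> d0; apply: continuous_measurable_fun => t; apply: cvgM; first exact: cvg_cst.
apply: cvgV; first by rewrite gt_eqF// ltr_pwDl ?exprn_gt0 ?sqr_ge0.
apply: cvgD; first exact: cvg_cst.
apply: (@continuous_comp _ _ _ (fun t : R => 2 * pi * t) (fun t : R => t ^+ 2)).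
  exact: mulrl_continuous.
exact: exprn_continuous.
Qed.

Lemma poisson_scale d t : 0 < d ->
  d / (2 * pi) * poisson d (d / (2 * pi) * t) = pi^-1 * (1 + t ^+ 2)^-1.
Proof.
rewrite /poisson => d0; have := pi_gt0 R; move: (@pi R) => q q0.
have t1 : 1 + t ^+ 2 != 0 by rewrite gt_eqF// ltr_pwDl// sqr_ge0.
rewrite (_ : 2 * q * (d / (2 * q) * t) = d * t); last by field; rewrite gt_eqF.
rewrite (_ : d ^+ 2 + _ = d ^+ 2 * (1 + t ^+ 2)); last by ring.
by field; rewrite t1 !gt_eqF.
Qed.

Lemma integ_poisson d : 0 < d -> integ (poisson d).
Proof.
move=> d0; have c0 : 0 < 2 * pi / d by rewrite divr_gt0// mulr_gt0// pi_gt0.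
have [ci _] := Rint_cauchy.
have [hi _] := @integ_affine R (2 * pi / d) 0 _ c0 (integZ pi^-1 ci).
apply: (eq_integ _ (integZ (2 * pi / d) hi)) => x /=.
rewrite addr0 -(poisson_scale _ d0).
have e1 : 2 * pi / d * (d / (2 * pi)) = 1 :> R.
  have := pi_gt0 R; move: (@pi R) => q q0; by field; rewrite !gt_eqF.
rewrite [LHS]mulrA e1 mul1r; congr (poisson d _).
by rewrite [LHS]mulrA (mulrC (d / _)) e1 mul1r.
Qed.

(** After the substitution y = d t / (2 pi) + x, the parameter d occurs only in the argument of [a],
    under the fixed Cauchy density: this prepares dominated convergence as d tends to zero. *)
Lemma Rint_poisson_shift d x (a : R -> R) (M : R) : 0 < d ->
  measurable_fun setT a -> (forall y, `|a y| <= M) ->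
  integ (fun y => a y * poisson d (x - y)) /\
  \int[mu]_y (a y * poisson d (x - y)) =
  \int[mu]_t (a (d / (2 * pi) * t + x) * (pi^-1 * (1 + t ^+ 2)^-1)).
Proof.
move=> d0 ma aM; have p0 := pi_gt0 R.
have c0 : 0 < d / (2 * pi) by rewrite divr_gt0// mulr_gt0.
have pi_ : integ (fun y => poisson d (x - y)).
  have [h _] := @integ_affine R 1 (- x) _ ltr01 (integ_poisson d0).
  by apply: (eq_integ _ h) => y /=; rewrite -poisson_even; congr poisson; ring.
have ii : integ (fun y => a y * poisson d (x - y)).
  by apply: (eq_integ _ (integ_mulb pi_ ma aM)) => y; rewrite mulrC.
split=> //; have [_ ->] := @integ_affine R (d / (2 * pi)) x _ c0 ii.
rewrite -RintZ; last by have [] := @integ_affine R (d / (2 * pi)) x _ c0 ii.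
apply: eq_Rint => t /=; rewrite -(poisson_scale t d0) -(poisson_even d (d / _ * t)).
rewrite mulrCA; congr (_ * (_ * poisson d _)); ring.
Qed.

Lemma Rint_poisson d x : 0 < d ->
  integ (fun y => poisson d (x - y)) /\ \int[mu]_y poisson d (x - y) = 1.
Proof.
move=> d0; have n1 (y : R) : `|1| <= 1 :> R by rewrite normr1.
have [h e] := @Rint_poisson_shift d x (fun=> 1) 1 d0 (measurable_cst _) n1.
split; first by apply: (eq_integ _ h) => y; rewrite mul1r.
have [ci ce] := Rint_cauchy.
transitivity (\int[mu]_y (1 * poisson d (x - y)));
  first by apply: eq_Rint => y; rewrite mul1r.
rewrite e (eq_Rint (g := fun t => pi^-1 * (1 + t ^+ 2)^-1)); last by move=> t;
  rewrite mul1r.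
by rewrite RintZ// ce mulVf// gt_eqF// pi_gt0.
Qed.

End PoissonKernel.

(** * Plancherel's theorem *)

Section DominatedConvergence.
Context {R : realType}.
Local Notation mu := (@lebesgue_measure R).

Lemma cvg_seq_EFin (u : nat -> R) (l : R) :
  u @ \oo --> l -> (u n)%:E @[n --> \oo] --> l%:E.
Proof. by move=> ul; apply/fine_cvgP; split; [exact: nearW|exact: ul]. Qed.

Lemma Rint_dct (f_ : nat -> R -> R) (f g : R -> R) :
  (forall n, measurable_fun setT (f_ n)) -> measurable_fun setT f ->
  {ae mu, forall x, f_ ^~ x @ \oo --> f x} -> integ g ->
  (forall n x, `|f_ n x| <= g x) ->
  integ f /\ \int[mu]_x f_ n x @[n --> \oo] --> \int[mu]_x f x.
Proof.
move=> mf_ mf fc gi fg.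
have mE n : measurable_fun setT (EFin \o f_ n) by apply/measurable_EFinP.
have mE' : measurable_fun setT (EFin \o f) by apply/measurable_EFinP.
have := @dominated_convergence _ _ _ mu setT measurableT (fun n =>
  EFin \o f_ n) (EFin \o f) (EFin \o g) mE mE'.
case=> //.
- apply: aeS fc => x h _ /=; exact: cvg_seq_EFin.
- by apply: aeW => x n _; rewrite lee_fin; exact: fg.
move=> fi _ h; split=> //.
have fni n : integ (f_ n) by exact: (integ_le (mf_ n) (fg n)).
apply/fine_cvg; move: h; rewrite (integ_EFin fi).
by under eq_fun do rewrite (integ_EFin (fni _)).
Qed.

End DominatedConvergence.

Section RealPlancherel.
Context {R : realType}.
Local Notation mu := (@lebesgue_measure R).
Implicit Types (a b : R -> R).

Definition kcos (x y : R) : R := cos (2 * pi * x * y).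
Definition ksin (x y : R) : R := sin (2 * pi * x * y).

(** For real [a] the Fourier integral is [cosft a] - i [sinft a]. Plancherel's theorem is first
    proved for this pair of real transforms. *)
Definition cosft a xi := \int[mu]_x (a x * kcos x xi).
Definition sinft a xi := \int[mu]_x (a x * ksin x xi).

Lemma mkernel_phase : mkernel (fun x y : R => 2 * pi * x * y).
Proof.
rewrite /mkernel/=; apply: measurable_funM => //.
by apply: measurable_funM.
Qed.

Lemma mkernel_kcos : mkernel kcos.
Proof. exact: (measurableT_comp measurable_cos mkernel_phase). Qed.

Lemma mkernel_ksin : mkernel ksin.
Proof. exact: (measurableT_comp measurable_sin mkernel_phase). Qed.

Lemma kcos_le1 x y : `|kcos x y| <= 1.
Proof. by rewrite ler_norml cos_geN1 cos_le1. Qed.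

Lemma ksin_le1 x y : `|ksin x y| <= 1.
Proof. by rewrite ler_norml sin_geN1 sin_le1. Qed.

Lemma kcosC x y : kcos x y = kcos y x.
Proof. by rewrite /kcos mulrAC. Qed.

Lemma ksinC x y : ksin x y = ksin y x.
Proof. by rewrite /ksin mulrAC. Qed.

Lemma cosft_bounded a : integ a -> measurable_fun setT (cosft a) /\
  forall xi, `|cosft a xi| <= \int[mu]_x `|a x|.
Proof.
move=> ai; have [m b _] := kernel_Fubini mkernel_kcos kcos_le1 ai (@integ0 R).
by split=> // xi; rewrite -[leRHS]mul1r; exact: b.
Qed.

Lemma sinft_bounded a : integ a -> measurable_fun setT (sinft a) /\
  forall xi, `|sinft a xi| <= \int[mu]_x `|a x|.
Proof.
move=> ai; have [m b _] := kernel_Fubini mkernel_ksin ksin_le1 ai (@integ0 R).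
by split=> // xi; rewrite -[leRHS]mul1r; exact: b.
Qed.

Lemma integ_kcos a xi : integ a -> integ (fun x => a x * kcos x xi).
Proof.
by move=> ai; apply: (integ_mulb ai (mkernel2 xi mkernel_kcos) (fun x =>
  kcos_le1 x xi)).
Qed.

Lemma integ_ksin a xi : integ a -> integ (fun x => a x * ksin x xi).
Proof.
by move=> ai; apply: (integ_mulb ai (mkernel2 xi mkernel_ksin) (fun x =>
  ksin_le1 x xi)).
Qed.

Lemma cosftD a b xi : integ a -> integ b ->
  cosft (fun x => a x + b x) xi = cosft a xi + cosft b xi.
Proof.
move=> ai bi; rewrite -RintD; [|exact: integ_kcos|exact: integ_kcos].
by apply: eq_Rint => x; rewrite mulrDl.
Qed.

Lemma sinftD a b xi : integ a -> integ b ->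
  sinft (fun x => a x + b x) xi = sinft a xi + sinft b xi.
Proof.
move=> ai bi; rewrite -RintD; [|exact: integ_ksin|exact: integ_ksin].
by apply: eq_Rint => x; rewrite mulrDl.
Qed.

Lemma cosftZ (k : R) a xi : integ a -> cosft (fun x => k * a x) xi = k * cosft a xi.
Proof.
move=> ai; rewrite -RintZ; last exact: integ_kcos.
by apply: eq_Rint => x; rewrite mulrA.
Qed.

Lemma sinftZ (k : R) a xi : integ a -> sinft (fun x => k * a x) xi = k * sinft a xi.
Proof.
move=> ai; rewrite -RintZ; last exact: integ_ksin.
by apply: eq_Rint => x; rewrite mulrA.
Qed.

Lemma cosft_dual a b : integ a -> integ b ->
  \int[mu]_y (b y * cosft a y) = \int[mu]_x (a x * cosft b x).
Proof.
move=> ai bi; have [_ _ ->] := kernel_Fubini mkernel_kcos kcos_le1 ai bi.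
by apply: eq_Rint => x; congr (_ * _); apply: eq_Rint => y; rewrite kcosC.
Qed.

Lemma sinft_dual a b : integ a -> integ b ->
  \int[mu]_y (b y * sinft a y) = \int[mu]_x (a x * sinft b x).
Proof.
move=> ai bi; have [_ _ ->] := kernel_Fubini mkernel_ksin ksin_le1 ai bi.
by apply: eq_Rint => x; congr (_ * _); apply: eq_Rint => y; rewrite ksinC.
Qed.

(** The power spectrum |hat a|^2 of a real function. *)
Definition spectrum a xi := cosft a xi ^+ 2 + sinft a xi ^+ 2.

Lemma spectrum_ge0 a xi : 0 <= spectrum a xi.
Proof. by rewrite addr_ge0 ?sqr_ge0. Qed.

Lemma spectrum_measurable a : integ a -> measurable_fun setT (spectrum a).
Proof.
move=> ai; apply: measurable_funD; apply: measurable_funX.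
- exact: (cosft_bounded ai).1.
- exact: (sinft_bounded ai).1.
Qed.

Lemma spectrum_le a xi : integ a -> spectrum a xi <= 2 * (\int[mu]_x `|a x|) ^+ 2.
Proof.
move=> ai; have c := (cosft_bounded ai).2 xi; have s := (sinft_bounded ai).2 xi.
rewrite /spectrum -[cosft a xi ^+ 2]real_normK ?num_real// -[sinft a xi ^+
  2]real_normK ?num_real//.
have := normr_ge0 (cosft a xi); have := normr_ge0 (sinft a xi); nra.
Qed.

Lemma exp_weight_le1 d (x : R) : 0 < d -> exp_weight d x <= 1.
Proof. by move=> d0; rewrite -expR0 ler_expR oppr_le0 mulr_ge0// ltW. Qed.

Lemma integ_exp_weight_spectrum d a : 0 < d -> integ a -> integ (fun x =>
  exp_weight d x * spectrum a x).
Proof.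
move=> d0 ai; apply: (integ_mulb (integ_exp_weight d0) (spectrum_measurable ai)).
by move=> x; rewrite ger0_norm ?spectrum_ge0//; exact: spectrum_le.
Qed.

Definition smoothed d a x := \int[mu]_y (a y * poisson d (x - y)).

(** Two applications of the duality of the transforms bring the two copies of [a] outside. The
    kernels then combine by cos u cos v + sin u sin v = cos (u - v), and what remains inside is the
    transform of the weight at x - y. *)
Lemma Poisson_pairing d a : 0 < d -> integ a ->
  \int[mu]_x (exp_weight d x * spectrum a x) = \int[mu]_x (a x * smoothed d a x).
Proof.
move=> d0 ai.
have [mC bC] := cosft_bounded ai; have [mS bS] := sinft_bounded ai.
have gi : integ (fun xi => exp_weight d xi * cosft a xi) :=
  integ_mulb (integ_exp_weight d0) mC bC.
have hi : integ (fun xi => exp_weight d xi * sinft a xi) :=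
  integ_mulb (integ_exp_weight d0) mS bS.
transitivity (\int[mu]_x (exp_weight d x * cosft a x * cosft a x) + \int[mu]_x
  (exp_weight d x * sinft a x * sinft a x)).
  rewrite -RintD.
  - by apply: eq_Rint => x; rewrite /spectrum; ring.
  - exact: (integ_mulb gi mC bC).
  - exact: (integ_mulb hi mS bS).
rewrite cosft_dual// sinft_dual// -RintD; last 2 first.
- exact: (integ_mulb ai (cosft_bounded gi).1 (cosft_bounded gi).2).
- exact: (integ_mulb ai (sinft_bounded hi).1 (sinft_bounded hi).2).
apply: eq_Rint => x; rewrite -mulrDr; congr (_ * _).
have ci : integ (fun xi => exp_weight d xi * kcos x xi).
  exact: (integ_mulb (integ_exp_weight d0) (mkernel1 x mkernel_kcos) (kcos_le1 x)).
have si : integ (fun xi => exp_weight d xi * ksin x xi).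
  exact: (integ_mulb (integ_exp_weight d0) (mkernel1 x mkernel_ksin) (ksin_le1 x)).
transitivity (\int[mu]_y (a y * cosft (fun xi => exp_weight d xi * kcos x xi) y) +
   \int[mu]_y (a y * sinft (fun xi => exp_weight d xi * ksin x xi) y)).
  rewrite -cosft_dual// -sinft_dual//; congr (_ + _); apply: eq_Rint => y.
    by rewrite (kcosC x) mulrAC.
  by rewrite (ksinC x) mulrAC.
rewrite -RintD; last 2 first.
- exact: (integ_mulb ai (cosft_bounded ci).1 (cosft_bounded ci).2).
- exact: (integ_mulb ai (sinft_bounded si).1 (sinft_bounded si).2).
apply: eq_Rint => y; rewrite -mulrDr; congr (_ * _).
rewrite -(Rint_expcos _ d0) -RintD; [|exact: integ_kcos|exact: integ_ksin].
apply: eq_Rint => xi; rewrite -!mulrA -mulrDr; congr (_ * _).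
rewrite /kcos /ksin (_ : 2 * (pi * ((x - y) * xi)) = 2 * pi * x * xi - 2 * pi *
  xi * y).
  by rewrite cosB.
ring.
Qed.

(** Tonelli's theorem: the kernel is symmetric, so it has mass one in either variable. *)
Lemma Poisson_mass d a : 0 < d -> integ a -> (forall x, 0 <= a x) ->
  integ (smoothed d a) /\ \int[mu]_x smoothed d a x = \int[mu]_x a x.
Proof.
move=> d0 ai a0.
have mk : mkernel (fun y x : R => poisson d (x - y)).
  apply: (measurableT_comp (measurable_poisson d0)).
  by apply: measurable_funB.
have kb (y x : R) : `|poisson d (x - y)| <= 2 / d.
  by rewrite ger0_norm ?poisson_ge0// poisson_le.
have [mS _ _] := kernel_Fubini mk kb ai (@integ0 R).
have ii x : integ (fun y => a y * poisson d (x - y)).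
  exact: (integ_mulb ai (mkernel2 x mk) (fun y => kb y x)).
have S0 x : 0 <= smoothed d a x.
  by apply: Rint_ge0 => y; rewrite mulr_ge0// poisson_ge0.
have E : (\int[mu]_x (smoothed d a x)%:E = (\int[mu]_x a x)%:E)%E.
  transitivity (\int[mu]_x \int[mu]_y (a y * poisson d (x - y))%:E)%E.
    by apply: eq_integral => x _; rewrite integ_EFin.
  pose F (z : R * R) : \bar R := (a z.2 * poisson d (z.1 - z.2))%:E.
  have mF : measurable_fun setT F.
    apply/measurable_EFinP; apply: measurable_funM.
      exact: (measurableT_comp (integ_measurable ai)).
    by apply: (measurableT_comp (measurable_poisson d0)); exact: measurable_funB.
  have F0 z : (0 <= F z)%E by rewrite lee_fin mulr_ge0// poisson_ge0.
  have := @fubini_tonelli _ _ _ _ _ mu mu F mF F0; rewrite /F/= => ->.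
  rewrite -integ_EFin//; apply: eq_integral => y _.
  have e (x : R) : poisson d (y - x) = poisson d (x - y) by rewrite
    -poisson_even opprB.
  have [pi_ pe] := Rint_poisson y d0.
  have pi2 : integ (fun x => poisson d (x - y)) by apply: (eq_integ _ pi_).
  rewrite integ_EFin; last exact: integZ.
  by rewrite RintZ// -(eq_Rint e) pe mulr1.
split; first by apply: ge0_integP => //; rewrite E ltry.
have Si : integ (smoothed d a) by apply: ge0_integP => //; rewrite E ltry.
by apply: EFin_inj; rewrite -integ_EFin.
Qed.

Definition L1L2 a := integ a /\ sqi a.

(** Both marginals of the kernel are one, so the average of a(x)^2 and a(y)^2 against it integrates
    to |a|^2. *)
Lemma Poisson_pairing_le d a : 0 < d -> L1L2 a ->
  \int[mu]_x (exp_weight d x * spectrum a x) <= \int[mu]_x (a x ^+ 2).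
Proof.
move=> d0 [ai as_]; rewrite Poisson_pairing//.
have sq0 x : 0 <= a x ^+ 2 by exact: sqr_ge0.
have [vi ve] := Poisson_mass d0 as_.2 sq0.
set v := smoothed d _ in vi ve.
have mk : mkernel (fun y x : R => poisson d (x - y)).
  by apply: (measurableT_comp (measurable_poisson d0)); exact: measurable_funB.
have kb (y x : R) : `|poisson d (x - y)| <= 2 / d.
  by rewrite ger0_norm ?poisson_ge0// poisson_le.
have [mS bS _] := kernel_Fubini mk kb ai (@integ0 R).
have i2 : integ (fun x => 2^-1 * (a x ^+ 2 + v x)).
  by apply: integZ; apply: integD => //; exact: as_.2.
apply: (@le_trans _ _ (\int[mu]_x (2^-1 * (a x ^+ 2 + v x)))); last first.
  by rewrite RintZ ?RintD ?ve//; [lra|exact: as_.2|apply: integD => //;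
    exact: as_.2].
apply: le_Rint => // [|x].
  exact: (integ_mulb ai mS bS).
have [pi_ pe] := Rint_poisson x d0.
have ii : integ (fun y => a y * poisson d (x - y)).
  exact: (integ_mulb ai (mkernel2 x mk) (fun y => kb y x)).
have ii2 : integ (fun y => a y ^+ 2 * poisson d (x - y)).
  exact: (integ_mulb as_.2 (mkernel2 x mk) (fun y => kb y x)).
have i3 : integ (fun y => a x ^+ 2 * poisson d (x - y)) := integZ (a x ^+ 2) pi_.
have i23 := integD i3 ii2.
rewrite /smoothed -RintZ//.
have -> : 2^-1 * (a x ^+ 2 + v x) =
   \int[mu]_y (2^-1 * (a x ^+ 2 * poisson d (x - y) + a y ^+ 2 * poisson d (x -
     y))).
  by rewrite (RintZ _ i23) (RintD i3 ii2) (RintZ _ pi_) pe mulr1.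
apply: le_Rint; [exact: integZ|exact: integZ|].
(* AM-GM: [2 a(x) a(y) <= a(x)^2 + a(y)^2] *)
move=> y; have := poisson_ge0 (x - y) d0; have := sqr_ge0 (a x - a y); nra.
Qed.

Lemma exp_weight_cvg1 (x : R) : exp_weight n.+1%:R^-1 x @[n --> \oo] --> (1 : R).
Proof.
rewrite -[X in _ --> X](@expR0 R).
have h : - (n.+1%:R^-1 * `|x|) @[n --> \oo] --> (0 : R).
  rewrite -[X in _ --> X]oppr0 -[X in _ --> - X](mul0r `|x|).
  have h0 : (n.+1%:R^-1 : R) @[n --> \oo] --> (0 : R) by exact: (@cvg_harmonic R).
  by apply: cvgN; apply: cvgM; [exact: h0|exact: cvg_cst].
exact: (cvg_comp _ _ h (@continuous_expR R 0)).
Qed.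

(** Monotone convergence, the weight increasing to 1 as d = 1/(n+1) decreases. The inequality
    already makes the transforms square integrable, which the proof of the equality relies on. *)
Lemma Bessel_real a : L1L2 a ->
  integ (spectrum a) /\ \int[mu]_x spectrum a x <= \int[mu]_x (a x ^+ 2).
Proof.
move=> [ai as_].
pose f n x := exp_weight n.+1%:R^-1 x * spectrum a x.
have n0 (n : nat) : 0 < n.+1%:R^-1 :> R by rewrite invr_gt0.
have E : (\int[mu]_x (spectrum a x)%:E <= (\int[mu]_x (a x ^+ 2))%:E)%E.
  have h := @cvg_monotone_convergence _ _ _ mu setT measurableT
    (fun n => EFin \o f n).
  have fl x : (f n x)%:E @[n --> \oo] --> (spectrum a x)%:E.
    apply: cvg_seq_EFin.
    rewrite -[X in _ --> X]mul1r; apply: cvgM;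
      [exact: exp_weight_cvg1|exact: cvg_cst].
  have {}h : (\int[mu]_x (f n x)%:E @[n --> \oo] --> \int[mu]_x (spectrum a
    x)%:E)%E.
    rewrite (_ : (\int[mu]_x (spectrum a x)%:E)%E =
      (\int[mu]_x (limn ((fun n => EFin \o f n)^~ x)))%E); last first.
      apply: eq_integral => x _; apply/esym/cvg_lim => //; exact: fl.
    apply: h.
    - move=> n; apply/measurable_EFinP/measurable_funM;
        first exact: measurable_exp_weight.
      exact: spectrum_measurable.
    - by move=> n x _; rewrite lee_fin mulr_ge0 ?expR_ge0 ?spectrum_ge0.
    - move=> x _ m n mn; rewrite lee_fin ler_wpM2r ?spectrum_ge0// ler_expR lerN2.
      by rewrite ler_wpM2r// lef_pV2 ?posrE ?ltr0n// ler_nat.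
  rewrite -(cvg_lim _ h)//; apply: lime_le; first by apply/cvg_ex; eexists;
    exact: h.
  apply: nearW => n; rewrite integ_EFin; last exact: integ_exp_weight_spectrum.
  by rewrite lee_fin Poisson_pairing_le.
have pi_ : integ (spectrum a).
  apply: ge0_integP; [exact: spectrum_measurable|exact: spectrum_ge0|].
  by rewrite (le_lt_trans E)// ltry.
by split=> //; rewrite -lee_fin -integ_EFin.
Qed.

End RealPlancherel.

(** * The reverse inequality: continuity points and stability under L^2 limits *)

Section PlancherelApproximation.
Context {R : realType}.
Local Notation mu := (@lebesgue_measure R).
Implicit Types (a b : R -> R).

Lemma bounded_sqi a (M : R) : (forall x, `|a x| <= M) -> integ a -> sqi a.
Proof.
move=> aM ai; have ma := integ_measurable ai; split => //.
by apply: (eq_integ _ (integ_mulb ai ma aM)) => x; rewrite expr2.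
Qed.

Lemma smoothed_le d a (M : R) x : 0 < d -> measurable_fun setT a ->
  (forall y, `|a y| <= M) -> `|smoothed d a x| <= M.
Proof.
move=> d0 ma aM; have [pi_ pe] := Rint_poisson x d0.
have [ii _] := Rint_poisson_shift x d0 ma aM.
rewrite -[leRHS]mulr1 -pe -RintZ//.
apply: norm_Rint_le => //; first exact: integZ.
by move=> y; rewrite normrM (ger0_norm (poisson_ge0 _ d0)) ler_wpM2r ?poisson_ge0.
Qed.

Lemma smoothed_cvg a (M : R) x : measurable_fun setT a ->
  (forall y, `|a y| <= M) -> {for x, continuous a} ->
  smoothed n.+1%:R^-1 a x @[n --> \oo] --> a x.
Proof.
move=> ma aM ca.
have n0 (n : nat) : 0 < n.+1%:R^-1 :> R by rewrite invr_gt0.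
have [ci ce] := @Rint_cauchy R.
have ip : integ (fun t : R => pi^-1 * (1 + t ^+ 2)^-1) := integZ _ ci.
have p0 t : 0 <= pi^-1 * (1 + t ^+ 2)^-1 :> R.
  by apply: mulr_ge0; rewrite invr_ge0 ?pi_ge0// addr_ge0// sqr_ge0.
have e1 : \int[mu]_t (a x * (pi^-1 * (1 + t ^+ 2)^-1)) = a x.
  by rewrite RintZ// RintZ// ce mulVf ?mulr1// gt_eqF ?pi_gt0.
have e2 n : smoothed n.+1%:R^-1 a x =
   \int[mu]_t (a (n.+1%:R^-1 / (2 * pi) * t + x) * (pi^-1 * (1 + t ^+ 2)^-1)).
  by have [_ <-] := Rint_poisson_shift x (n0 n) ma aM.
rewrite -[X in _ --> X]e1; under eq_fun do rewrite e2.
suff [] : integ (fun t => a x * (pi^-1 * (1 + t ^+ 2)^-1)) /\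
  \int[mu]_t (a (n.+1%:R^-1 / (2 * pi) * t + x) * (pi^-1 * (1 + t ^+ 2)^-1))
    @[n --> \oo] --> \int[mu]_t (a x * (pi^-1 * (1 + t ^+ 2)^-1)) by [].
apply: (Rint_dct (g := fun t => M * (pi^-1 * (1 + t ^+ 2)^-1))).
- move=> n; apply: measurable_funM; last exact: integ_measurable.
  by apply: (measurableT_comp ma); exact: measurable_affine.
- exact: (measurable_funM (measurable_cst _) (integ_measurable ip)).
- apply: aeW => t; apply: cvgM; last exact: cvg_cst.
  have h : n.+1%:R^-1 / (2 * pi) * t + x @[n --> \oo] --> (x : R).
    rewrite -[X in _ --> X]add0r; apply: cvgD; last exact: cvg_cst.
    rewrite -(mul0r t); apply: cvgM; last exact: cvg_cst.
    rewrite -(mul0r (2 * pi)^-1); apply: cvgM; last exact: cvg_cst.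
    exact: (@cvg_harmonic R).
  exact: (cvg_comp _ _ h ca).
- exact: integZ.
- by move=> n t; rewrite normrM (ger0_norm (p0 t)) ler_wpM2r.
Qed.

(** In the Poisson pairing the weight is at most 1, so the left side never exceeds the integral of
    the spectrum. The smoothed function tends to [a] at each continuity point, and M |a| dominates
    the right side, which therefore tends to |a|^2. *)
Lemma Plancherel_ae_continuous a (M : R) : integ a -> (forall y, `|a y| <= M) ->
  {ae mu, forall x, {for x, continuous a}} ->
  \int[mu]_x (a x ^+ 2) <= \int[mu]_x spectrum a x.
Proof.
move=> ai aM ca; have ma := integ_measurable ai.
have n0 (n : nat) : 0 < n.+1%:R^-1 :> R by rewrite invr_gt0.
have as_ := bounded_sqi aM ai.
have [pi_ _] := Bessel_real (conj ai as_).
have mk d : 0 < d -> mkernel (fun y x : R => poisson d (x - y)).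
  by move=> d0; apply: (measurableT_comp (measurable_poisson d0));
    exact: measurable_funB.
have kb d (y x : R) : 0 < d -> `|poisson d (x - y)| <= 2 / d.
  by move=> d0; rewrite ger0_norm ?poisson_ge0// poisson_le.
have [_ h] : integ (fun x => a x * a x) /\
   \int[mu]_x (a x * smoothed n.+1%:R^-1 a x) @[n --> \oo] -->
   \int[mu]_x (a x * a x).
  apply: (Rint_dct (g := fun x => M * `|a x|)).
  - move=> n; apply: measurable_funM => //.
    by have [] := kernel_Fubini (mk _ (n0 n)) (fun y x =>
      kb _ y x (n0 n)) ai (@integ0 R).
  - exact: measurable_funM.
  - apply: aeS ca => x cx; apply: cvgM; first exact: cvg_cst.
    exact: smoothed_cvg ma aM cx.
  - exact/integZ/integ_norm.
  - by move=> n x; rewrite normrM mulrC ler_wpM2r// smoothed_le.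
rewrite (eq_Rint (g := fun x => a x * a x)); last by move=> x; rewrite expr2.
rewrite -(cvg_lim _ h)//; apply: limr_le; first by apply/cvg_ex; eexists; exact: h.
apply: nearW => n; rewrite -Poisson_pairing//.
apply: le_Rint => //; first exact: integ_exp_weight_spectrum.
by move=> x; rewrite ler_piMl ?spectrum_ge0// exp_weight_le1.
Qed.

Lemma Bessel_approx a b : L1L2 a -> L1L2 b ->
  \int[mu]_x (b x ^+ 2) <= \int[mu]_x spectrum b x ->
  \int[mu]_x (a x ^+ 2) - \int[mu]_x spectrum a x <=
  2 * \int[mu]_x ((a x - b x) ^+ 2).
Proof.
(* parallelogram law for the nonnegative form [|a|^2 - |Fa|^2] *)
move=> la lb eb.
have lN c : L1L2 c -> L1L2 (fun x => - c x).
  by move=> [ci cs]; split; [exact: integN|exact: sqiN].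
have lD c c' : L1L2 c -> L1L2 c' -> L1L2 (fun x => c x + c' x).
  by move=> [ci cs] [ci' cs']; split; [exact: integD|exact: sqiD].
have lZ k c : L1L2 c -> L1L2 (fun x => k * c x).
  by move=> [ci cs]; split; [exact: integZ|exact: sqiZ].
pose c x := a x - b x; have lc : L1L2 c by apply: lD => //; exact: lN.
(* Here a = b + c and e = b - c. The form is nonpositive at b by hypothesis, nonnegative at e by
   Bessel, and at most |c|^2 at c. *)
pose e x := -1 * c x + b x; have le_ : L1L2 e by apply: lD => //; exact: lZ.
have [pa _] := Bessel_real la; have [pb _] := Bessel_real lb.
have [pc hc] := Bessel_real lc; have [pe he] := Bessel_real le_.
have i2 (f : R -> R) : L1L2 f -> integ (fun x => f x ^+ 2) by move=> [_ []].
have e1 : \int[mu]_x (a x ^+ 2) + \int[mu]_x (e x ^+ 2) =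
   2 * (\int[mu]_x (b x ^+ 2) + \int[mu]_x (c x ^+ 2)).
  rewrite -(RintD (i2 _ la) (i2 _ le_)) -(RintD (i2 _ lb) (i2 _ lc)).
  rewrite -(RintZ _ (integD (i2 _ lb) (i2 _ lc))).
  by apply: eq_Rint => x; rewrite /e /c; ring.
have e2 : \int[mu]_x spectrum a x + \int[mu]_x spectrum e x =
   2 * (\int[mu]_x spectrum b x + \int[mu]_x spectrum c x).
  rewrite -(RintD pa pe) -(RintD pb pc) -(RintZ _ (integD pb pc)).
  have pE x : spectrum a x = (cosft c x + cosft b x) ^+ 2 + (sinft c x + sinft
    b x) ^+ 2.
    rewrite -cosftD -?sinftD; [|exact: lc.1|exact: lb.1|exact: lc.1|exact: lb.1].
    by congr (spectrum _ x); apply/funext => y; rewrite /c subrK.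
  have eE x : spectrum e x = (-1 * cosft c x + cosft b x) ^+ 2 + (-1 * sinft c
    x + sinft b x) ^+ 2.
    rewrite -(cosftZ _ _ lc.1) -(sinftZ _ _ lc.1).
    by rewrite -(cosftD _ (integZ _ lc.1) lb.1) -(sinftD _ (integZ _ lc.1) lb.1).
  by apply: eq_Rint => x; rewrite pE eE /spectrum; ring.
have p0 : 0 <= \int[mu]_x spectrum c x by apply: Rint_ge0 => x; exact: spectrum_ge0.
have alg (Ia Ie Ib Ic Pa Pe Pb Pc : R) : Ia + Ie = 2 * (Ib + Ic) ->
  Pa + Pe = 2 * (Pb + Pc) -> Ib <= Pb -> Pe <= Ie -> 0 <= Pc -> Ia - Pa <= 2 * Ic.
  by lra.
exact: alg e1 e2 eb he p0.
Qed.

(** By [Bessel_approx] the defect of [a] is at most twice its squared distance to a function without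
    defect; hence the tolerance e / 2. *)
Lemma Plancherel_closure a : L1L2 a ->
  (forall e, 0 < e -> exists b, [/\ L1L2 b,
     \int[mu]_x (b x ^+ 2) <= \int[mu]_x spectrum b x &
     \int[mu]_x ((a x - b x) ^+ 2) <= e]) ->
  \int[mu]_x (a x ^+ 2) <= \int[mu]_x spectrum a x.
Proof.
move=> la h; apply/ler_addgt0Pr => e e0.
have [b [lb eb ab]] := h (e / 2) (divr_gt0 e0 (ltr0Sn _ 1)).
rewrite -lerBlDl; apply: (le_trans (Bessel_approx la lb eb)).
by rewrite mulrC -ler_pdivlMr.
Qed.

End PlancherelApproximation.

(** * Density of the functions continuous almost everywhere *)

Section PlancherelDensity.
Context {R : realType}.
Local Notation mu := (@lebesgue_measure R).
Implicit Types (a b : R -> R).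

(** For M >= 0, truncation of t to [-M, M], in a form whose continuity is immediate. *)
Definition clip (M t : R) : R := (`|t + M| - `|t - M|) / 2.

Lemma clip_le M t : 0 <= M -> `|clip M t| <= M.
Proof.
move=> M0; rewrite /clip ler_norml.
by case: (ger0P (t + M)) => h1; case: (ger0P (t - M)) => h2; apply/andP; split; lra.
Qed.

Lemma clip_dist M s t : `|s| <= M -> `|s - clip M t| <= `|s - t|.
Proof.
rewrite ler_norml => /andP[s1 s2]; rewrite /clip.
case: (ger0P (t + M)) => h1; case: (ger0P (t - M)) => h2;
 case: (ger0P (s - t)) => h3; rewrite ler_norml; apply/andP; split; lra.
Qed.

Lemma continuous_clip M : continuous (clip M).
Proof.
move=> t; apply: cvgM; last exact: cvg_cst.
apply: cvgB; apply: cvg_norm; (apply: cvgD; [exact: cvg_id|exact: cvg_cst]).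
Qed.

Lemma indic_le1 (E : set R) x : `|\1_E x| <= 1 :> R.
Proof. by rewrite indicE; case: (_ \in _); rewrite ?normr1// normr0. Qed.

Lemma integ_itv (M : R) : integ (\1_(`[- M, M]%classic) : R -> R).
Proof. exact: integrable_indic_itv. Qed.

(** A continuous approximation of [a] in L^1, clipped to [-M, M] in value and cut off to [-M, M] in
    support, is bounded, integrable and continuous outside two points. Boundedness turns the L^1
    error into an L^2 error. *)
Lemma Plancherel_bounded a (M : R) : 0 < M -> measurable_fun setT a ->
  (forall x, `|a x| <= M) -> (forall x, M < `|x| -> a x = 0) ->
  \int[mu]_x (a x ^+ 2) <= \int[mu]_x spectrum a x.
Proof.
move=> M0 ma aM a0; pose E := `[- M, M]%classic : set R.
have mE : measurable E by exact: measurable_itv.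
have EP x : E x <-> `|x| <= M by rewrite /E/= in_itv/= -ler_norml.
have out x : x \notin E -> a x = 0.
  by rewrite notin_setE EP => /negP; rewrite -ltNge; exact: a0.
have ai : integ a.
  apply: (eq_integ _ (integ_mulb (integ_itv M) ma aM)) => x.
  rewrite indicE; case: (boolP (x \in E)) => xE; first by rewrite mul1r.
  by rewrite mul0r out.
have la : L1L2 a by split=> //; exact: bounded_sqi aM ai.
apply: Plancherel_closure => // e e0.
have muE : (mu E < +oo)%E.
  by rewrite lebesgue_measure_itv/=; case: ifPn => _; rewrite ?ltry// -EFinD ltry.
have aiE : mu.-integrable E (EFin \o a).
  by apply: (@integrableS _ _ _ mu setT) => //; exact: ai.
have [g_ [cg gi hg]] := approximation_continuous_integrable mE muE aiE.
(* The L^1 tolerance, as |a - b|^2 <= 2 M |a - g| will hold for the clipped function b. *)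
have e1 : 0 < e / (2 * M) by rewrite divr_gt0// mulr_gt0.
have [n hn] : exists n, (\int[mu]_(z in E) `|(a z - g_ n z)%:E| <= (e / (2 *
  M))%:E)%E.
  move/fine_cvgP : hg => [fin /cvgrPdist_le /(_ _ e1) h].
  have [n [fn hn]] : exists n, (\int[mu]_(z in E) `|(a z - g_ n z)%:E|)%E \is a
    fin_num
     /\ `|0 - fine (\int[mu]_(z in E) `|(a z - g_ n z)%:E|)%E| <= e / (2 * M).
    have := @filter_ex _ \oo _ _ (filterI fin h); by case=> n [? ?]; exists n.
  exists n; rewrite -(fineK fn) lee_fin; move: hn; rewrite sub0r normrN.
  by apply: le_trans; exact: ler_norm.
pose g := g_ n; pose b x := clip M (g x) * \1_E x.
have mg : measurable_fun setT g by apply: continuous_measurable_fun; exact: cg.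
have mclip : measurable_fun setT (fun x => clip M (g x)).
  by apply: (measurableT_comp _ mg); apply: continuous_measurable_fun;
    exact: continuous_clip.
have bi : integ b.
  apply: (eq_integ _ (integ_mulb (integ_itv M) mclip (fun x =>
    clip_le _ (ltW M0)))) => x.
  by rewrite mulrC.
have bM x : `|b x| <= M.
  rewrite normrM -[leRHS]mulr1; apply: ler_pM => //; first exact: clip_le (ltW M0).
  exact: indic_le1.
exists b; split.
- by split=> //; exact: bounded_sqi bM bi.
- apply: (Plancherel_ae_continuous bi bM).
  (* The cut-off can be discontinuous only at the two ends, a null set. *)
  exists [set - M; M]; split.
  - by apply: measurableU.
  - apply/eqP; rewrite eq_le measure_ge0 andbT.
    apply: (le_trans (measureU2 _ _ _)) => //.
    by rewrite -[leLHS]/(mu [set (- M : R)%R] + mu [set (M : R)%R])%E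
      !lebesgue_measure_set1 adde0.
  - move=> x /= nc; apply: contrapT => /not_orP[/eqP x1 /eqP x2]; apply: nc.
    have cc : {for x, continuous (fun x => clip M (g x))}.
      exact: (continuous_comp (cg n x) (@continuous_clip M (g x))).
    have hn' : `|y| @[y --> x] --> `|x| by apply: cvg_norm; exact: cvg_id.
    have [xM|xM|xM] := ltgtP `|x| M.
    + have E1 : \1_E y @[y --> x] --> (\1_E x : R).
        apply: cvg_near_cst.
        have : \forall y \near x, `|y| < M.
          exact: (cvgr_lt `|x| hn' _ xM).
        apply: filterS => y yM; rewrite !indicE !mem_set//; apply/EP; exact: ltW.
      exact: cvgM cc E1.
    + have E1 : \1_E y @[y --> x] --> (\1_E x : R).
        apply: cvg_near_cst.
        have : \forall y \near x, M < `|y|.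
          exact: (cvgr_gt `|x| hn' _ xM).
        apply: filterS => y yM; rewrite !indicE !memNset//; apply/EP/negP;
          by rewrite -ltNge.
      exact: cvgM cc E1.
    + exfalso; move: xM x1 x2; case: (ger0P x) => _ <-; rewrite ?opprK eqxx//.
- have sq : sqi (fun x => a x - b x).
    by apply: sqiB; [exact: la.2|exact: bounded_sqi bM bi].
  rewrite -lee_fin -integ_EFin; last exact: sq.2.
  apply: (@le_trans _ _ (\int[mu]_(x in E) ((2 * M)%:E * `|(a x - g
    x)%:E|))%E); last first.
    rewrite ge0_integralZl//; last 2 first.
    - do 2 apply: measurableT_comp => //; apply: measurable_funB => //.
      + exact: measurable_funTS.
      + exact: measurable_funTS.
    - by rewrite lee_fin mulr_ge0// ltW.
    apply: (@le_trans _ _ ((2 * M)%:E * (e / (2 * M))%:E)%E).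
      by rewrite lee_pmul2l ?lte_fin ?mulr_gt0.
    by rewrite -EFinM lee_fin mulrC divfK// gt_eqF// mulr_gt0.
  rewrite [leRHS]integral_mkcond; apply: ge0_le_integral => //.
  + by move=> x _; rewrite lee_fin sqr_ge0.
  + by apply/measurable_EFinP; exact: (integ_measurable sq.2).
  + apply/(measurable_restrictT _ _).1 => //.
    apply: emeasurable_funM => //; do 2 apply: measurableT_comp => //;
      apply: measurable_funB => //.
    * exact: measurable_funTS.
    * exact: measurable_funTS.
  + move=> x _; rewrite patchE; case: ifPn => xE; last first.
      by rewrite out// /b indicE (negbTE xE) mulr0 subrr expr0n.
    have hb : `|a x - b x| <= `|a x - g x|.
      by rewrite /b indicE xE mulr1 clip_dist.
    have h2 : `|a x - b x| <= 2 * M.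
      by rewrite (le_trans (ler_normB _ _))// mulr2n mulrDl mul1r lerD.
    rewrite -EFinM lee_fin -real_normK ?num_real// expr2.
    by apply: ler_pM.
Qed.

Lemma indic_cvg_sqr a (A : nat -> set R) : sqi a -> (forall n, measurable (A n)) ->
  (forall x, \forall n \near \oo, A n x) ->
  \int[mu]_x ((a x - a x * \1_(A n) x) ^+ 2) @[n --> \oo] --> (0 : R).
Proof.
move=> as_ mA Ax; rewrite -(@Rint0 R).
suff [] : integ (fun _ : R => 0 : R) /\
  \int[mu]_x ((a x - a x * \1_(A n) x) ^+ 2) @[n --> \oo] --> \int[mu]_x (0 :
    R) by [].
apply: (Rint_dct (g := fun x => a x ^+ 2)).
- move=> n; apply: measurable_funX; apply: measurable_funB; first exact: as_.1.
  by apply: measurable_funM; [exact: as_.1|exact: measurable_indic].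
- exact: measurable_cst.
- apply: aeW => x; apply: cvg_near_cst; apply: filterS (Ax x) => n Anx.
  by rewrite indicE mem_set// mulr1 subrr expr0n.
- exact: as_.2.
- move=> n x; rewrite indicE; case: (_ \in _); rewrite ?mulr1 ?mulr0 ?subrr ?subr0.
    by rewrite expr0n normr0 sqr_ge0.
  by rewrite ger0_norm// sqr_ge0.
Qed.

Theorem Plancherel_real a : L1L2 a ->
  integ (spectrum a) /\ \int[mu]_x spectrum a x = \int[mu]_x (a x ^+ 2).
Proof.
move=> la; have [ip h] := Bessel_real la; split=> //.
apply/eqP; rewrite eq_le h/=; have ma := la.2.1.
apply: Plancherel_closure => // e e0.
(* Cutting the support and the values at the same level n lets [Plancherel_bounded] apply with M =
   n. *)
pose A (n : nat) := `[- n%:R, n%:R]%classic `&` a @^-1` `[- n%:R, n%:R]%classic.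
have AP n x : A n x <-> `|x| <= n%:R /\ `|a x| <= n%:R.
  by rewrite /A /= !in_itv/= !ler_norml.
have mA n : measurable (A n).
  apply: measurableI; first exact: measurable_itv.
  by rewrite -[X in measurable X]setTI; apply: ma => //; exact: measurable_itv.
have Ax x : \forall n \near \oo, A n x.
  near=> n; apply/AP; split.
  - near: n; exact: nbhs_infty_ger.
  - near: n; exact: nbhs_infty_ger.
have hc := indic_cvg_sqr la.2 mA Ax.
have [n [n0 hn]] : exists n, (0 < n)%N /\
    \int[mu]_x ((a x - a x * \1_(A n) x) ^+ 2) <= e.
  move/cvgrPdist_le : hc => /(_ _ e0) hc.
  have [n [n0 hn]] := @filter_ex _ \oo _ _ (filterI (nbhs_infty_gt 0) hc).
  exists n; split => //; move: hn; rewrite sub0r normrN; apply: le_trans.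
  exact: ler_norm.
have mind : measurable_fun setT (\1_(A n) : R -> R) by exact: measurable_indic.
exists (fun x => a x * \1_(A n) x); split => //.
- split; first exact: (integ_mulb la.1 mind (indic_le1 _)).
  exact: (sqi_mulb la.2 mind (indic_le1 _)).
- apply: (@Plancherel_bounded _ n%:R); first by rewrite ltr0n.
  + by apply: measurable_funM.
  + move=> x; rewrite indicE; case: (boolP (x \in A n)) => [|_].
      by rewrite inE AP mulr1 => -[].
    by rewrite mulr0 normr0.
  + move=> x xn; rewrite indicE memNset ?mulr0// => /AP[]; by rewrite leNgt xn.
Unshelve. all: by end_near. Qed.

End PlancherelDensity.

(** * Complex square-integrable functions *)

Section ComplexL2.
Context {R : realType}.
Local Open Scope complex_scope.
Local Notation mu := (@lebesgue_measure R).
Implicit Types (f g h : R -> R[i]) (z w : R[i]).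
Local Notation Re := complex.Re.
Local Notation Im := complex.Im.
Local Notation ReR := (@complex.Re R).
Local Notation ImR := (@complex.Im R).

Lemma cReD z w : Re (z + w) = Re z + Re w. Proof. by case: z w => ? ? []. Qed.
Lemma cImD z w : Im (z + w) = Im z + Im w. Proof. by case: z w => ? ? []. Qed.
Lemma cReN z : Re (- z) = - Re z. Proof. by case: z. Qed.
Lemma cImN z : Im (- z) = - Im z. Proof. by case: z. Qed.
Lemma cReB z w : Re (z - w) = Re z - Re w. Proof. by rewrite cReD cReN. Qed.
Lemma cImB z w : Im (z - w) = Im z - Im w. Proof. by rewrite cImD cImN. Qed.
Lemma cReM z w : Re (z * w) = Re z * Re w - Im z * Im w.
Proof. by case: z w => ? ? []. Qed.
Lemma cImM z w : Im (z * w) = Re z * Im w + Im z * Re w.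
Proof. by case: z w => ? ? []. Qed.
Lemma cReC z : Re (z^*) = Re z. Proof. by case: z. Qed.
Lemma cImC z : Im (z^*) = - Im z. Proof. by case: z. Qed.

Definition complex_simp := (cReD, cImD, cReN, cImN, cReM, cImM, cReC, cImC).

Lemma complexP z w : Re z = Re w -> Im z = Im w -> z = w.
Proof. by case: z w => ? ? [? ?] /= -> ->. Qed.

Definition re f x := Re (f x).
Definition im f x := Im (f x).

Definition nrm2 f := \int[mu]_x (re f x ^+ 2 + im f x ^+ 2).

Lemma normc_sqr z : Normc.normc z ^+ 2 = Re z ^+ 2 + Im z ^+ 2.
Proof. by case: z => a b /=; rewrite sqr_sqrtr// addr_ge0 ?sqr_ge0. Qed.

Lemma normc_ge0 z : 0 <= Normc.normc z.
Proof. by case: z => a b /=; exact: sqrtr_ge0. Qed.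

Lemma L2norm_unfold f :
  L2norm f = ((\int[mu]_x (re f x ^+ 2 + im f x ^+ 2)%:E) `^ (2^-1))%E.
Proof.
rewrite /L2norm unlock /Lnorm; congr (_ `^ _)%E; apply: eq_integral => x _.
rewrite abse_EFin ger0_norm ?normc_ge0// poweR_EFin.
by rewrite powR_mulrn ?normc_ge0// normc_sqr.
Qed.

Lemma L2P f : L2 f <-> sqi (re f) /\ sqi (im f).
Proof.
have m0 x : 0 <= re f x ^+ 2 + im f x ^+ 2 by rewrite addr_ge0 ?sqr_ge0.
split=> [[mr mi foo]|[[mr ir] [mi ii]]].
  have ms : measurable_fun setT (fun x => re f x ^+ 2 + im f x ^+ 2).
    by apply: measurable_funD; apply: measurable_funX.
  have ints : integ (fun x => re f x ^+ 2 + im f x ^+ 2).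
    apply: ge0_integP => //; move: foo; rewrite L2norm_unfold.
    have : (0 <= \int[mu]_x (re f x ^+ 2 + im f x ^+ 2)%:E)%E.
      by apply: integral_ge0 => x _; rewrite lee_fin.
    case: (\int[mu]_x _)%E => [r _ _|_|]//.
    - by rewrite ltry.
    - by rewrite poweRyr// invr_eq0 pnatr_eq0.
  split; split => //; apply: (integ_le _ _ ints).
  - exact: measurable_funX.
  - by move=> x; rewrite ger0_norm ?sqr_ge0// lerDl sqr_ge0.
  - exact: measurable_funX.
  - by move=> x; rewrite ger0_norm ?sqr_ge0// lerDr sqr_ge0.
split=> //; rewrite L2norm_unfold integ_EFin; last exact: integD.
by rewrite poweR_EFin ltry.
Qed.

Lemma nrm2_integ f : L2 f -> integ (fun x => re f x ^+ 2 + im f x ^+ 2).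
Proof. by move=> /L2P[[_ h] [_ k]]; exact: integD. Qed.

Lemma nrm2E f : L2 f ->
  nrm2 f = \int[mu]_x (re f x ^+ 2) + \int[mu]_x (im f x ^+ 2).
Proof. by move=> /L2P[[_ h] [_ k]]; exact: RintD. Qed.

Lemma nrm2_ge0 f : 0 <= nrm2 f.
Proof. by apply: Rint_ge0 => x; rewrite addr_ge0 ?sqr_ge0. Qed.

Lemma L2norm_sqrt f : L2 f -> L2norm f = (Num.sqrt (nrm2 f))%:E.
Proof.
move=> fL; rewrite L2norm_unfold integ_EFin; last exact: nrm2_integ.
by rewrite poweR_EFin powR12_sqrt// nrm2_ge0.
Qed.

Lemma L2norm_cvg0P (u : nat -> R -> R[i]) : (forall n, L2 (u n)) ->
  (L2norm (u n) @[n --> \oo] --> 0%E) <-> (nrm2 (u n) @[n --> \oo] --> (0 : R)).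
Proof.
move=> uL; under eq_fun do rewrite L2norm_sqrt//.
split=> [/fine_cvg h|h].
- have {}h : Num.sqrt (nrm2 (u n)) @[n --> \oo] --> (0 : R) by exact: h.
  rewrite (_ : (fun n => nrm2 (u n)) =
    (fun n => Num.sqrt (nrm2 (u n)) * Num.sqrt (nrm2 (u n)))); last first.
    by apply/funext => n; rewrite -expr2 sqr_sqrtr// nrm2_ge0.
  by rewrite -(mulr0 (0 : R)); exact: cvgM.
- apply: cvg_seq_EFin; rewrite -(@sqrtr0 R).
  exact: (cvg_comp _ _ h (@sqrt_continuous R 0)).
Qed.

Lemma L2D f g : L2 f -> L2 g -> L2 (fun x => f x + g x).
Proof.
move=> /L2P[fr fi] /L2P[gr gi]; apply/L2P; split.
  by rewrite (_ : re _ = fun x => re f x + re g x);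
    [exact: sqiD|apply/funext => x; exact: cReD].
by rewrite (_ : im _ = fun x => im f x + im g x);
  [exact: sqiD|apply/funext => x; exact: cImD].
Qed.

Lemma L2Z (c : R[i]) f : L2 f -> L2 (fun x => c * f x).
Proof.
move=> /L2P[fr fi]; apply/L2P; split.
  rewrite (_ : re _ = fun x => Re c * re f x - Im c * im f x).
    by apply: sqiB; exact: sqiZ.
  by apply/funext => x; exact: cReM.
rewrite (_ : im _ = fun x => Re c * im f x + Im c * re f x).
  by apply: sqiD; exact: sqiZ.
by apply/funext => x; exact: cImM.
Qed.

Lemma L2B f g : L2 f -> L2 g -> L2 (fun x => f x - g x).
Proof.
move=> fL gL; rewrite (_ : (fun x => _) = (fun x => f x + (-1) * g x)).
  by apply: L2D => //; exact: L2Z.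
by apply/funext => x; rewrite mulN1r.
Qed.

Lemma L20 : L2 (fun _ : R => 0 : R[i]).
Proof. by apply/L2P; split; exact: sqi0. Qed.

Lemma L2conj f : L2 f -> L2 (fun x => (f x)^*).
Proof.
move=> /L2P[fr fi]; apply/L2P; split.
  by rewrite (_ : re _ = re f)//; apply/funext => x; exact: cReC.
by rewrite (_ : im _ = fun x => - im f x); [exact: sqiN|apply/funext => x;
  exact: cImC].
Qed.

Lemma L2sum (n : nat) (u : 'I_n -> R -> R[i]) : (forall i, L2 (u i)) ->
  L2 (fun x => \sum_(i < n) u i x).
Proof.
elim: n u => [|n IH] u uL.
  by rewrite (_ : (fun x => _) = (fun=> 0)); [exact: L20|apply/funext => x;
    rewrite big_ord0].
rewrite (_ : (fun x => _) = (fun x => \sum_(i < n) u (widen_ord (leqnSn n) i) x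
  + u ord_max x)).
  by apply: L2D => //; exact: IH.
by apply/funext => x; rewrite big_ord_recr.
Qed.

Lemma re_Pproj (E : set R) f x : re (Pproj E f) x = re f x * \1_E x.
Proof. by rewrite /re /Pproj cReM/= mul0r subr0 mulrC. Qed.

Lemma im_Pproj (E : set R) f x : im (Pproj E f) x = im f x * \1_E x.
Proof. by rewrite /im /Pproj cImM/= mul0r addr0 mulrC. Qed.

Lemma L2Pproj (E : set R) f : measurable E -> L2 f -> L2 (Pproj E f).
Proof.
move=> mE /L2P[fr fi]; have mi : measurable_fun setT (\1_E : R -> R) by exact:
  measurable_indic.
apply/L2P; split; [rewrite (funext (re_Pproj E f))|rewrite (funext (im_Pproj E f))].
  exact: (sqi_mulb fr mi (indic_le1 E)).
exact: (sqi_mulb fi mi (indic_le1 E)).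
Qed.

Lemma Pproj_idem (E : set R) f : Pproj E (Pproj E f) = Pproj E f.
Proof.
apply/funext => x; rewrite /Pproj indicE; case: (_ \in _); first by rewrite !mul1r.
by rewrite !mul0r.
Qed.

Lemma re_dot f g : L2 f -> L2 g -> Re (dotL2 f g) =
  \int[mu]_x (re f x * re g x) + \int[mu]_x (im f x * im g x).
Proof.
move=> /L2P[fr fi] /L2P[gr gi]; rewrite -RintD; [|exact: sqi_mul|exact: sqi_mul].
by apply: eq_Rint => x; rewrite !complex_simp; rewrite mulrN opprK.
Qed.

Lemma im_dot f g : L2 f -> L2 g -> Im (dotL2 f g) =
  \int[mu]_x (im f x * re g x) - \int[mu]_x (re f x * im g x).
Proof.
move=> /L2P[fr fi] /L2P[gr gi]; rewrite -RintB; [|exact: sqi_mul|exact: sqi_mul].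
by apply: eq_Rint => x; rewrite !complex_simp mulrN addrC.
Qed.

Lemma dot_ext f f' g g' : L2 f -> L2 f' -> L2 g -> L2 g' ->
  f = f' %[ae mu] -> g = g' %[ae mu] -> dotL2 f g = dotL2 f' g'.
Proof.
move=> /[dup] fL /L2P[[fr _] [fi _]] /[dup] fL' /L2P[[fr' _] [fi' _]].
move=> /[dup] gL /L2P[[gr _] [gi _]] /[dup] gL' /L2P[[gr' _] [gi' _]] ff gg.
have key (p q : R[i] -> R) : measurable_fun setT (fun x => p (f x)) ->
    measurable_fun setT (fun x => p (f' x)) ->
    measurable_fun setT (fun x => q (g x)) -> measurable_fun setT (fun x =>
      q (g' x)) ->
    \int[mu]_x (p (f x) * q (g x)) = \int[mu]_x (p (f' x) * q (g' x)).
  move=> h1 h2 h3 h4; apply: Rint_ae_eq; [exact: measurable_funM|exact: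
    measurable_funM|].
  by apply: aeS2 ff gg => x h k _; rewrite h// k.
apply: complexP; rewrite ?re_dot ?im_dot//.
  by congr (_ + _); [exact: (key ReR ReR)|exact: (key ImR ImR)].
by congr (_ - _); [exact: (key ImR ReR)|exact: (key ReR ImR)].
Qed.

Lemma dotC f g : L2 f -> L2 g -> dotL2 g f = (dotL2 f g)^*.
Proof.
move=> fL gL; apply: complexP; rewrite !complex_simp ?re_dot ?im_dot//.
  by congr (_ + _); apply: eq_Rint => x; rewrite mulrC.
by rewrite opprB; congr (_ - _); apply: eq_Rint => x; rewrite mulrC.
Qed.

Lemma re_add f g : re (fun x => f x + g x) = (fun x => re f x + re g x).
Proof. by apply/funext => x; exact: cReD. Qed.
Lemma im_add f g : im (fun x => f x + g x) = (fun x => im f x + im g x).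
Proof. by apply/funext => x; exact: cImD. Qed.
Lemma re_sub f g : re (fun x => f x - g x) = (fun x => re f x - re g x).
Proof. by apply/funext => x; exact: cReB. Qed.
Lemma im_sub f g : im (fun x => f x - g x) = (fun x => im f x - im g x).
Proof. by apply/funext => x; exact: cImB. Qed.
Lemma re_scale (c : R[i]) f : re (fun x => c * f x) = (fun x =>
  Re c * re f x - Im c * im f x).
Proof. by apply/funext => x; exact: cReM. Qed.
Lemma im_scale (c : R[i]) f : im (fun x => c * f x) = (fun x =>
  Re c * im f x + Im c * re f x).
Proof. by apply/funext => x; exact: cImM. Qed.

Lemma RintMDl (a b c : R -> R) : sqi a -> sqi b -> sqi c ->
  \int[mu]_x ((a x + b x) * c x) = \int[mu]_x (a x * c x) + \int[mu]_x (b x * c x).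
Proof.
move=> sa sb sc; rewrite -RintD; [|exact: sqi_mul|exact: sqi_mul].
by apply: eq_Rint => x; rewrite mulrDl.
Qed.

Lemma RintMZl (k : R) (a c : R -> R) : sqi a -> sqi c ->
  \int[mu]_x ((k * a x) * c x) = k * \int[mu]_x (a x * c x).
Proof.
move=> sa sc; rewrite -RintZ; last exact: sqi_mul.
by apply: eq_Rint => x; rewrite mulrA.
Qed.

Lemma RintMBl (a b c : R -> R) : sqi a -> sqi b -> sqi c ->
  \int[mu]_x ((a x - b x) * c x) = \int[mu]_x (a x * c x) - \int[mu]_x (b x * c x).
Proof.
move=> sa sb sc; rewrite -RintB; [|exact: sqi_mul|exact: sqi_mul].
by apply: eq_Rint => x; rewrite mulrBl.
Qed.

Lemma dotDl f f' g : L2 f -> L2 f' -> L2 g ->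
  dotL2 (fun x => f x + f' x) g = dotL2 f g + dotL2 f' g.
Proof.
move=> fL fL' gL; have sL := L2D fL fL'.
move: (fL) (fL') (gL) => /L2P[fr fi] /L2P[fr' fi'] /L2P[gr gi].
apply: complexP; rewrite !complex_simp ?re_dot ?im_dot// re_add im_add
  !RintMDl//; ring.
Qed.

Lemma dotZl (c : R[i]) f g : L2 f -> L2 g ->
  dotL2 (fun x => c * f x) g = c * dotL2 f g.
Proof.
move=> fL gL; have sL := L2Z c fL.
move: (fL) (gL) => /L2P[fr fi] /L2P[gr gi].
apply: complexP; rewrite !complex_simp ?re_dot ?im_dot// re_scale im_scale.
  rewrite (RintMBl (sqiZ _ fr) (sqiZ _ fi) gr) (RintMDl (sqiZ _ fi) (sqiZ _ fr) gi).
  by rewrite !RintMZl//; ring.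
rewrite (RintMBl (sqiZ _ fr) (sqiZ _ fi) gi) (RintMDl (sqiZ _ fi) (sqiZ _ fr) gr).
by rewrite !RintMZl//; ring.
Qed.

Lemma dotBl f f' g : L2 f -> L2 f' -> L2 g ->
  dotL2 (fun x => f x - f' x) g = dotL2 f g - dotL2 f' g.
Proof.
move=> fL fL' gL; rewrite (_ : (fun x => _) = (fun x => f x + (-1) * f' x)).
  by rewrite dotDl// ?dotZl ?mulN1r//; exact: L2Z.
by apply/funext => x; rewrite mulN1r.
Qed.

Lemma dotBr f g g' : L2 f -> L2 g -> L2 g' ->
  dotL2 f (fun x => g x - g' x) = dotL2 f g - dotL2 f g'.
Proof.
move=> fL gL gL'; rewrite (dotC gL fL) (dotC gL' fL) (dotC (L2B gL gL') fL) dotBl//.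
by apply: complexP; rewrite !complex_simp; ring.
Qed.

Lemma dot_suml (n : nat) (u : 'I_n -> R -> R[i]) g :
  (forall i, L2 (u i)) -> L2 g ->
  dotL2 (fun x => \sum_(i < n) u i x) g = \sum_(i < n) dotL2 (u i) g.
Proof.
elim: n u => [|n IH] u uL gL.
  rewrite big_ord0 (_ : (fun x => _) = (fun x => 0 * (0 : R[i]))).
    by rewrite (dotZl 0 L20 gL) mul0r.
  by apply/funext => x; rewrite big_ord0 mul0r.
rewrite big_ord_recr/= -IH// -dotDl//; last exact: L2sum.
by congr dotL2; apply/funext => x; rewrite big_ord_recr.
Qed.

Lemma dot_self f : L2 f -> dotL2 f f = (nrm2 f)%:C.
Proof.
move=> fL; apply: complexP; rewrite ?re_dot ?im_dot// [RHS]/=.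
  by rewrite nrm2E//; congr (_ + _); apply: eq_Rint => x; rewrite expr2.
by apply/eqP; rewrite subr_eq0; apply/eqP/eq_Rint => x; rewrite mulrC.
Qed.

Lemma nrm2_eq0 f : L2 f -> nrm2 f = 0 -> f = (fun=> 0) %[ae mu].
Proof.
move=> fL; rewrite nrm2E// => h.
have [fr fi] := (L2P f).1 fL.
have hr := Rint_sqr_ge0 (re f); have hi := Rint_sqr_ge0 (im f).
have r0 : re f = (fun=> 0) %[ae mu] by apply: Rint_sqr_eq0 => //; lra.
have i0 : im f = (fun=> 0) %[ae mu] by apply: Rint_sqr_eq0 => //; lra.
by apply: aeS2 r0 i0 => x a b _; apply: complexP; [exact: a|exact: b].
Qed.

Lemma ae_sub0 f g : (fun x => f x - g x) = (fun=> 0) %[ae mu] -> f = g %[ae mu].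
Proof. by apply: aeS => x h /h /eqP; rewrite subr_eq0 => /eqP. Qed.

(** The source of almost everywhere identities for operators that are known only through an adjoint
    relation. *)
Lemma dot_eq_ae f g : L2 f -> L2 g -> (forall h, L2 h -> dotL2 f h = dotL2 g h) ->
  f = g %[ae mu].
Proof.
move=> fL gL h; apply: ae_sub0; have dL := L2B fL gL.
apply: nrm2_eq0 => //; have := dot_self dL; rewrite {1}dotBl// h// subrr.
by move=> /(congr1 ReR) e; exact: esym e.
Qed.

Lemma nrm2B f g : L2 f -> L2 g -> nrm2 (fun x => f x - g x) =
  nrm2 f - 2 * Re (dotL2 f g) + nrm2 g.
Proof.
move=> fL gL; have dL := L2B fL gL.
have := dot_self dL; rewrite dotBl// !dotBr// !dot_self// (dotC fL gL).
by move=> /(congr1 ReR); rewrite !complex_simp /= => <-; ring.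
Qed.

(** Parallelogram law with the term |f + g|^2 dropped; it replaces the triangle inequality and
    avoids square roots. *)
Lemma nrm2_triangle f g : L2 f -> L2 g ->
  nrm2 (fun x => f x - g x) <= 2 * nrm2 f + 2 * nrm2 g.
Proof.
move=> fL gL; have h := nrm2_ge0 (fun x => f x + g x).
have gL' := L2Z (-1) gL.
have e : nrm2 (fun x => f x + g x) = nrm2 f + 2 * Re (dotL2 f g) + nrm2 g.
  have -> : (fun x => f x + g x) = (fun x => f x - (-1) * g x).
    by apply/funext => x; rewrite mulN1r opprK.
  rewrite (nrm2B fL gL') (dotC gL' fL) (dotZl _ gL fL) (dotC fL gL).
  have -> : nrm2 (fun x => -1 * g x) = nrm2 g.
    by apply: eq_Rint => x; rewrite /re /im mulN1r !complex_simp !sqrrN.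
  by rewrite !complex_simp /=; ring.
rewrite nrm2B//; lra.
Qed.

Lemma nrm2_ae f g : L2 f -> L2 g -> f = g %[ae mu] -> nrm2 f = nrm2 g.
Proof.
move=> fL gL fg; have := dot_self fL; rewrite (dot_ext fL gL fL gL fg fg)
  dot_self//.
by move=> /(congr1 ReR).
Qed.

End ComplexL2.

(** * The Fourier transform *)

Section Fourier.
Context {R : realType}.
Local Open Scope complex_scope.
Local Notation mu := (@lebesgue_measure R).
Implicit Types (f g h : R -> R[i]).
Local Notation hat := (@fourier_integral R).

Definition cL1L2 f := L1L2 (re f) /\ L1L2 (im f).

Lemma cL1L2_L2 f : cL1L2 f -> L2 f.
Proof. by move=> [[_ a] [_ b]]; apply/L2P. Qed.

Lemma re_hat f xi : cL1L2 f -> re (hat f) xi = cosft (re f) xi + sinft (im f) xi.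
Proof.
move=> [[ar _] [ai _]]; rewrite -RintD; [|exact: integ_kcos|exact: integ_ksin].
apply: eq_Rint => x; rewrite cReM/= cosN sinN mulNr opprK.
by rewrite /kcos /ksin /re /im mulrC; congr (_ + _); rewrite mulrC.
Qed.

Lemma im_hat f xi : cL1L2 f -> im (hat f) xi = cosft (im f) xi - sinft (re f) xi.
Proof.
move=> [[ar _] [ai _]]; rewrite -RintB; [|exact: integ_kcos|exact: integ_ksin].
apply: eq_Rint => x; rewrite cImM/= cosN sinN mulNr.
by rewrite /kcos /ksin /re /im mulrC; congr (_ - _); rewrite mulrC.
Qed.

Lemma sqi_cosft (a : R -> R) : L1L2 a -> sqi (cosft a).
Proof.
move=> la; have [ip _] := Bessel_real la; have [mC _] := cosft_bounded la.1.
split=> //; apply: (integ_le _ _ ip); first exact: measurable_funX.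
by move=> x; rewrite ger0_norm ?sqr_ge0// lerDl sqr_ge0.
Qed.

Lemma sqi_sinft (a : R -> R) : L1L2 a -> sqi (sinft a).
Proof.
move=> la; have [ip _] := Bessel_real la; have [mS _] := sinft_bounded la.1.
split=> //; apply: (integ_le _ _ ip); first exact: measurable_funX.
by move=> x; rewrite ger0_norm ?sqr_ge0// lerDr sqr_ge0.
Qed.

(** Invariance under x -> -x is applied to the nonnegative function g + |g|, whose reflection is |g|
    - g. *)
Lemma Rint_odd (g : R -> R) : integ g -> (forall x, g (- x) = - g x) ->
  \int[mu]_x g x = 0.
Proof.
move=> gi og; pose p x := g x + `|g x|.
have ni := integ_norm gi; have pint : integ p := integD gi ni.
have p0 x : 0 <= p x by rewrite /p -lerBlDl sub0r -normrN ler_norm.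
have pN : integ (fun x => p (- x)).
  apply: (eq_integ _ (integD (integN gi) ni)) => x.
  by rewrite /p og normrN.
have mphi : measurable_fun setT (-%R : measurableTypeR R -> measurableTypeR R).
  exact: oppr_measurable.
have e : \int[mu]_x p x = \int[mu]_x p (- x).
  apply: EFin_inj; rewrite -!integ_EFin//.
  have mp : measurable_fun setT (EFin \o p) := measurable_int mu pint.
  have := @ge0_integral_pushforward _ _ _ _ _ (-%R : measurableTypeR R ->
    measurableTypeR R)
    mphi mu setT (EFin \o p) measurableT mp.
  move=> /(_ (fun y _ => p0 y)); rewrite preimage_setT => <-.
  apply: eq_measure_integral => A mA _; exact/esym/lebesgue_measureN.
have : \int[mu]_x p x = \int[mu]_x g x + \int[mu]_x `|g x| by exact: RintD.
have : \int[mu]_x p (- x) = - (\int[mu]_x g x) + \int[mu]_x `|g x|.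
  rewrite -RintN// -RintD//; last exact: integN.
  by apply: eq_Rint => x; rewrite /p og normrN.
lra.
Qed.

Lemma cosft_even (a : R -> R) xi : cosft a (- xi) = cosft a xi.
Proof. by apply: eq_Rint => x; rewrite /kcos mulrN cosN. Qed.

Lemma sinft_odd (a : R -> R) xi : integ a -> sinft a (- xi) = - sinft a xi.
Proof.
move=> ia; rewrite -RintN; last exact: integ_ksin.
by apply: eq_Rint => x; rewrite /ksin mulrN sinN mulrN.
Qed.

Lemma hat_L2 f : cL1L2 f -> L2 (hat f).
Proof.
move=> lf; apply/L2P; split.
  rewrite (_ : re _ = fun xi => cosft (re f) xi + sinft (im f) xi).
    by apply: sqiD; [exact: sqi_cosft lf.1|exact: sqi_sinft lf.2].
  by apply/funext => x; exact: re_hat.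
rewrite (_ : im _ = fun xi => cosft (im f) xi - sinft (re f) xi).
  by apply: sqiB; [exact: sqi_cosft lf.2|exact: sqi_sinft lf.1].
by apply/funext => x; exact: im_hat.
Qed.

Lemma hat_nrm2 f : cL1L2 f -> nrm2 (hat f) = nrm2 f.
Proof.
move=> lf; have [lr li] := lf.
have Cr := sqi_cosft lr; have Ci := sqi_cosft li.
have Sr := sqi_sinft lr; have Si := sqi_sinft li.
have [ir er] := Plancherel_real lr; have [ii ei] := Plancherel_real li.
have i1 := sqi_mul Cr Si; have i2 := sqi_mul Ci Sr.
(* the cross terms of [|hat f|^2] form an odd function *)
have odd0 : \int[mu]_x (2 * (cosft (re f) x * sinft (im f) x - cosft (im f) x *
  sinft (re f) x)) = 0.
  apply: Rint_odd; first exact/integZ/integB.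
  by move=> x; rewrite !cosft_even (sinft_odd _ li.1) (sinft_odd _ lr.1); ring.
rewrite (nrm2E (cL1L2_L2 lf)) -er -ei -[LHS]subr0 -{1}odd0 -RintD//.
rewrite -RintB; last 2 first.
- exact: nrm2_integ (hat_L2 lf).
- exact/integZ/integB.
by apply: eq_Rint => x; rewrite re_hat// im_hat// /spectrum; ring.
Qed.

Lemma hat_sub f g xi : cL1L2 f -> cL1L2 g -> hat f xi - hat g xi = hat (fun x
  => f x - g x) xi.
Proof.
move=> lf lg; have [[fr _] [fi _]] := lf; have [[gr _] [gi _]] := lg.
have ld : cL1L2 (fun x => f x - g x).
  rewrite /cL1L2 re_sub im_sub; split; split.
  - exact: integB.
  - exact: sqiB lf.1.2 lg.1.2.
  - exact: integB.
  - exact: sqiB lf.2.2 lg.2.2.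
have NZ (c : R -> R) : (fun x => - c x) = (fun x => -1 * c x).
  by apply/funext => x; rewrite mulN1r.
apply: complexP.
  rewrite cReB; change (re (hat f) xi - re (hat g) xi = re (hat (fun x =>
    f x - g x)) xi).
  rewrite !re_hat// re_sub im_sub cosftD ?sinftD//; try exact: integN.
  by rewrite !NZ cosftZ// sinftZ//; ring.
rewrite cImB; change (im (hat f) xi - im (hat g) xi = im (hat (fun x =>
  f x - g x)) xi).
rewrite !im_hat// re_sub im_sub cosftD ?sinftD//; try exact: integN.
by rewrite !NZ cosftZ// sinftZ//; ring.
Qed.

Lemma cL1L2B f g : cL1L2 f -> cL1L2 g -> cL1L2 (fun x => f x - g x).
Proof.
move=> [[a b] [c d]] [[a' b'] [c' d']]; rewrite /cL1L2 re_sub im_sub.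
by split; split; [exact: integB|exact: sqiB|exact: integB|exact: sqiB].
Qed.

(** The integral with kernel e^(2 i pi x y); written with conjugations, it inherits the isometry
    from [hat]. *)
Definition inv_hat g x := (hat (fun y => (g y)^*) x)^*.

Lemma cL1L2_conj g : cL1L2 g -> cL1L2 (fun y => (g y)^*).
Proof.
move=> [lr [li si]]; split.
  by rewrite (_ : re _ = re g)//; apply/funext => x; exact: cReC.
rewrite (_ : im _ = fun x => - im g x); last by apply/funext => x; exact: cImC.
by split; [exact: integN|exact: sqiN].
Qed.

Lemma inv_hat_L2 g : cL1L2 g -> L2 (inv_hat g).
Proof. by move=> lg; apply/L2conj/hat_L2/cL1L2_conj. Qed.

Lemma nrm2_conj f : nrm2 (fun x => (f x)^*) = nrm2 f.
Proof. by apply: eq_Rint => x; rewrite /re /im cReC cImC sqrrN. Qed.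

Lemma inv_hat_nrm2 g : cL1L2 g -> nrm2 (inv_hat g) = nrm2 g.
Proof. by move=> lg; rewrite nrm2_conj hat_nrm2 ?nrm2_conj//;
  exact: cL1L2_conj. Qed.

Lemma re_conj g : re (fun y => (g y)^*) = re g.
Proof. by apply/funext => x; exact: cReC. Qed.
Lemma im_conj g : im (fun y => (g y)^*) = (fun x => -1 * im g x).
Proof. by apply/funext => x; rewrite mulN1r; exact: cImC. Qed.

Lemma re_inv_hat g x : cL1L2 g -> re (inv_hat g) x = cosft (re g) x - sinft (im
  g) x.
Proof.
move=> lg; rewrite /inv_hat re_conj re_hat; last exact: cL1L2_conj.
by rewrite re_conj im_conj sinftZ ?mulN1r//; exact: lg.2.1.
Qed.

Lemma im_inv_hat g x : cL1L2 g -> im (inv_hat g) x = cosft (im g) x + sinft (re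
  g) x.
Proof.
move=> lg; rewrite /inv_hat im_conj im_hat; last exact: cL1L2_conj.
by rewrite re_conj im_conj cosftZ; [ring|exact: lg.2.1].
Qed.

(** The cosine and sine transforms are symmetric for the pairing; the real and the imaginary part
    each use this symmetry four times. *)
Lemma hat_dual f g : cL1L2 f -> cL1L2 g -> dotL2 (hat f) g = dotL2 f (inv_hat g).
Proof.
move=> lf lg; have fL := cL1L2_L2 lf; have gL := cL1L2_L2 lg.
have hL := hat_L2 lf; have cL := inv_hat_L2 lg.
have [[ar sr] [ai si]] := lf; have [[br tr] [bi ti]] := lg.
have sC a : L1L2 a -> sqi (cosft a) := @sqi_cosft a.
have sS a : L1L2 a -> sqi (sinft a) := @sqi_sinft a.
have hr : re (hat f) = (fun x => cosft (re f) x + sinft (im f) x) by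
  apply/funext => x; exact: re_hat.
have hi : im (hat f) = (fun x => cosft (im f) x - sinft (re f) x) by
  apply/funext => x; exact: im_hat.
have cr : re (inv_hat g) = (fun x => cosft (re g) x - sinft (im g) x) by
  apply/funext => x; exact: re_inv_hat.
have ci : im (inv_hat g) = (fun x => cosft (im g) x + sinft (re g) x) by
  apply/funext => x; exact: im_inv_hat.
have swap (a b : R -> R) : \int[mu]_x (a x * b x) = \int[mu]_x (b x * a x).
  by apply: eq_Rint => x; rewrite mulrC.
have CrE a b : L1L2 a -> L1L2 b -> \int[mu]_x (cosft a x * b x) = \int[mu]_x (a
  x * cosft b x).
  by move=> la lb; rewrite (swap (cosft a) b) (cosft_dual la.1 lb.1).
have SrE a b : L1L2 a -> L1L2 b -> \int[mu]_x (sinft a x * b x) = \int[mu]_x (a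
  x * sinft b x).
  by move=> la lb; rewrite (swap (sinft a) b) (sinft_dual la.1 lb.1).
have l1 := lf.1; have l2 := lf.2; have l3 := lg.1; have l4 := lg.2.
have mDr (a b c : R -> R) : sqi a -> sqi b -> sqi c ->
    \int[mu]_x (c x * (a x + b x)) = \int[mu]_x (c x * a x) + \int[mu]_x (c x *
      b x).
  by move=> *; rewrite (swap c) RintMDl// (swap a) (swap b).
have mBr (a b c : R -> R) : sqi a -> sqi b -> sqi c ->
    \int[mu]_x (c x * (a x - b x)) = \int[mu]_x (c x * a x) - \int[mu]_x (c x *
      b x).
  by move=> *; rewrite (swap c) RintMBl// (swap a) (swap b).
apply: complexP; rewrite ?re_dot ?im_dot// hr hi cr ci.
  rewrite (RintMDl (sC _ l1) (sS _ l2) tr) (RintMBl (sC _ l2) (sS _ l1) ti).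
  rewrite (mBr _ _ _ (sC _ l3) (sS _ l4) sr) (mDr _ _ _ (sC _ l4) (sS _ l3) si).
  rewrite (CrE _ _ l1 l3) (SrE _ _ l2 l3) (CrE _ _ l2 l4) (SrE _ _ l1 l4).
  have alg (p q r s : R) : p + q + (r - s) = p - s + (r + q) by ring.
  exact: alg.
rewrite (RintMDl (sC _ l1) (sS _ l2) ti) (RintMBl (sC _ l2) (sS _ l1) tr).
rewrite (mBr _ _ _ (sC _ l3) (sS _ l4) si) (mDr _ _ _ (sC _ l4) (sS _ l3) sr).
rewrite (CrE _ _ l2 l3) (SrE _ _ l1 l3) (CrE _ _ l1 l4) (SrE _ _ l2 l4).
have alg (p q r s : R) : p - s - (r + q) = p - q - (r + s) by ring.
exact: alg.
Qed.

(** The indicator of a set of finite measure is square integrable, so its product with an L^2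
    function is integrable. Finiteness of |A| and |cA| enters the Fourier analysis here. *)
Lemma cL1L2_Pproj (E : set R) f : measurable E -> (mu E < +oo)%E -> L2 f ->
  cL1L2 (Pproj E f).
Proof.
move=> mE muE fL; have [fr fi] := (L2P f).1 fL.
have [pr pi_] := (L2P _).1 (L2Pproj mE fL).
have iE : sqi (\1_E : R -> R).
  split; first exact: measurable_indic.
  have : integ (\1_E : R -> R).
    apply: ge0_integP; [exact: measurable_indic|by move=> x; rewrite indicE|].
    by rewrite integral_indic// setIT.
  by apply: eq_integ => x; rewrite indicE; case: (_ \in _); rewrite ?expr1n ?expr0n.
split; split => //.
  by rewrite (funext (re_Pproj E f)); exact: sqi_mul.
by rewrite (funext (im_Pproj E f)); exact: sqi_mul.
Qed.

Definition trunc n : set R := `[- n%:R, n%:R]%classic.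

Lemma cL1L2_trunc n f : L2 f -> cL1L2 (Pproj (trunc n) f).
Proof.
move=> fL; apply: cL1L2_Pproj => //; first exact: measurable_itv.
by rewrite lebesgue_measure_itv/=; case: ifPn => _; rewrite ?ltry// -EFinD ltry.
Qed.

Lemma trunc_cvg f : L2 f ->
  nrm2 (fun x => f x - Pproj (trunc n) f x) @[n --> \oo] --> (0 : R).
Proof.
move=> fL; have [fr fi] := (L2P f).1 fL.
have mt (n : nat) : measurable (trunc n) by exact: measurable_itv.
have tx (x : R) : \forall n \near \oo, trunc n x.
  near=> n; rewrite /trunc/= in_itv/= -ler_norml.
  by near: n; exact: nbhs_infty_ger.
have hr := indic_cvg_sqr fr mt tx; have hi := indic_cvg_sqr fi mt tx.
rewrite (_ : (fun n => _) = (fun n =>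
   \int[mu]_x ((re f x - re f x * \1_(trunc n) x) ^+ 2) +
   \int[mu]_x ((im f x - im f x * \1_(trunc n) x) ^+ 2))).
  by rewrite -(addr0 (0 : R)); exact: cvgD.
apply/funext => n; rewrite nrm2E; last exact: L2B (L2Pproj (mt n) fL).
by rewrite re_sub im_sub (funext (re_Pproj _ f)) (funext (im_Pproj _ f)).
Unshelve. all: by end_near. Qed.

Lemma trunc_sub n f g :
  (fun x => Pproj (trunc n) f x - Pproj (trunc n) g x) =
  Pproj (trunc n) (fun x => f x - g x).
Proof. by apply/funext => x; rewrite /Pproj mulrBr. Qed.

Lemma is_fourierP f g : is_fourier f g <->
  [/\ L2 f, L2 g & nrm2 (fun xi => g xi - hat (Pproj (trunc n) f) xi) @[n -->
    \oo] --> (0 : R)].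
Proof.
split=> -[fL gL h]; split=> //; have := h; rewrite L2norm_cvg0P// => n;
  by apply: L2B => //; apply: hat_L2; exact: cL1L2_trunc.
Qed.

Lemma cvg0_squeeze (u v : nat -> R) : (forall n, 0 <= u n) -> (forall n,
  u n <= v n) ->
  v @ \oo --> (0 : R) -> u @ \oo --> (0 : R).
Proof.
move=> u0 uv v0; apply: (@squeeze_cvgr _ _ _ _ (fun=> 0) v) => //.
  by apply: nearW => n; rewrite u0 uv.
exact: cvg_cst.
Qed.

Lemma le_cvg0_eq0 (c : R) (v : nat -> R) : 0 <= c -> (forall n, c <= v n) ->
  v @ \oo --> (0 : R) -> c = 0.
Proof.
move=> c0 cv v0; apply/eqP; rewrite eq_le c0 andbT -(cvg_lim _ v0)//.
by apply: limr_ge; [apply/cvg_ex; exists 0|exact: nearW].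
Qed.

Lemma cvg0_lincomb (u v : nat -> R) : u @ \oo --> (0 : R) -> v @ \oo --> (0 : R) ->
  2 * u n + 2 * v n @[n --> \oo] --> (0 : R).
Proof.
move=> hu hv; have -> : (0 : R) = 2 * 0 + 2 * 0 by rewrite mulr0 addr0.
by apply: cvgD; (apply: cvgM; [exact: cvg_cst|]).
Qed.

(** By linearity and the isometry, the error of the truncated transform equals |f - f 1_n|. *)
Lemma is_fourier_hat f : cL1L2 f -> is_fourier f (hat f).
Proof.
move=> lf; have fL := cL1L2_L2 lf; apply/is_fourierP; split=> //;
  first exact: hat_L2.
rewrite (_ : (fun n => _) = (fun n => nrm2 (fun x => f x - Pproj (trunc n) f x))).
  exact: trunc_cvg.
apply/funext => n; have ln := cL1L2_trunc n fL.
rewrite -[RHS]hat_nrm2; last exact: cL1L2B.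
by congr nrm2; apply/funext => x; rewrite hat_sub.
Qed.

(* By duality [|g - hat (f 1_n)|^2 = |g|^2 - |f 1_n|^2] for [f = inv_hat g], so that the
   isometry alone gives the surjectivity of the Fourier transform. *)
Lemma is_fourier_inv_hat g : cL1L2 g -> is_fourier (inv_hat g) g.
Proof.
move=> lg; have gL := cL1L2_L2 lg; have cL := inv_hat_L2 lg.
apply/is_fourierP; split=> //.
rewrite (_ : (fun n => _) = (fun n => nrm2 (fun x =>
  inv_hat g x - Pproj (trunc n) (inv_hat g) x))).
  exact: trunc_cvg.
apply/funext => n; have ln := cL1L2_trunc n cL; have lnL := cL1L2_L2 ln.
rewrite !nrm2B//; last exact: hat_L2.
rewrite hat_nrm2// inv_hat_nrm2// (dotC (hat_L2 ln) gL) hat_dual// cReC.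
by rewrite (dotC lnL cL) cReC.
Qed.

Lemma is_fourier_uniq f g g' : is_fourier f g -> is_fourier f g' -> g = g' %[ae mu].
Proof.
move=> /is_fourierP[fL gL h] /is_fourierP[_ gL' h'].
have dL := L2B gL gL'; apply/ae_sub0/nrm2_eq0 => //.
apply: (le_cvg0_eq0 (v := fun n =>
  2 * nrm2 (fun xi => g xi - hat (Pproj (trunc n) f) xi) +
  2 * nrm2 (fun xi => g' xi - hat (Pproj (trunc n) f) xi))).
- exact: nrm2_ge0.
- move=> n; have hn := hat_L2 (cL1L2_trunc n fL).
  rewrite (_ : (fun x => g x - g' x) =
    (fun x => (g x - hat (Pproj (trunc n) f) x) - (g' x - hat (Pproj (trunc n)
      f) x))).
    by apply: nrm2_triangle; exact: L2B.
  by apply/funext => x; rewrite opprB addrA subrK.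
- exact: (cvg0_lincomb h h').
Qed.

(** Put d = f - f'. The transforms of f 1_n and f' 1_n share the limit g, so |d 1_n| tends to zero
    by the isometry, while d 1_n tends to d. Hence the choice made by [inv_fourier] is harmless. *)
Lemma is_fourier_inj f f' g : is_fourier f g -> is_fourier f' g -> f = f' %[ae mu].
Proof.
move=> /is_fourierP[fL gL h] /is_fourierP[fL' _ h'].
have dL := L2B fL fL'; apply/ae_sub0/nrm2_eq0 => //.
pose d := fun x => f x - f' x.
have hd : nrm2 (Pproj (trunc n) d) @[n --> \oo] --> (0 : R).
  apply: (cvg0_squeeze (v := fun n =>
    2 * nrm2 (fun xi => g xi - hat (Pproj (trunc n) f') xi) +
    2 * nrm2 (fun xi => g xi - hat (Pproj (trunc n) f) xi))).
  - by move=> n; exact: nrm2_ge0.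
  - move=> n; have ln := cL1L2_trunc n fL; have ln' := cL1L2_trunc n fL'.
    have hn := hat_L2 ln; have hn' := hat_L2 ln'.
    rewrite -trunc_sub -hat_nrm2; last exact: cL1L2B.
    rewrite (_ : hat _ = (fun x => (g x - hat (Pproj (trunc n) f') x) - (g x -
      hat (Pproj (trunc n) f) x))).
      by apply: nrm2_triangle; exact: L2B.
    by apply/funext => x; rewrite -hat_sub//; ring.
  - exact: (cvg0_lincomb h' h).
apply: (le_cvg0_eq0 (v := fun n =>
  2 * nrm2 (fun x => d x - Pproj (trunc n) d x) + 2 * nrm2 (Pproj (trunc n) d))).
- exact: nrm2_ge0.
- move=> n; have pL := cL1L2_L2 (cL1L2_trunc n dL).
  have pL' := L2Z (-1) pL.
  have -> : nrm2 d = nrm2 (fun x => (d x - Pproj (trunc n) d x) - (-1 * Pproj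
    (trunc n) d x)).
    by congr nrm2; apply/funext => x; rewrite mulN1r opprK subrK.
  have e : nrm2 (fun x => -1 * Pproj (trunc n) d x) = nrm2 (Pproj (trunc n) d).
    by apply: eq_Rint => x; rewrite /re /im mulN1r !complex_simp !sqrrN.
  by rewrite -[X in _ + 2 * X]e; apply: nrm2_triangle => //; exact: L2B.
- exact: (cvg0_lincomb (trunc_cvg dL) hd).
Qed.

(** Since [hat f] is a witness, [xget] returns a true transform, and uniqueness identifies the two
    almost everywhere. *)
Lemma fourierE f : cL1L2 f -> [/\ is_fourier f (fourier f), L2 (fourier f) &
  fourier f = hat f %[ae mu]].
Proof.
move=> lf; have h := is_fourier_hat lf.
have h2 : is_fourier f (fourier f).
  by apply: (@xgetPex _ (fun=> 0) [set g | is_fourier f g]); exists (hat f).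
by split=> //; [case: h2|exact: is_fourier_uniq h2 h].
Qed.

Lemma inv_fourierE g : cL1L2 g -> L2 (inv_fourier g) /\ inv_fourier g = inv_hat
  g %[ae mu].
Proof.
move=> lg; have h := is_fourier_inv_hat lg.
have h2 : is_fourier (inv_fourier g) g.
  by apply: (@xgetPex _ (fun=> 0) [set f | is_fourier f g]); exists (inv_hat g).
by split; [case: h2|exact: is_fourier_inj h2 h].
Qed.

End Fourier.

(** * Operators of finite rank *)

Section Operators.
Context {R : realType}.
Local Open Scope complex_scope.
Local Notation mu := (@lebesgue_measure R).
Local Notation ReR := (@complex.Re R).
Local Notation hat := (@fourier_integral R).
Implicit Types (f g h : R -> R[i]) (T : operator R).

Lemma dot_Pproj (E : set R) f g : dotL2 (Pproj E f) g = dotL2 f (Pproj E g).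
Proof.
rewrite /dotL2; congr cintegral; apply/funext => x; rewrite /Pproj.
by apply: complexP; rewrite !complex_simp /=; ring.
Qed.

Lemma Pproj_ae (E : set R) f g : f = g %[ae mu] -> Pproj E f = Pproj E g %[ae mu].
Proof. by apply: aeS => x h /h e; rewrite /Pproj e. Qed.

Lemma ae_sym f g : f = g %[ae mu] -> g = f %[ae mu].
Proof. by apply: aeS => x a t; rewrite a. Qed.

Lemma ae_refl f : f = f %[ae mu].
Proof. exact: aeW. Qed.

Lemma dot_ae_l f f' g : L2 f -> L2 f' -> L2 g -> f = f' %[ae mu] ->
  dotL2 f g = dotL2 f' g.
Proof. by move=> fL fL' gL ff; exact: dot_ext ff (ae_refl g). Qed.

Lemma dot_ae_r f g g' : L2 f -> L2 g -> L2 g' -> g = g' %[ae mu] ->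
  dotL2 f g = dotL2 f g'.
Proof. by move=> fL gL gL'; exact: dot_ext (ae_refl f). Qed.

(** One exhibited adjoint makes [xget] return an adjoint, and two adjoints have the same
    pairings. *)
Lemma adjointE T T' : is_adjoint T T' -> is_adjoint T (adjoint T) /\
  forall f, L2 f -> adjoint T f = T' f %[ae mu].
Proof.
move=> TT'; have h : is_adjoint T (adjoint T) :=
  xgetPex (fun _ _ => 0) (ex_intro _ _ TT').
split=> // f fL; have [TL TL' e'] := TT'; have [_ aL e] := h.
apply: dot_eq_ae; [exact: aL|exact: TL'|move=> g gL].
rewrite (dotC gL (aL _ fL)) (dotC gL (TL' _ fL)); congr (_^*).
by rewrite -e// e'.
Qed.

Section Concentration.
Variables A B : set R.
Hypotheses (mA : measurable A) (mB : measurable B).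
Hypotheses (finA : (mu A < +oo)%E) (finB : (mu B < +oo)%E).

Definition Kgen : operator R := fun f => Pproj B (fourier (Pproj A f)).

Let K' : operator R := fun g => Pproj A (inv_fourier (Pproj B g)).

Lemma Kgen_L2 : L2stable Kgen.
Proof.
move=> f fL; apply: L2Pproj => //.
by have [] := fourierE (cL1L2_Pproj mA finA fL).
Qed.

Lemma Kgen_hat f : L2 f -> Kgen f = Pproj B (hat (Pproj A f)) %[ae mu].
Proof.
by move=> fL; apply: Pproj_ae; have [] := fourierE (cL1L2_Pproj mA finA fL).
Qed.

Lemma Kgen_is_adjoint : is_adjoint Kgen K'.
Proof.
split; first exact: Kgen_L2.
  move=> f fL; apply: L2Pproj => //.
  by have [] := inv_fourierE (cL1L2_Pproj mB finB fL).
move=> f g fL gL.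
have lf := cL1L2_Pproj mA finA fL; have lg := cL1L2_Pproj mB finB gL.
have [_ FL Fe] := fourierE lf; have [GL Ge] := inv_fourierE lg.
rewrite /Kgen dot_Pproj (dot_ae_l FL (hat_L2 lf) (cL1L2_L2 lg) Fe) hat_dual//.
by rewrite -(dot_ae_r (cL1L2_L2 lf) GL (inv_hat_L2 lg) Ge) dot_Pproj.
Qed.

Definition Sgen : operator R := fun f => adjoint Kgen (Kgen f).

(** The P_B that ends K and the P_B that begins its adjoint merge by idempotence. *)
Lemma Sgen_formula f : L2 f ->
  Sgen f = Pproj A (Qproj B (Pproj A f)) %[ae mu].
Proof.
move=> fL; have [_ h] := adjointE Kgen_is_adjoint.
by have := h _ (Kgen_L2 fL); rewrite /K' /Kgen Pproj_idem.
Qed.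

Lemma Sgen_L2 : L2stable Sgen.
Proof. by have [[_ aL _] _] := adjointE Kgen_is_adjoint => f fL;
  exact/aL/Kgen_L2. Qed.

Lemma dot_Sgen f g : L2 f -> L2 g -> dotL2 f (Sgen g) = dotL2 (Kgen f) (Kgen g).
Proof.
by move=> fL gL; have [[_ aL e] _] := adjointE Kgen_is_adjoint; rewrite e//;
  exact: Kgen_L2.
Qed.

Lemma Sgen_sa f g : L2 f -> L2 g -> dotL2 (Sgen f) g = dotL2 f (Sgen g).
Proof.
move=> fL gL; rewrite dot_Sgen// (dotC gL (Sgen_L2 fL)) dot_Sgen//.
by rewrite -dotC//; exact: Kgen_L2.
Qed.

Lemma Sgen_form f : L2 f -> dotL2 (Sgen f) f = (nrm2 (Kgen f))%:C.
Proof. by move=> fL; rewrite Sgen_sa// dot_Sgen// dot_self//; exact: Kgen_L2. Qed.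

End Concentration.

Definition lincomb (n : nat) (c : 'I_n -> R[i]) (u : 'I_n -> R -> R[i]) :
  R -> R[i] := fun x => \sum_(i < n) c i * u i x.

Definition sqmod (z : R[i]) : R := complex.Re z ^+ 2 + complex.Im z ^+ 2.

Lemma sqmod_ge0 z : 0 <= sqmod z.
Proof. by rewrite addr_ge0 ?sqr_ge0. Qed.

Lemma mul_conj z : z * z^* = (sqmod z)%:C.
Proof. by apply: complexP; rewrite !complex_simp /sqmod/=; ring. Qed.

Lemma sqmod_conj z : sqmod (z^*) = sqmod z.
Proof. by rewrite /sqmod !complex_simp sqrrN. Qed.

Lemma sqmod_eq0 z : sqmod z = 0 -> z = 0.
Proof.
move=> /eqP; rewrite paddr_eq0 ?sqr_ge0// !sqrf_eq0 => /andP[/eqP a /eqP b].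
exact: complexP.
Qed.

Lemma lincomb_L2 n (c : 'I_n -> R[i]) u : (forall i, L2 (u i)) -> L2 (lincomb c u).
Proof. by move=> uL; apply: L2sum => i; exact: L2Z. Qed.

Lemma dot_combl n (c : 'I_n -> R[i]) u g : (forall i, L2 (u i)) -> L2 g ->
  dotL2 (lincomb c u) g = \sum_(i < n) c i * dotL2 (u i) g.
Proof.
move=> uL gL; rewrite dot_suml//; last by move=> i; exact: L2Z.
by apply: eq_bigr => i _; rewrite dotZl.
Qed.

Lemma dot_lincomb_ortho n (c : 'I_n -> R[i]) u j : orthonormalL2 u ->
  dotL2 (lincomb c u) (u j) = c j.
Proof.
move=> [uL uo]; rewrite dot_combl// (bigD1 j)//= uo eqxx mulr1 big1 ?addr0// =>
  i ij.
by rewrite uo (negbTE ij) mulr0.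
Qed.

Lemma sum_realC n (r : 'I_n -> R) : \sum_(i < n) (r i)%:C = (\sum_(i < n) r i)%:C.
Proof.
elim: n r => [|n IH] r; first by rewrite !big_ord0.
by rewrite !big_ord_recr/= IH; apply: complexP; rewrite !complex_simp//= addr0.
Qed.

Lemma nrm2_lincomb n (c : 'I_n -> R[i]) u : orthonormalL2 u ->
  nrm2 (lincomb c u) = \sum_(i < n) sqmod (c i).
Proof.
move=> uo; have uL := uo.1; have cL := lincomb_L2 c uL.
have := dot_self cL; rewrite dot_combl//.
under eq_bigr => i _ do rewrite (dotC cL (uL i)) dot_lincomb_ortho// mul_conj.
by rewrite sum_realC => /(congr1 ReR).
Qed.

(** Expansion of the squared norm of w minus its projection onto the span of the family. *)
Lemma Bessel n (e : 'I_n -> R -> R[i]) w : orthonormalL2 e -> L2 w ->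
  \sum_(i < n) sqmod (dotL2 (e i) w) <= nrm2 w.
Proof.
move=> eo wL; have eL := eo.1; pose c i := dotL2 w (e i).
have cL := lincomb_L2 c eL.
have h := nrm2_ge0 (fun x => w x - lincomb c e x).
move: h; rewrite (nrm2B wL cL) (nrm2_lincomb c eo) (dotC cL wL) cReC dot_combl//.
have -> : \sum_(i < n) c i * dotL2 (e i) w = (\sum_(i < n) sqmod (c i))%:C.
  rewrite -sum_realC; apply: eq_bigr => i _.
  by rewrite (dotC wL (eL i)) -mul_conj.
have -> : \sum_(i < n) sqmod (dotL2 (e i) w) = \sum_(i < n) sqmod (c i).
  by apply: eq_bigr => i _; rewrite (dotC wL (eL i)) sqmod_conj.
rewrite /=; lra.
Qed.

(** N + 1 vectors in dimension N are dependent: the row kernel has positive rank. *)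
Lemma left_kernel (F : fieldType) (N : nat) (M : 'M[F]_(N.+1, N)) :
  exists c : 'I_N.+1 -> F, (exists i, c i != 0) /\
    forall j, \sum_(i < N.+1) c i * M i j = 0.
Proof.
have : kermx M != 0.
  rewrite -mxrank_eq0 mxrank_ker -lt0n subn_gt0.
  by rewrite (leq_ltn_trans (rank_leq_col M)).
case/rowV0Pn => v vk v0.
have vM : v *m M = 0 by apply/sub_kermxP; rewrite (submx_trans vk).
exists (fun i => v 0 i); split.
  apply: contrapT => h; move/negP: v0; apply; apply/eqP/rowP => i; rewrite mxE.
  by apply: contrapT => /eqP vi; apply: h; exists i.
by move=> j; move/matrixP : vM => /(_ 0 j); rewrite !mxE.
Qed.

(** * Forms that are small on the orthogonal complement of N functions *)

Section FiniteRank.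
Variables (N : nat) (phi : 'I_N -> R -> R[i]) (delta : R) (q : (R -> R[i]) -> R).
Hypothesis phiL : forall j, L2 (phi j).
Hypothesis qphi : forall v, L2 v -> (forall j,
  dotL2 v (phi j) = 0) -> q v <= delta * nrm2 v.

(** The min-max argument: N + 1 orthonormal functions have a nonzero combination orthogonal to the N
    functions [phi j]. It serves both the singular values and the spectral subspaces. *)
Lemma orthonormal_vanishing (u : 'I_N.+1 -> R -> R[i]) : orthonormalL2 u ->
  exists c : 'I_N.+1 -> R[i], 0 < \sum_(i < N.+1) sqmod (c i) /\
   q (lincomb c u) <= delta * \sum_(i < N.+1) sqmod (c i).
Proof.
move=> uo; have [c [[i ci] cM]] := left_kernel (\matrix_(i, j) dotL2 (u i) (phi j)).
exists c; split.
  rewrite (bigD1 i)//=; apply: ltr_pwDl; last by apply: sumr_ge0 => *;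
    exact: sqmod_ge0.
  rewrite lt_neqAle sqmod_ge0 andbT; apply/eqP => h; move/eqP : ci; apply.
  exact/sqmod_eq0/esym.
rewrite -(nrm2_lincomb c uo); apply: qphi; first exact: (lincomb_L2 c uo.1).
move=> j; rewrite (dot_combl c uo.1)//; have := cM j.
by under eq_bigr do rewrite mxE.
Qed.

(* A nonzero vector in the range of [P] is not orthogonal to all the [phi j], so
   that this range has dimension at most [N]. *)
Variables (P : operator R) (eps : R).
Hypothesis Padj : is_adjoint P P.
Hypothesis Pidem : forall f, L2 f -> P (P f) = P f %[ae mu].
Hypothesis deltaeps : delta < eps.
Hypothesis qP : forall v, L2 v -> P v = v %[ae mu] -> eps * nrm2 v <= q v.

Let PL f : L2 f -> L2 (P f). Proof. by case: Padj => h _ _; exact: h. Qed.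
Let Psa f g : L2 f -> L2 g -> dotL2 (P f) g = dotL2 f (P g).
Proof. by case: Padj => _ _ h; exact: h. Qed.

(** Linearity of [P] up to null sets comes from its self-adjointness: in a pairing, [P] moves to the
    test function. *)
Lemma range_lincomb n (c : 'I_n -> R[i]) u : (forall i, L2 (u i)) ->
  (forall i, P (u i) = u i %[ae mu]) -> P (lincomb c u) = lincomb c u %[ae mu].
Proof.
move=> uL Pu; have cL := lincomb_L2 c uL.
apply: dot_eq_ae => //; first exact: PL.
move=> h hL; rewrite Psa// !dot_combl//; last exact: PL.
apply: eq_bigr => i _; rewrite -Psa//; congr (_ * _).
by apply: dot_ae_l (Pu i) => //; exact: PL.
Qed.

Lemma range_dim (u : 'I_N.+1 -> R -> R[i]) : orthonormalL2 u ->
  ~ (forall i, P (u i) = u i %[ae mu]).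
Proof.
move=> uo Pu; have [c [c0 cq]] := orthonormal_vanishing uo.
have := qP (lincomb_L2 c uo.1) (range_lincomb c uo.1 Pu);
  rewrite (nrm2_lincomb c uo).
move=> h; have : (eps - delta) * \sum_(i < N.+1) sqmod (c i) <= 0.
  by rewrite mulrBl; have := le_trans h cq; lra.
by apply/negP; rewrite -ltNge mulr_gt0// subr_gt0.
Qed.

(** Otherwise every orthonormal family of at most N members in the range could be enlarged by the
    normalised difference between some v and its projection, until N + 1 members contradict
    [range_dim]. *)
Lemma range_basis : exists m (w : 'I_m -> R -> R[i]), [/\ (m <= N)%N,
  orthonormalL2 w,
   (forall i, P (w i) = w i %[ae mu]) &
   forall v, L2 v -> P v = v %[ae mu] -> v = lincomb (fun i =>
     dotL2 v (w i)) w %[ae mu]].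
Proof.
apply: contrapT => nob.
have ext m : (m <= N.+1)%N -> exists w : 'I_m -> R -> R[i],
    orthonormalL2 w /\ forall i, P (w i) = w i %[ae mu].
  elim: m => [_|m IH mN].
    by exists (fun _ _ => 0); split=> [|[]//]; split => -[].
  have [w [wo Pw]] := IH (ltnW mN).
  have [v [vL Pv nv]] : exists v, [/\ L2 v, P v = v %[ae mu] &
      ~ v = lincomb (fun i => dotL2 v (w i)) w %[ae mu]].
    apply: contrapT => nex; apply: nob; exists m, w; split=> // v vL Pv.
    by apply: contrapT => nv; apply: nex; exists v.
  pose c i := dotL2 v (w i); have cL := lincomb_L2 c wo.1.
  pose r x := v x - lincomb c w x; have rL : L2 r := L2B vL cL.
  have r0 : 0 < nrm2 r.
    rewrite lt_neqAle nrm2_ge0 andbT; apply/eqP => h; apply: nv.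
    by apply: ae_sub0; apply: nrm2_eq0 => //; exact: esym.
  have rw i : dotL2 r (w i) = 0.
    by rewrite dotBl//; [rewrite dot_lincomb_ortho// subrr|exact: wo.1].
  have Pr : P r = r %[ae mu].
    apply: dot_eq_ae => //; first exact: PL.
    move=> h hL; rewrite Psa// !dotBl//; last exact: PL.
    rewrite -!Psa//; congr (_ - _); first exact: dot_ae_l (PL vL) vL hL Pv.
    exact: dot_ae_l (PL cL) cL hL (range_lincomb c wo.1 Pw).
  pose s := (Num.sqrt (nrm2 r))^-1; pose z x := s%:C * r x.
  have zL : L2 z := L2Z _ rL.
  have zw i : dotL2 z (w i) = 0 by rewrite dotZl ?rw ?mulr0//; exact: wo.1.
  have zz : dotL2 z z = 1.
    rewrite dotZl// (dotC zL rL) dotZl// dot_self//.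
    have ss : s * s * nrm2 r = 1.
      rewrite /s -invfM -expr2 sqr_sqrtr ?nrm2_ge0// mulVf// gt_eqF//.
    by apply: complexP; rewrite !complex_simp /= -?ss; ring.
  have Pz : P z = z %[ae mu].
    apply: dot_eq_ae => //; first exact: PL.
    move=> h hL; rewrite Psa// !dotZl//; last exact: PL.
    by rewrite -Psa//; congr (_ * _); exact: dot_ae_l (PL rL) rL hL Pr.
  exists (fun i => if unlift ord_max i is Some j then w j else z); split;
    last first.
    by move=> i; case: (unlift _ _).
  split=> [i|i j]; first by case: unliftP => [k _|_]; [exact: wo.1|].
  case: unliftP => [k ->|->]; case: unliftP => [l ->|->].
  - by rewrite wo.2 (inj_eq lift_inj).
  - rewrite (dotC zL (wo.1 k)) zw eq_sym (negbTE (neq_lift _ _)).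
    by apply: complexP; rewrite !complex_simp/= ?oppr0.
  - by rewrite zw (negbTE (neq_lift _ _)).
  - by rewrite zz eqxx.
have [w [wo Pw]] := ext N.+1 (leqnn _).
exact: range_dim wo Pw.
Qed.

(** Each diagonal term is |P e_n|^2, the sum over i of |<e_n, w_i>|^2. After exchanging the sums,
    Bessel's inequality for the e_n gives at most |w_i|^2 = 1 for each of the m <= N indices i. *)
Lemma trace_partial_le (e : nat -> R -> R[i]) k : orthonormalL2 e ->
  \sum_(n < k) ReR (dotL2 (P (e n)) (e n)) <= N%:R.
Proof.
move=> eo; have eL := eo.1.
have [m [w [mN wo Pw wb]]] := range_basis.
have E n : ReR (dotL2 (P (e n)) (e n)) = \sum_(i < m) sqmod (dotL2 (e n) (w i)).
  have PLn := PL (eL n).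
  have -> : dotL2 (P (e n)) (e n) = dotL2 (P (e n)) (P (e n)).
    rewrite -Psa//; apply: dot_ae_l (eL n) (ae_sym (Pidem (eL n))) => //; exact: PL.
  rewrite dot_self//=.
  have cL := lincomb_L2 (fun i => dotL2 (P (e n)) (w i)) wo.1.
  rewrite (nrm2_ae PLn cL (wb _ PLn (Pidem (eL n)))) nrm2_lincomb//.
  apply: eq_bigr => i _; congr sqmod; rewrite Psa//; last exact: wo.1.
  by apply: dot_ae_r (Pw i) => //; [exact/PL/wo.1|exact: wo.1].
under eq_bigr do rewrite E.
rewrite exchange_big/= (@le_trans _ _ (\sum_(i < m) 1))//; last first.
  by rewrite sumr_const card_ord ler_nat.
apply: ler_sum => i _.
have wi : nrm2 (w i) = 1.
  by have := dot_self (wo.1 i); rewrite wo.2 eqxx => /(congr1 ReR)/= <-.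
rewrite -wi; apply: (Bessel (e := fun n : 'I_k => e n)); last exact: wo.1.
by split=> [j|j l]; [exact: eL|rewrite eo.2].
Qed.

End FiniteRank.

End Operators.

(** * Bounds for singular values and spectral projections *)

Section SpectralBounds.
Context {R : realType}.
Local Open Scope complex_scope.
Local Notation mu := (@lebesgue_measure R).
Local Notation ReR := (@complex.Re R).
Implicit Types (f g h : R -> R[i]) (T : operator R).

Lemma dot0l g : L2 g -> dotL2 (fun=> 0) g = 0.
Proof.
move=> gL; rewrite -[RHS](mul0r (dotL2 (fun=> 0) g)) -(dotZl 0 L20 gL).
by congr dotL2; apply/funext => x; rewrite mul0r.
Qed.

Lemma dot0r g : L2 g -> dotL2 g (fun=> 0) = 0.
Proof.
move=> gL; rewrite (dotC (L20 (R := R)) gL) dot0l//.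
by apply: complexP; rewrite !complex_simp/= ?oppr0.
Qed.

Section Bounds.
Variables A B : set R.
Hypotheses (mA : measurable A) (mB : measurable B).
Hypotheses (finA : (mu A < +oo)%E) (finB : (mu B < +oo)%E).
Variables (N : nat) (phi : 'I_N -> R -> R[i]) (delta : R).
Hypothesis phiL : forall j, L2 (phi j).
Hypothesis Kphi : forall v, L2 v -> (forall j, dotL2 v (phi j) = 0) ->
  nrm2 (Kgen A B v) <= delta * nrm2 v.

Let S := Sgen A B.
Let SL : L2stable S := Sgen_L2 mA mB finA finB.

(** For v the combination of the N + 1 eigenvectors with coefficients c_i, |K v|^2 is the sum of
    sigma_i^2 |c_i|^2. It is at least t^2 |v|^2, and at most delta |v|^2 for the combination
    orthogonal to all [phi j]. *)
Lemma singular_bound : 0 <= delta ->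
  (singular_value (Kgen A B) N.+1 <= (Num.sqrt delta)%:E)%E.
Proof.
move=> d0; apply: ge_ereal_sup => _ [t [t0 [u [sigma [uo ts eig]]]] <-].
rewrite lee_fin -(ger0_norm t0) -sqrtr_sqr ler_wsqrtr//.
have [c [c0 cq]] := orthonormal_vanishing phiL Kphi uo.
have uL := uo.1; have vL := lincomb_L2 c uL.
have E : nrm2 (Kgen A B (lincomb c u)) = \sum_(i < N.+1) sigma i ^+ 2 * sqmod (c i).
  have h := Sgen_form mA mB finA finB vL.
  have : dotL2 (lincomb c u) (S (lincomb c u)) = (\sum_(i < N.+1) sigma i ^+ 2
    * sqmod (c i))%:C.
    rewrite dot_combl//; last exact: SL.
    rewrite -sum_realC; apply: eq_bigr => i _.
    rewrite -(Sgen_sa mA mB finA finB)//.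
    rewrite (dot_ae_l (SL (uL i)) (L2Z _ (uL i)) vL (eig i)) dotZl//.
    rewrite (dotC vL (uL i)) dot_lincomb_ortho//.
    by apply: complexP; rewrite !complex_simp /sqmod/=; ring.
  rewrite -(Sgen_sa mA mB finA finB)// h => /(congr1 ReR).
  by [].
have : t ^+ 2 * \sum_(i < N.+1) sqmod (c i) <= delta * \sum_(i < N.+1) sqmod (c i).
  apply: le_trans cq; rewrite E mulr_sumr; apply: ler_sum => i _.
  rewrite ler_wpM2r ?sqmod_ge0// !expr2.
  by apply: ler_pM.
by rewrite ler_pM2r.
Qed.

(** The scalar spectral measure of v has total mass |v|^2 and is carried by D, where the variable is
    at least eps; its first moment is |K v|^2. *)
Lemma spectral_range_form (E : set R -> operator R) (eps : R) (D : set R) v :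
  is_spectral_measure S E -> measurable D -> (forall x, D x -> eps <= x) ->
  L2 v -> E D v = v %[ae mu] -> eps * nrm2 v <= nrm2 (Kgen A B v).
Proof.
move=> [Eadj Emul ET Enu] mD Deps vL Dv.
have [nu [nuE inu Snu]] := Enu v vL.
have EL D' : measurable D' -> L2 (E D' v) by move=> /Eadj[h _ _]; exact: h.
have mDc : measurable (~` D) by exact: measurableC.
have nuT : nu setT = (nrm2 v)%:E.
  rewrite nuE//; congr EFin.
  by rewrite (dot_ae_l (EL _ measurableT) vL vL (ET v vL)) dot_self.
(* Replacing the second v by E(D) v and moving E(D) to the other side leaves E of the empty set,
   whose pairing with v is the measure of the empty set. *)
have nuDc : nu (~` D) = 0%E.
  rewrite nuE//; have [PL _ Psa] := Eadj D mD.
  rewrite -(dot_ae_r (EL _ mDc) (EL _ mD) vL Dv) -Psa//; last exact: EL.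
  have h := Emul D (~` D) v mD mDc vL.
  rewrite setICr in h.
  rewrite (dot_ae_l (PL _ (EL _ mDc)) (EL _ measurable0) vL (ae_sym h)).
  by rewrite -nuE// measure0.
have nuD : nu D = (nrm2 v)%:E.
  have e : (nu setT = nu D + nu (~` D))%E.
    by rewrite -(setUv D); exact: (@measureU _ _ _ nu _ _ mD mDc (setICr D)).
  by rewrite -nuT e nuDc adde0.
have <- : \int[nu]_x x = nrm2 (Kgen A B v).
  have := Snu; rewrite (Sgen_form mA mB finA finB vL) => /(congr1 ReR) h.
  exact: esym h.
have -> : \int[nu]_x x = \int[nu]_(x in D) x.
  rewrite -(setUv D) Rintegral_setU//; last 2 first.
  - by rewrite setUv; exact: inu.
  - by apply/disj_setPCl.
  rewrite [X in _ + X](_ : _ = 0) ?addr0//.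
  rewrite /Rintegral (_ : (\int[nu]_(x in ~` D) x%:E)%E = 0%E)//.
  apply: null_set_integral => //; exact: measurable_funTS.
have iD : nu.-integrable D (fun x : R => x%:E).
  by apply: (@integrableS _ _ _ nu setT) => //; exact: inu.
have finD : (nu D < +oo)%E by rewrite nuD ltry.
have icst : nu.-integrable D (EFin \o (fun=> eps)).
  apply/integrableP; split; first exact/measurable_EFinP.
  rewrite (eq_integral (cst `|eps|%:E))//.
  by rewrite (@integral_cst _ _ _ nu D mD `|eps|%:E) nuD -EFinM ltry.
have -> : eps * nrm2 v = \int[nu]_(x in D) eps.
  by rewrite Rintegral_cst// nuD.
by apply: le_Rintegral => // x Dx; exact: Deps.
Qed.

(* When no Hilbert basis or no spectral measure exists, the corresponding [xget]
   returns its default value and the trace is zero. *)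
Lemma trace_bound (eps : R) (D : set R) : measurable D ->
  (forall x, D x -> eps <= x) -> delta < eps ->
  exists2 r : R, 0 <= r <= N%:R & trace (spectral_projection S D) = r%:E.
Proof.
move=> mD Deps deps.
rewrite /trace /spectral_projection.
set E := xget _ _; set e := xget _ _.
have eP : is_hilbert_basis e \/ e = (fun _ _ => 0).
  have [h|h] := pselect (exists e : nat -> R -> R[i], is_hilbert_basis e).
    by left; case: h => e' he'; rewrite /e; apply: xgetPex; exists e'.
  by right; apply: xgetPN => e' he'; apply: h; exists e'.
have eL n : L2 (e n).
  by case: eP => [[[h _] _]|->]; [exact: h|exact: L20].
have EP : is_spectral_measure S E \/ E = (fun _ _ _ => 0).
  have [h|h] := pselect (exists E : set R -> operator R, is_spectral_measure S E).
    by left; case: h => e' he'; rewrite /E; apply: xgetPex; exists e'.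
  by right; apply: xgetPN => e' he'; apply: h; exists e'.
have zero : (forall n, dotL2 (E D (e n)) (e n) = 0) ->
    exists2 r : R, 0 <= r <= N%:R & (\sum_(0 <= n <oo) (ReR (dotL2 (E D (e n))
      (e n)))%:E)%E = r%:E.
  move=> h; exists 0; first by rewrite lexx ler0n.
  by rewrite eseries0// => n _ _; rewrite h.
case: EP => [SE|E0]; last by apply: zero => n; rewrite E0 dot0l.
have [Eadj Emul ET Enu] := SE; have PD := Eadj D mD.
have EDL n : L2 (E D (e n)) by case: PD => h _ _; exact: h.
case: eP => [[eo _]|e0]; last first.
  by apply: zero => n; rewrite {2}e0 dot0r.
have Pidem f : L2 f -> E D (E D f) = E D f %[ae mu].
  by move=> fL; have := Emul D D f mD mD fL; rewrite setIid => /ae_sym.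
have tp k := @trace_partial_le R N phi delta (fun v => nrm2 (Kgen A B v)) phiL Kphi
  (E D) eps PD Pidem deps (fun v vL Pv => spectral_range_form SE mD Deps vL Pv)
    e k eo.
have nonneg n : 0 <= ReR (dotL2 (E D (e n)) (e n)).
  have [PL _ Psa] := PD.
  have -> : dotL2 (E D (e n)) (e n) = dotL2 (E D (e n)) (E D (e n)).
    by rewrite -Psa//; apply: dot_ae_l (ae_sym (Pidem _ (eL n))) => //; exact: PL.
  by rewrite dot_self//= nrm2_ge0.
set s := (\sum_(0 <= n <oo) _)%E.
have s0 : (0 <= s)%E by apply: nneseries_ge0 => n _ _; rewrite lee_fin.
have sN : (s <= N%:R%:E)%E.
  apply: lime_le; first by apply: is_cvg_nneseries => n _ _; rewrite lee_fin.
  by apply: nearW => k; rewrite sumEFin lee_fin big_mkord.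
case: s s0 sN => [r| |]//; rewrite ?lee_fin => r0 rN.
by exists r; rewrite ?r0.
Qed.

End Bounds.
End SpectralBounds.

(** * Taylor approximation of the kernel *)

Section Taylor.
Context {R : realType}.
Local Open Scope complex_scope.
Implicit Types (a : nat -> R).

(** The Taylor polynomial whose derivatives at zero are the [a j]. It has N terms, not degree N, so
    that it yields an operator of rank N. *)
Definition tpoly a (N : nat) (t : R) : R := \sum_(j < N) a j * (t ^+ j / j`!%:R).

Lemma tpolyS a N t : tpoly a N.+1 t = tpoly a N t + a N * (t ^+ N / N`!%:R).
Proof. by rewrite /tpoly big_ord_recr. Qed.

Lemma is_derive_monomial (c x : R) N :
  is_derive x 1 (fun t => c * t ^+ N.+1) (c * (N.+1%:R * x ^+ N)).
Proof.
have -> : (fun t => c * t ^+ N.+1) = c \*: (@id R ^+ N.+1).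
  by apply/funext => t; rewrite exprfctE.
have h2 := is_deriveZ c (@is_deriveX _ _ id N.+1 x 1 1 (is_derive_id x 1)).
by apply: (is_derive_eq h2); rewrite /GRing.scale/= mulr1.
Qed.

Lemma fact_neq0 N : N.+1%:R != 0 :> R /\ N`!%:R != 0 :> R.
Proof. by split; rewrite pnatr_eq0 -?lt0n ?fact_gt0. Qed.

Lemma is_derive_tpoly a N (x : R) :
  is_derive x 1 (tpoly a N.+1) (tpoly (fun j => a j.+1) N x).
Proof.
elim: N => [|N IH].
  rewrite (_ : tpoly a 1 = cst (a 0%N)); first by rewrite /tpoly big_ord0;
    exact: is_derive_cst.
  by apply/funext => t; rewrite /tpoly big_ord1 expr0 fact0 divr1 mulr1.
have -> : tpoly a N.+2 = tpoly a N.+1 + (fun t => (a N.+1 / N.+1`!%:R) * t ^+ N.+1).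
  by apply/funext => t; rewrite tpolyS; congr (_ + _); rewrite mulrA mulrAC.
apply: (is_derive_eq (is_deriveD IH (is_derive_monomial _ x N))).
rewrite tpolyS; congr (_ + _); have [h1 h2] := fact_neq0 N.
by rewrite factS natrM; move: h1 h2; move: (N.+1%:R : R) (N`!%:R : R) =>
  p q h1 h2; field; rewrite h1 h2.
Qed.

(** The j-th derivatives of cos and sin at zero, generated by the rule (cos, sin)' = (-sin, cos). *)
Fixpoint trig_coef (j : nat) : R * R :=
  if j is j'.+1 then (- (trig_coef j').2, (trig_coef j').1) else (1, 0).

Definition cosT := tpoly (fun j => (trig_coef j).1).
Definition sinT := tpoly (fun j => (trig_coef j).2).

Lemma is_derive_cosT N (x : R) : is_derive x 1 (cosT N.+1) (- sinT N x).
Proof.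
apply: (is_derive_eq (is_derive_tpoly _ _ _)).
by rewrite /sinT /tpoly -sumrN; apply: eq_bigr => i _; rewrite /= mulNr.
Qed.

Lemma is_derive_sinT N (x : R) : is_derive x 1 (sinT N.+1) (cosT N x).
Proof. exact: (is_derive_eq (is_derive_tpoly _ _ _)). Qed.

Lemma tpoly0 a N : tpoly a N.+1 0 = a 0%N.
Proof.
rewrite /tpoly big_ord_recl expr0 fact0 divr1 mulr1 big1 ?addr0// => i _.
by rewrite lift0 expr0n/= mul0r mulr0.
Qed.

(** The right side minus f vanishes at 0 and has a nonnegative derivative on [0, s]; the mean value
    theorem concludes. *)
Lemma derive_bound (f f' : R -> R) (K s : R) (N : nat) : 0 <= s ->
  (forall x : R, is_derive x 1 f (f' x)) -> f 0 = 0 ->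
  (forall x, 0 <= x -> f' x <= K * (x ^+ N / N`!%:R)) ->
  f s <= K * (s ^+ N.+1 / N.+1`!%:R).
Proof.
move=> s0 df f0 fK.
pose g x := K / N.+1`!%:R * x ^+ N.+1 - f x.
have dg (x : R) : is_derive x 1 g (K * (x ^+ N / N`!%:R) - f' x).
  have dfx := df x.
  apply: (is_derive_eq (is_deriveB (is_derive_monomial _ x N) dfx)).
  congr (_ - _); have [h1 h2] := fact_neq0 N.
  by rewrite factS natrM; move: h1 h2; move: (N.+1%:R : R) (N`!%:R : R) =>
    p q h1 h2; field; rewrite h1 h2.
have cg : {within `[0, s], continuous g}.
  apply: derivable_within_continuous => x _.
  by have [] := dg x.
have [c cs gE] := MVT_segment s0 (fun x _ => dg x) cg.
have c0 : 0 <= c by move: cs; rewrite in_itv/= => /andP[].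
have : 0 <= g s - g 0 by rewrite gE mulr_ge0 ?subr0// subr_ge0 fK.
rewrite /g f0 expr0n/= mulr0 !subr0 subr_ge0 => /le_trans; apply.
by rewrite mulrAC mulrA.
Qed.

(* The factor [th] of the argument handles both signs at once. *)
Lemma trig_Taylor_aux (th : R) (N : nat) : forall s : R, 0 <= s ->
  `|cos (th * s) - cosT N (th * s)| <= `|th| ^+ N * (s ^+ N / N`!%:R) /\
  `|sin (th * s) - sinT N (th * s)| <= `|th| ^+ N * (s ^+ N / N`!%:R).
Proof.
elim: N => [|N IH] s s0.
  rewrite /cosT /sinT /tpoly !big_ord0 !subr0 !expr0 fact0 divr1 mulr1.
  by rewrite !ler_norml cos_geN1 cos_le1 sin_geN1 sin_le1.
have dth (x : R) : is_derive x 1 (fun x : R => th * x) th.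
  by apply: is_derive_eq; rewrite /GRing.scale/= !mulr1.
have dc (x : R) : is_derive x 1 (fun s => cos (th * s) - cosT N.+1 (th * s))
    (- th * (sin (th * x) - sinT N (th * x))).
  have h1 := is_derive1_comp (is_derive_cos (th * x)) (dth x).
  have h2 := is_derive1_comp (is_derive_cosT N (th * x)) (dth x).
  by apply: (is_derive_eq (is_deriveB h1 h2)); ring.
have ds (x : R) : is_derive x 1 (fun s => sin (th * s) - sinT N.+1 (th * s))
    (th * (cos (th * x) - cosT N (th * x))).
  have h1 := is_derive1_comp (is_derive_sin (th * x)) (dth x).
  have h2 := is_derive1_comp (is_derive_sinT N (th * x)) (dth x).
  by apply: (is_derive_eq (is_deriveB h1 h2)); ring.
have dN (f : R -> R) (f' : R -> R) : (forall x : R, is_derive x 1 f (f' x)) ->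
    (forall x : R, is_derive x 1 (fun s => - f s) (- f' x)).
  by move=> df x; exact: is_deriveN (df x).
have bd (f f' : R -> R) : (forall x : R, is_derive x 1 f (f' x)) -> f 0 = 0 ->
    (forall x, 0 <= x -> `|f' x| <= `|th| * (`|th| ^+ N * (x ^+ N / N`!%:R))) ->
    `|f s| <= `|th| ^+ N.+1 * (s ^+ N.+1 / N.+1`!%:R).
  move=> df f0 fb.
  have fb1 x : 0 <= x -> f' x <= `|th| ^+ N.+1 * (x ^+ N / N`!%:R).
    by move=> x0; rewrite exprS -mulrA (le_trans (ler_norm _))// fb.
  have fb2 x : 0 <= x -> - f' x <= `|th| ^+ N.+1 * (x ^+ N / N`!%:R).
    by move=> x0; rewrite exprS -mulrA (le_trans (ler_norm _))// normrN fb.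
  rewrite ler_norml (derive_bound s0 df f0 fb1) andbT lerNl.
  by apply: (derive_bound s0 (dN _ _ df) _ fb2); rewrite f0 oppr0.
split.
- apply: (bd _ _ dc); first by rewrite mulr0 cos0 /cosT tpoly0/= subrr.
  by move=> x x0; rewrite normrM normrN ler_wpM2l// (IH x x0).2.
- apply: (bd _ _ ds); first by rewrite mulr0 sin0 /sinT tpoly0/= subrr.
  by move=> x x0; rewrite normrM ler_wpM2l// (IH x x0).1.
Qed.

Lemma cos_Taylor N (t : R) : `|cos t - cosT N t| <= `|t| ^+ N / N`!%:R.
Proof.
have [h _] := trig_Taylor_aux t N ler01.
by move: h; rewrite mulr1 expr1n mul1r.
Qed.

Lemma sin_Taylor N (t : R) : `|sin t - sinT N t| <= `|t| ^+ N / N`!%:R.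
Proof.
have [_ h] := trig_Taylor_aux t N ler01.
by move: h; rewrite mulr1 expr1n mul1r.
Qed.

End Taylor.

(** * Smallness of the kernel on the complement of the monomials *)

Section FiniteRankApproximation.
Context {R : realType}.
Local Open Scope complex_scope.
Local Notation mu := (@lebesgue_measure R).
Local Notation hat := (@fourier_integral R).

Definition monomial (A : set R) (j : nat) (x : R) : R := x ^+ j * \1_A x.

Definition moment2 (A : set R) (j : nat) : R := \int[mu]_x (monomial A j x ^+ 2).

Section OneSet.
Variable A : set R.
Hypothesis mA : measurable A.
Hypothesis monoL : forall j, sqi (monomial A j).

Lemma tpoly_pairing (a : nat -> R) (N : nat) (v : R -> R) xi : sqi v ->
  (forall j : 'I_N, \int[mu]_x (v x * monomial A j x) = 0) ->
  integ (fun x => v x * \1_A x * tpoly a N (2 * pi * x * xi)) /\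
  \int[mu]_x (v x * \1_A x * tpoly a N (2 * pi * x * xi)) = 0.
Proof.
move=> vs v0.
pose F (j : 'I_N) x := a j * (2 * pi * xi) ^+ j / j`!%:R * (v x * monomial A j x).
have Fi j : integ (F j) by apply: integZ; exact: sqi_mul.
have [si se] := Rint_sum Fi.
have E x : \sum_(j < N) F j x = v x * \1_A x * tpoly a N (2 * pi * x * xi).
  rewrite /tpoly mulr_sumr; apply: eq_bigr => j _; rewrite /F /monomial.
  by rewrite (_ : 2 * pi * x * xi = 2 * pi * xi * x) ?exprMn; ring.
split; first exact: (eq_integ E si).
rewrite -(eq_Rint E) se big1// => j _; rewrite RintZ ?v0 ?mulr0//; exact: sqi_mul.
Qed.

(** Orthogonality to the monomials allows the Taylor polynomial to be subtracted from the kernel.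
    The remainder is at most (2 pi)^N |x xi|^N / N!, and Cauchy-Schwarz separates v from x^N 1_A. *)
Lemma transform_small (k : R -> R) (a : nat -> R) (N : nat) (v : R -> R) xi :
  measurable_fun setT k -> (forall t, `|k t| <= 1) ->
  (forall t, `|k t - tpoly a N t| <= `|t| ^+ N / N`!%:R) ->
  sqi v -> (forall j : 'I_N, \int[mu]_x (v x * monomial A j x) = 0) ->
  (\int[mu]_x (v x * \1_A x * k (2 * pi * x * xi))) ^+ 2 <=
  ((2 * pi) ^+ N / N`!%:R) ^+ 2 * moment2 A N * \int[mu]_x (v x ^+ 2) * (xi ^+
    N) ^+ 2.
Proof.
move=> mk k1 kT vs v0.
have [pi_ pe] := tpoly_pairing a xi vs v0.
have mph : measurable_fun setT (fun x : R => 2 * pi * x * xi).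
  by apply: measurable_funM => //; exact: mulrl_measurable.
have s1 : sqi (\1_A : R -> R).
  by have := monoL 0; rewrite (_ : monomial A 0 = \1_A)//; apply/funext => x;
    rewrite /monomial expr0 mul1r.
have ki : integ (fun x => v x * \1_A x * k (2 * pi * x * xi)).
  apply: (@integ_mulb _ _ _ 1 (sqi_mul vs s1)); first exact: measurableT_comp.
  by move=> x; exact: k1.
set kap := (2 * pi) ^+ N / N`!%:R.
have kap0 : 0 <= kap by rewrite divr_ge0 ?exprn_ge0 ?mulr_ge0 ?pi_ge0.
pose w x := `|monomial A N x|.
have ws : sqi w.
  split; first by apply: measurableT_comp => //; exact: (monoL N).1.
  by apply: (eq_integ _ (monoL N).2) => x; rewrite /w real_normK ?num_real.
pose u x := `|v x|.
have us : sqi u.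
  split; first by apply: measurableT_comp => //; exact: vs.1.
  by apply: (eq_integ _ vs.2) => x; rewrite /u real_normK ?num_real.
have uw := sqi_mul us ws.
have b : `|\int[mu]_x (v x * \1_A x * k (2 * pi * x * xi))| <=
    kap * `|xi| ^+ N * \int[mu]_x (u x * w x).
  (* The polynomial part, whose integral is zero, is subtracted here. *)
  rewrite -[X in `|X|]subr0 -pe -RintB// -RintZ//.
  apply: norm_Rint_le; [exact: integB|exact: integZ|move=> x].
  rewrite -mulrBr normrM.
  apply: (@le_trans _ _ (`|v x * \1_A x| * (`|2 * pi * x * xi| ^+ N / N`!%:R))).
    by rewrite ler_wpM2l.
  rewrite /u /w /monomial !normrM !exprMn (ger0_norm (ler0n _ 2)) (ger0_norm
    (pi_ge0 R)) normrX /kap.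
  by rewrite le_eqVlt; apply/orP; left; apply/eqP; rewrite exprMn; ring.
have CS := Rint_CS us ws.
have eu : \int[mu]_x (u x ^+ 2) = \int[mu]_x (v x ^+ 2).
  by apply: eq_Rint => x; rewrite /u real_normK ?num_real.
have ew2 : \int[mu]_x (w x ^+ 2) = moment2 A N.
  by apply: eq_Rint => x; rewrite /w real_normK ?num_real.
rewrite eu ew2 in CS.
have xi0 : 0 <= `|xi| ^+ N by rewrite exprn_ge0.
have uw0 : 0 <= \int[mu]_x (u x * w x) by apply: Rint_ge0 => x;
  apply: mulr_ge0; exact: normr_ge0.
rewrite -[leLHS]real_normK ?num_real//.
apply: (@le_trans _ _ ((kap * `|xi| ^+ N * \int[mu]_x (u x * w x)) ^+ 2)).
  by rewrite !expr2 ler_pM.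
have e2 : (`|xi| ^+ N) ^+ 2 = (xi ^+ N) ^+ 2.
  by rewrite -normrX real_normK ?num_real.
rewrite -e2; move: CS; move: (`|xi| ^+ N) (moment2 A N) (\int[mu]_x (v x ^+ 2))
  (\int[mu]_x (u x * w x)) => X M V I CS.
rewrite (_ : (kap * X * I) ^+ 2 = (kap * X) ^+ 2 * I ^+ 2); last by ring.
rewrite (_ : kap ^+ 2 * M * V * X ^+ 2 = (kap * X) ^+ 2 * (V * M)); last by ring.
by rewrite ler_wpM2l ?sqr_ge0.
Qed.

End OneSet.

Section TwoSets.
Variables A B : set R.
Hypotheses (mA : measurable A) (mB : measurable B).
Hypotheses (finA : (mu A < +oo)%E) (finB : (mu B < +oo)%E).
Hypothesis monoA : forall j, sqi (monomial A j).
Hypothesis monomialB : forall j, sqi (monomial B j).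

Definition phi (j : nat) (x : R) : R[i] := (monomial A j x)%:C.

Lemma phi_L2 j : L2 (phi j).
Proof. by apply/L2P; split; [exact: monoA|exact: sqi0]. Qed.

(** A bound for the squared norm of the remainder. The factor 4 is 2 from (p + s)^2 <= 2 p^2 + 2
    s^2, times 2 because the real and the imaginary part of v each have a cosine and a sine
    transform. *)
Definition delta N := 4 * ((2 * pi) ^+ N / N`!%:R) ^+ 2 * moment2 A N * moment2 B N.

Lemma Kgen_small N v : L2 v -> (forall j : 'I_N, dotL2 v (phi j) = 0) ->
  nrm2 (Kgen A B v) <= delta N * nrm2 v.
Proof.
move=> vL v0; have [vr vi] := (L2P v).1 vL.
have lv := cL1L2_Pproj mA finA vL.
have z0 (b : R -> R) : \int[mu]_x (b x * 0) = 0.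
  by rewrite -[RHS](@Rint0 R); apply: eq_Rint => x; rewrite mulr0.
have r0 (j : 'I_N) : \int[mu]_x (re v x * monomial A j x) = 0.
  have := congr1 (@complex.Re R) (v0 j); rewrite re_dot//; last exact: phi_L2.
  by rewrite z0 addr0.
have i0 (j : 'I_N) : \int[mu]_x (im v x * monomial A j x) = 0.
  have := congr1 (@complex.Im R) (v0 j); rewrite im_dot//; last exact: phi_L2.
  by rewrite z0 subr0.
have KL := Kgen_L2 mA mB finA vL.
have hL := L2Pproj mB (hat_L2 lv).
rewrite (nrm2_ae KL hL (Kgen_hat B mA finA vL)).
pose kap : R := ((2 * pi) ^+ N / N`!%:R) ^+ 2.
have mM : measurable_fun setT (@cos R) := measurable_cos.
have CT (b : R -> R) xi : sqi b -> (forall j : 'I_N,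
  \int[mu]_x (b x * monomial A j x) = 0) ->
    cosft (fun x => b x * \1_A x) xi ^+ 2 <=
    kap * moment2 A N * \int[mu]_x (b x ^+ 2) * (xi ^+ N) ^+ 2.
  move=> bs b0.
  have cos1 (t : R) : `|cos t| <= 1 by rewrite ler_norml cos_geN1 cos_le1.
  exact: (@transform_small A monoA cos (fun j =>
    (trig_coef j).1) N b xi measurable_cos cos1 (@cos_Taylor R N) bs b0).
have ST (b : R -> R) xi : sqi b -> (forall j : 'I_N,
  \int[mu]_x (b x * monomial A j x) = 0) ->
    sinft (fun x => b x * \1_A x) xi ^+ 2 <=
    kap * moment2 A N * \int[mu]_x (b x ^+ 2) * (xi ^+ N) ^+ 2.
  move=> bs b0.
  have sin1 (t : R) : `|sin t| <= 1 by rewrite ler_norml sin_geN1 sin_le1.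
  exact: (@transform_small A monoA sin (fun j =>
    (trig_coef j).2) N b xi measurable_sin sin1 (@sin_Taylor R N) bs b0).
have -> : delta N * nrm2 v =
    \int[mu]_x (4 * kap * moment2 A N * nrm2 v * monomial B N x ^+ 2).
  by rewrite RintZ; [rewrite -/(moment2 B N) /delta -/kap;
    ring|exact: (monomialB N).2].
apply: le_Rint; [exact: nrm2_integ|exact/integZ/(monomialB N).2|move=> xi].
rewrite re_Pproj im_Pproj re_hat// im_hat//.
rewrite (funext (re_Pproj A v)) (funext (im_Pproj A v)).
have h1 := CT _ xi vr r0; have h2 := CT _ xi vi i0.
have h3 := ST _ xi vr r0; have h4 := ST _ xi vi i0.
rewrite (nrm2E vL) /monomial !exprMn.
rewrite -mulrDl [leRHS]mulrA ler_wpM2r ?sqr_ge0//.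
move: h1 h2 h3 h4.
set p := cosft _ xi; set q := cosft _ xi; set r := sinft _ xi; set s := sinft _ xi.
set I1 := \int[mu]_x _; set I2 := \int[mu]_x _; set X := (xi ^+ N) ^+ 2.
set m := kap * _.
have -> : 4 * kap * moment2 A N * (I1 + I2) * X =
   2 * (m * I1 * X) + 2 * (m * I2 * X) + 2 * (m * I1 * X) + 2 * (m * I2 * X).
  by rewrite /m; ring.
move: (m * I1 * X) (m * I2 * X) => Y Z h1 h2 h3 h4.
have := sqr_ge0 (p - s); have := sqr_ge0 (q + r); nra.
Qed.

End TwoSets.
End FiniteRankApproximation.

(** * The set A *)

Section CombSet.
Context {R : realType}.
Local Notation mu := (@lebesgue_measure R).
Local Notation A := (Astar R).
Local Notation m := (mseq R).
Local Notation K := (Kseq R).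
Local Notation l := (ellseq R).
Local Notation C := (Cset R).
Implicit Types (n k N : nat).

Lemma mseq_gt0 n : 0 < m n. Proof. exact: expR_gt0. Qed.

Lemma Kseq_ge n : expR (n%:R ^+ 6) <= (K n)%:R :> R.
Proof.
by apply: (le_trans (ceil_ge _)); rewrite /Kseq natr_absz ler_int ler_norm.
Qed.

Lemma Kseq_gt0 n : (0 < K n)%N.
Proof. by rewrite -(ltr_nat R); exact: lt_le_trans (expR_gt0 _) (Kseq_ge n). Qed.

Lemma ellseq_gt0 n : 0 < l n.
Proof. by rewrite divr_gt0 ?mseq_gt0// ltr0n Kseq_gt0. Qed.

Lemma Kseq_ellseq n : (K n)%:R * l n = m n.
Proof. by rewrite mulrC divfK// pnatr_eq0 -lt0n Kseq_gt0. Qed.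

Lemma ellseq_le n : l n <= m n.
Proof. by rewrite -Kseq_ellseq ler_peMl ?ler1n ?Kseq_gt0// ltW// ellseq_gt0. Qed.

(** The square of e^(1/2) >= 3/2. It gives 2 m_n <= 8/9 < 1, so that C_n stays inside [n, n+1) with
    a gap of at least 1/9 after it. *)
Lemma expR1_ge : 9 / 4 <= expR 1 :> R.
Proof.
rewrite (_ : expR 1 = expR (2^-1 + 2^-1 : R)); last by congr expR; field.
by rewrite expRD; have := expR_ge1Dx (2^-1 : R); nra.
Qed.

Lemma mseq_le n : (0 < n)%N -> m n <= 4 / 9.
Proof.
move=> n0; apply: (@le_trans _ _ (expR (- 1))).
  by rewrite ler_expR lerN2 exprn_ege1// ler1n.
rewrite expRN -[leRHS]invrK lef_pV2 ?posrE ?expR_gt0 ?invr_gt0 ?divr_gt0//.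
by rewrite invf_div; exact: expR1_ge.
Qed.

(** 17 = 1 + 2^4. From n = 2 on, a translation by l_n <= 1/17 is too short to cross the gaps of
    length 1/9 between the sets C_k. *)
Lemma mseq_le2 n : (2 <= n)%N -> m n <= 17^-1.
Proof.
move=> n2; rewrite /mseq expRN lef_pV2 ?posrE ?expR_gt0//.
apply: le_trans (expR_ge1Dx _).
have : (2 : R) ^+ 4 <= n%:R ^+ 4 by rewrite lerXn2r ?nnegrE// ler_nat.
lra.
Qed.

Definition cell n k : set R :=
  `[n%:R + (2 * k)%:R * l n, n%:R + (2 * k + 1)%:R * l n[%classic.

Lemma CsetE n : C n = \bigcup_(k in `I_(K n)) cell n k.
Proof. by []. Qed.

Lemma cellP n k x : cell n k x <-> n%:R + (2 * k)%:R * l n <= x < n%:R + (2 * k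
  + 1)%:R * l n.
Proof. by rewrite /cell/= in_itv. Qed.

Lemma measurable_cell n k : measurable (cell n k).
Proof. exact: measurable_itv. Qed.

Lemma measurable_Cset n : measurable (C n).
Proof. by apply: bigcup_measurable => k _; exact: measurable_cell. Qed.

Lemma mu_cell n k : mu (cell n k) = (l n)%:E.
Proof.
rewrite lebesgue_measure_itv/= lte_fin ltrD2l ltr_pM2r ?ellseq_gt0//.
rewrite ltr_nat addn1 ltnSn -EFinD; congr EFin.
by rewrite -natr1; ring.
Qed.

Lemma mu_Cset n : mu (C n) = (m n)%:E.
Proof.
rewrite -Kseq_ellseq CsetE bigcup_mkord.
elim: (K n) => [|j IH]; first by rewrite big_ord0 measure0 mul0r.
rewrite big_ord_recr/= measureU.
- rewrite -/(mu _) [X in (X + _)%E]IH [X in (_ + X)%E]mu_cell -EFinD.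
  by congr EFin; rewrite -addn1 natrD; ring.
- by apply: bigsetU_measurable => k _; exact: measurable_cell.
- exact: measurable_cell.
- rewrite -bigcup_mkord -subset0 => x [[k /= kj /cellP/andP[_ h1]]
    /cellP/andP[h2 _]].
  have : n%:R + (2 * k + 1)%:R * l n <= n%:R + (2 * j)%:R * l n.
    by rewrite lerD2l ler_pM2r ?ellseq_gt0// ler_nat; lia.
  by move=> h3; have := le_lt_trans (le_trans h3 h2) h1; rewrite ltxx.
Qed.

Lemma Cset_itv n x : (0 < n)%N -> C n x -> n%:R <= x < n%:R + 2 * m n.
Proof.
move=> n0 [k /= kK /cellP/andP[h1 h2]]; apply/andP; split.
  by apply: le_trans h1; rewrite lerDl mulr_ge0// ltW// ellseq_gt0.
apply: (lt_le_trans h2); rewrite lerD2l -Kseq_ellseq mulrA ler_pM2r ?ellseq_gt0//.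
by rewrite -natrM ler_nat; lia.
Qed.

Lemma Cset_lt n x : (0 < n)%N -> C n x -> n%:R <= x < n.+1%:R.
Proof.
move=> n0 /(Cset_itv n0)/andP[-> h]; rewrite (lt_le_trans h)// -(natr1 n) lerD2l.
by have := mseq_le n0; lra.
Qed.

Lemma Cset_left n : C n n%:R.
Proof.
exists 0%N; first exact: Kseq_gt0.
by apply/cellP; rewrite muln0 mul0r addr0 lexx add0n mul1r ltrDl ellseq_gt0.
Qed.

Lemma Cset_sub n : (0 < n)%N -> C n `<=` A.
Proof. by move=> n0 x Cx; exists n. Qed.

Lemma Astar_ge1 x : A x -> 1 <= x.
Proof.
move=> [n /= n0 /(Cset_lt n0)/andP[h _]]; apply: le_trans h.
by rewrite ler1n.
Qed.

Lemma AstarE : A = \bigcup_n C n.+1.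
Proof.
apply/seteqP; split => [x [[//|n] _ Cx]|x [n _ Cx]]; first by exists n.
by exists n.+1.
Qed.

Lemma trivIset_Cset : trivIset setT (fun n => C n.+1).
Proof.
apply/trivIsetP => i j _ _ ij; rewrite -subset0 => x [Ci Cj].
have /andP[i1 i2] := Cset_lt (ltn0Sn i) Ci.
have /andP[j1 j2] := Cset_lt (ltn0Sn j) Cj.
have := le_lt_trans i1 j2; have := le_lt_trans j1 i2.
by rewrite !ltr_nat; move/eqP: ij; lia.
Qed.

Lemma measurable_Astar : measurable A.
Proof. by rewrite AstarE; apply: bigcup_measurable => k _;
  exact: measurable_Cset. Qed.

(* [ln y <= y - 1] at [y = n^4 / N] *)
Lemma ln_pow_le n N : (0 < n)%N ->
  2 * N%:R * ln n%:R <= N%:R / 2 * ln N%:R + n%:R ^+ 4 / 2 :> R.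
Proof.
move=> n0; have n1 : 0 < n%:R :> R by rewrite ltr0n.
have n4 : 0 <= n%:R ^+ 4 :> R by rewrite exprn_ge0.
case: N => [|N]; first by rewrite mulr0 !mul0r add0r divr_ge0.
have N1 : 0 < N.+1%:R :> R by rewrite ltr0n.
have y0 : 0 < n%:R ^+ 4 / N.+1%:R :> R by rewrite divr_gt0// exprn_gt0.
have := @le_ln1Dx R (n%:R ^+ 4 / N.+1%:R - 1).
rewrite (_ : 1 + (_ - 1) = n%:R ^+ 4 / N.+1%:R); last by ring.
have -> : -1 < n%:R ^+ 4 / N.+1%:R - 1 :> R by rewrite ltrBrDr addNr.
move=> /(_ isT); rewrite ln_div ?posrE ?exprn_gt0// lnXn// => h.
have : (ln n%:R *+ 4 - ln N.+1%:R) * N.+1%:R <= n%:R ^+ 4 :> R.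
  apply: (@le_trans _ _ ((n%:R ^+ 4 / N.+1%:R) * N.+1%:R));
    last by rewrite divfK// gt_eqF.
  by rewrite ler_pM2r//; apply: (le_trans h); rewrite gerBl.
rewrite -[ln n%:R *+ 4]mulr_natr; lra.
Qed.

(** The factor 4^N pays for n + 1 <= 2 n raised to the power 2N, when x in C_n is replaced by n +
    1. *)
Definition moment_bound N : R := 4 ^+ N * expR (N%:R / 2 * ln N%:R).

(** One half of n^4 is spent in [ln_pow_le] to bound 2N ln n; the other half leaves e^(-n/2) <=
    (2/3)^n, which makes the series converge uniformly in N. *)
Lemma Cset_term_le n N : (0 < n)%N ->
  n.+1%:R ^+ (2 * N) * m n <= moment_bound N * (2 / 3) ^+ n.
Proof.
move=> n0; have n1 : 0 < n%:R :> R by rewrite ltr0n.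
apply: (@le_trans _ _ ((2 * n%:R) ^+ (2 * N) * m n)).
  rewrite ler_pM2r ?mseq_gt0// lerXn2r ?nnegrE ?mulr_ge0//.
  by rewrite -natrM ler_nat; lia.
have -> : (2 * n%:R) ^+ (2 * N) * m n =
    4 ^+ N * expR (2 * N%:R * ln n%:R - n%:R ^+ 4) :> R.
  have e4 : (2 : R) ^+ (2 * N) = 4 ^+ N.
    by rewrite exprM (_ : (2 : R) ^+ 2 = 4)//; ring.
  rewrite exprMn e4 -[LHS]mulrA; congr (_ * _); rewrite expRD; congr (_ * _).
  by rewrite -natrM mulrC expRM_natr ?lnK ?posrE.
rewrite /moment_bound -[leRHS]mulrA ler_wpM2l ?exprn_ge0//.
apply: (@le_trans _ _ (expR (N%:R / 2 * ln N%:R - n%:R / 2))).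
  rewrite ler_expR; have := ln_pow_le N n0.
  have : n%:R <= n%:R ^+ 4 :> R by rewrite ler_eXnr// ler1n.
  lra.
rewrite expRD ler_wpM2l ?expR_ge0//.
have -> : - (n%:R / 2) = - 2^-1 * n%:R :> R by ring.
rewrite expRM_natr lerXn2r ?nnegrE ?expR_ge0 ?divr_ge0//.
rewrite expRN -[leRHS]invrK lef_pV2 ?posrE ?expR_gt0 ?invr_gt0 ?divr_gt0// invf_div.
by have := expR_ge1Dx (2^-1 : R); lra.
Qed.

Lemma moment_bound_ge0 N : 0 <= moment_bound N.
Proof. by rewrite mulr_ge0 ?exprn_ge0// expR_ge0. Qed.

Lemma sum_geom_le k : \sum_(i < k) (2 / 3) ^+ i.+1 <= 2 :> R.
Proof.
suff -> : \sum_(i < k) (2 / 3) ^+ i.+1 = 2 - 2 * (2 / 3) ^+ k :> R.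
  by rewrite gerBl mulr_ge0// exprn_ge0// divr_ge0.
elim: k => [|k IH]; first by rewrite big_ord0 expr0; ring.
by rewrite big_ord_recr/= IH exprS; field.
Qed.

Lemma int_Astar_le N :
  (\int[mu]_(x in A) (x ^+ (2 * N))%:E <= (2 * moment_bound N)%:E)%E.
Proof.
have mX D : measurable_fun D (fun x : R => x ^+ (2 * N)).
  by apply: measurable_funTS; exact: measurable_funX.
have x0 (x : R) : 0 <= x ^+ (2 * N) by rewrite exprM exprn_ge0// sqr_ge0.
rewrite AstarE ge0_integral_bigcup//; last 4 first.
- by move=> k; exact: measurable_Cset.
- by apply/measurable_EFinP.
- by move=> x _; rewrite lee_fin.
- exact: trivIset_Cset.
have term n : (\int[mu]_(x in C n.+1) (x ^+ (2 * N))%:E <= (moment_bound N * (2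
  / 3) ^+ n.+1)%:E)%E.
  apply: (@le_trans _ _ (\int[mu]_(x in C n.+1) (cst (n.+2%:R ^+ (2 * N))%:E x))%E).
    apply: ge0_le_integral => //.
    - exact: measurable_Cset.
    - by move=> x _; rewrite lee_fin.
    - by apply/measurable_EFinP.
    - move=> x /(Cset_lt (ltn0Sn n))/andP[h1 h2]; rewrite lee_fin.
      rewrite lerXn2r ?nnegrE ?ler0n//; last exact: ltW.
      by apply: le_trans h1.
  rewrite integral_cst; last exact: measurable_Cset.
  by rewrite -[X in (_ * X <= _)%E]/(mu (C n.+1)) mu_Cset -EFinM lee_fin
    Cset_term_le.
apply: lime_le.
  by apply: is_cvg_nneseries => n _ _; apply: integral_ge0 => x _; rewrite lee_fin.
apply: nearW => k.
apply: (@le_trans _ _ (\sum_(0 <= i < k) (moment_bound N * (2 / 3) ^+ i.+1)%:E)%E).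
  by apply: lee_sum => i _; exact: term.
rewrite sumEFin lee_fin big_mkord -mulr_sumr mulrC.
by rewrite ler_wpM2r ?moment_bound_ge0// sum_geom_le.
Qed.

Lemma sqi_monomial_Astar N : sqi (monomial A N).
Proof.
have mi : measurable_fun setT (monomial A N).
  apply: measurable_funM; first exact: measurable_funX.
  by apply: measurable_indic; exact: measurable_Astar.
split=> //; apply: ge0_integP => [|x|].
- exact: measurable_funX.
- exact: sqr_ge0.
apply: (@le_lt_trans _ _ (\int[mu]_(x in A) (x ^+ (2 * N))%:E)%E); last first.
  by apply: le_lt_trans (int_Astar_le N) _; rewrite ltry.
rewrite [leRHS]integral_mkcond le_eqVlt; apply/orP; left; apply/eqP.
apply: eq_integral => x _; rewrite patchE /monomial indicE.
by case: ifPn => _; rewrite ?mulr1 ?mulr0 ?expr0n// -exprM mulnC.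
Qed.

Lemma moment2_Astar N : moment2 A N = \int[mu]_(x in A) x ^+ (2 * N).
Proof.
rewrite [RHS]Rintegral_mkcond; apply: eq_Rint => x; rewrite patchE /monomial indicE.
by case: ifPn => _; rewrite ?mulr1 ?mulr0 ?expr0n// -exprM mulnC.
Qed.

Lemma integ_Astar_EFin N :
  (\int[mu]_(x in A) (x ^+ (2 * N))%:E = (moment2 A N)%:E)%E.
Proof.
have [_ h] := sqi_monomial_Astar N.
rewrite /moment2 -(integ_EFin h) integral_mkcond.
apply: eq_integral => x _; rewrite patchE /monomial indicE.
by case: ifPn => _; rewrite ?mulr1 ?mulr0 ?expr0n// -exprM mulnC.
Qed.

Lemma moment2_le N : moment2 A N <= 2 * moment_bound N.
Proof. by rewrite -lee_fin -integ_Astar_EFin int_Astar_le. Qed.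

Lemma moment2_ge n N : (0 < n)%N -> n%:R ^+ (2 * N) * m n <= moment2 A N.
Proof.
move=> n0; rewrite -lee_fin -integ_Astar_EFin.
have mX D : measurable_fun D (fun x : R => x ^+ (2 * N)).
  by apply: measurable_funTS; exact: measurable_funX.
have x0 (x : R) : 0 <= x ^+ (2 * N) by rewrite exprM exprn_ge0// sqr_ge0.
apply: (@le_trans _ _ (\int[mu]_(x in C n) (x ^+ (2 * N))%:E)%E); last first.
  apply: ge0_subset_integral => //; [exact: measurable_Cset|exact:
    measurable_Astar| | |exact: Cset_sub].
  - by apply/measurable_EFinP.
  - by move=> x _; rewrite lee_fin.
rewrite EFinM -[X in (_ * X)%E]mu_Cset -integral_cst; last exact: measurable_Cset.
apply: ge0_le_integral => //.
- exact: measurable_Cset.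
- by move=> x _; rewrite /= lee_fin.
- by apply/measurable_EFinP.
- move=> x /(Cset_lt n0)/andP[h1 _]; rewrite lee_fin lerXn2r ?nnegrE//.
  exact: le_trans h1.
Qed.

Lemma moment2_gt0 N : 0 < moment2 A N.
Proof.
apply: lt_le_trans (moment2_ge N (ltn0Sn 0)).
by rewrite mulr_gt0 ?exprn_gt0// mseq_gt0.
Qed.

(** 5 N covers the constants: 2 <= e^N and 4^N <= e^(4N). *)
Lemma ln_moment2_le N : (0 < N)%N -> ln (moment2 A N) <= N%:R / 2 * ln N%:R + 5
  * N%:R.
Proof.
move=> N0; have N1 : 1 <= N%:R :> R by rewrite ler1n.
rewrite -ler_expR lnK ?posrE ?moment2_gt0//.
apply: (le_trans (moment2_le N)); rewrite /moment_bound expRD mulrA mulrC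
  ler_wpM2l ?expR_ge0//.
have -> : 5 * N%:R = N%:R + 4 * N%:R :> R by ring.
rewrite expRD; apply: ler_pM; rewrite ?exprn_ge0//.
  by apply: le_trans (expR_ge1Dx _); lra.
rewrite expRM_natr lerXn2r ?nnegrE ?expR_ge0//.
by apply: le_trans (expR_ge1Dx _); lra.
Qed.

(** For the least n with N <= n^4, either n = 1 or n <= 2 (n - 1) with (n - 1)^4 < N; hence 16 =
    2^4. *)
Lemma fourth_root_approx N : (0 < N)%N ->
  exists n, [/\ (0 < n)%N, (N <= n ^ 4)%N & (n ^ 4 <= 16 * N)%N].
Proof.
move=> N0; have ex : exists n, (N <= n ^ 4)%N.
  by exists N; rewrite -{1}(expn1 N) leq_pexp2l.
case: (ex_minnP ex) => n hn nmin.
have n0 : (0 < n)%N.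
  by rewrite lt0n; apply/eqP => n0; move: hn; rewrite n0 exp0n// leqNgt N0.
exists n; split=> //.
case: n n0 hn nmin => // [[|n]] _ hn nmin.
  by rewrite exp1n; lia.
have h : (n.+1 ^ 4 < N)%N.
  by rewrite ltnNge; apply/negP => /nmin; rewrite ltnn.
apply: (@leq_trans (16 * n.+1 ^ 4)); last by rewrite leq_pmul2l// ltnW.
have -> : (16 = 2 ^ 4)%N by [].
by rewrite -expnMn leq_exp2r//; lia.
Qed.

(** A single C_n suffices, with n^4 between N and 16 N: the first bound gives 2N ln n >= (N/2) ln N,
    the second m_n >= e^(-16 N). *)
Lemma ln_moment2_ge N : (0 < N)%N -> N%:R / 2 * ln N%:R - 16 * N%:R <= ln
  (moment2 A N).
Proof.
move=> N0; have [n [n0 nN n16]] := fourth_root_approx N0.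
have n1 : 0 < n%:R :> R by rewrite ltr0n.
have N1 : 0 < N%:R :> R by rewrite ltr0n.
rewrite -ler_expR lnK ?posrE ?moment2_gt0//.
apply: le_trans (moment2_ge N n0).
have -> : n%:R ^+ (2 * N) * m n = expR (2 * N%:R * ln n%:R - n%:R ^+ 4) :> R.
  by rewrite expRD; congr (_ * _); rewrite -natrM mulrC expRM_natr ?lnK ?posrE.
rewrite ler_expR.
have h1 : n%:R ^+ 4 <= 16 * N%:R :> R by rewrite -natrX -natrM ler_nat.
have h2 : ln N%:R <= 4 * ln n%:R :> R.
  rewrite mulrC mulr_natr -lnXn// ler_ln ?posrE ?exprn_gt0//.
  by rewrite -natrX ler_nat.
have h3 : N%:R * ln N%:R <= N%:R * (4 * ln n%:R) :> R by rewrite ler_pM2l.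
lra.
Qed.

End CombSet.

(** * Measure, perimeters, moments and dilations of the set *)

Section CombSetProperties.
Context {R : realType}.
Local Notation mu := (@lebesgue_measure R).
Local Notation A := (Astar R).
Local Notation m := (mseq R).
Local Notation K := (Kseq R).
Local Notation l := (ellseq R).
Local Notation C := (Cset R).

Lemma Astar_unbounded : ~ bounded_set A.
Proof.
move=> [M [Mr h]]; have /h {}h : M < M + 1 by rewrite ltrDl.
pose n := (Num.Def.trunc (M + 1)).+1.
have An : A n%:R by apply: (@Cset_sub R n (ltn0Sn _)); exact: Cset_left.
have hn : `|n%:R : R| <= M + 1 := h _ An.
move: hn; rewrite ger0_norm ?ler0n// => /(lt_le_trans (truncnS_gt (M + 1))).
by rewrite ltxx.
Qed.

Lemma mu_Astar : (0 < mu A < +oo)%E.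
Proof.
apply/andP; split.
  apply: (@lt_le_trans _ _ (mu (C 1%N))); first by rewrite mu_Cset lte_fin mseq_gt0.
  apply: le_measure; rewrite ?inE; [exact: measurable_Cset|exact:
    measurable_Astar|exact: Cset_sub].
(* The measure is the moment of order zero. *)
apply: (le_lt_trans _ (ltry (2 * moment_bound 0 : R))).
apply: le_trans (int_Astar_le 0).
rewrite (eq_integral (cst 1%E)); last by move=> x _; rewrite muln0 expr0.
by rewrite integral_cst ?mul1e//; exact: measurable_Astar.
Qed.

(** Since A lies in [1, +oo), |x|^q <= x^(2N) there as soon as 2N >= q. *)
Lemma Astar_moment_finite (q : R) : 0 <= q ->
  (\int[mu]_(x in A) (`|x| `^ q)%:E < +oo)%E.
Proof.
move=> q0; pose N := (Num.Def.trunc q).+1.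
apply: (le_lt_trans _ (ltry (2 * moment_bound N : R))).
apply: le_trans (int_Astar_le N); apply: ge0_le_integral => //.
- exact: measurable_Astar.
- apply/measurable_EFinP; apply: measurable_funTS.
  by apply: (measurableT_comp (measurable_powR q)); exact: normr_measurable.
- by apply/measurable_EFinP; apply: measurable_funTS; exact: measurable_funX.
- move=> x /Astar_ge1 x1; have x0 : 0 <= x by apply: le_trans x1.
  rewrite lee_fin (ger0_norm x0) -powR_mulrn// ler_powR//.
  by apply: (le_trans (ltW (truncnS_gt q))); rewrite ler_nat -/N mul2n -addnn
    leq_addr.
Qed.

(** The translation by one tooth length sends the teeth of C_n into its gaps, and the other C_k are
    too far away to reach C_n. *)
Lemma shift_disjoint n x : (2 <= n)%N -> C n x -> ~ [set y + l n | y in A] x.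
Proof.
move=> n2 Cx [y [k /= k0 Cy] yx]; have n0 : (0 < n)%N by lia.
have /andP[x1 x2] := Cset_itv n0 Cx; have /andP[y1 y2] := Cset_itv k0 Cy.
have l0 := @ellseq_gt0 R n; have ln_ := le_trans (@ellseq_le R n) (mseq_le2 n2).
have mk := @mseq_le R k k0; have mn := @mseq_le R n n0.
have yE : y = x - l n by rewrite -yx addrK.
have [kn|nk|kn] := ltngtP k n.
- have : k.+1%:R <= n%:R :> R by rewrite ler_nat.
  rewrite -(natr1 k); lra.
- have : n.+1%:R <= k%:R :> R by rewrite ler_nat.
  rewrite -(natr1 n); lra.
- subst k; case: Cx => i /= iK /cellP/andP[i1 i2].
  case: Cy => j /= jK /cellP/andP[j1 j2].
  (* If x is in tooth i and x - l_n in tooth j of the same C_n, the two inequalities force i <= j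
     and j < i. *)
  have a1 : (2 * i)%:R * l n < (2 * j + 2)%:R * l n.
    rewrite (_ : (2 * j + 2)%:R = (2 * j + 1)%:R + 1 :> R) ?mulrDl ?mul1r;
      first lra.
    by rewrite natr1 addn1 addn2.
  have a2 : (2 * j + 1)%:R * l n < (2 * i + 1)%:R * l n.
    rewrite (_ : (2 * j + 1)%:R = (2 * j)%:R + 1 :> R) ?mulrDl ?mul1r; first lra.
    by rewrite natr1 addn1.
  move: a1 a2; rewrite !ltr_pM2r// !ltr_nat; clear; lia.
Qed.

Lemma measurable_shift (h : R) : measurable [set x + h | x in A].
Proof.
rewrite (_ : [set x + h | x in A] = (fun x => 1 * x + - h) @^-1` A).
  rewrite -[X in measurable X]setTI; apply: measurable_affine => //.
  exact: measurable_Astar.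
apply/seteqP; split => [_ [x Ax <-] /=|x /= Ax]; first by rewrite mul1r addrK.
by exists (1 * x + - h) => //; rewrite mul1r subrK.
Qed.

Lemma sym_diff_ge n : (2 <= n)%N ->
  ((m n)%:E <= mu (A `+` [set (x + l n)%R | x in A]))%E.
Proof.
move=> n2; rewrite -mu_Cset; apply: le_measure; rewrite ?inE.
- exact: measurable_Cset.
- have mS := measurable_shift (l n); have mA := @measurable_Astar R.
  by rewrite setY_def; apply: measurableU; apply: measurableD.
- move=> x Cx; left; split; last exact: shift_disjoint.
  by move: Cx; apply: Cset_sub; lia.
Qed.

(** 1 / l_n = K_n / m_n is at least K_n >= e^(n^6), because m_n <= 1. *)
Lemma Per_term (gamma : R) n : 0 < gamma -> gamma <= 1 ->
  expR (gamma * n%:R ^+ 6 - n%:R ^+ 4) <= m n * (`|l n| `^ gamma)^-1.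
Proof.
move=> g0 g1; rewrite expRD mulrC ler_pM2l ?mseq_gt0//.
have l0 := @ellseq_gt0 R n.
rewrite gtr0_norm// -powR_inv1 ?powR_ge0// -powRrM mulrN1.
rewrite /powR gt_eqF// ler_expR mulNr -mulrN ler_pM2l// -lnV ?posrE//.
rewrite -ler_expR lnK ?posrE ?invr_gt0//.
apply: (le_trans (Kseq_ge n)).
rewrite /ellseq invf_div ler_pMr ?ltr0n ?Kseq_gt0//.
rewrite invf_ge1 ?mseq_gt0//.
by rewrite /mseq -expR0 ler_expR oppr_le0 exprn_ge0.
Qed.

Lemma Per_Astar (gamma : R) : 0 < gamma -> gamma <= 1 -> Per gamma A = +oo%E.
Proof.
move=> g0 g1.
have bd n : (2 <= n)%N -> ((expR (gamma * n%:R ^+ 6 - n%:R ^+ 4))%:E <= Per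
  gamma A)%E.
  move=> n2; apply: (@le_trans _ _ ((m n)%:E * ((`|l n| `^ gamma)^-1)%:E)%E).
    by rewrite -EFinM lee_fin Per_term.
  apply: (@le_trans _ _ (mu (A `+` [set (x + l n)%R | x in A]) * ((`|l n| `^
    gamma)^-1)%:E)%E).
    by rewrite lee_wpmul2r// ?lee_fin ?invr_ge0 ?powR_ge0// sym_diff_ge.
  apply: ereal_sup_ubound; exists (l n) => //=.
  by rewrite gt_eqF// ellseq_gt0.
have big (M : R) : (M%:E < Per gamma A)%E.
  (* n exceeds |M| and 2 / gamma, so gamma n^6 >= 2 n^4 and the exponent is at least n^4 >= n >
     M. *)
  pose n := ((Num.Def.trunc `|M|).+1 + (Num.Def.trunc (2 / gamma)).+1).+2.
  have n2 : (2 <= n)%N by [].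
  apply: lt_le_trans (bd n n2); rewrite lte_fin.
  have n1 : 1 <= n%:R :> R by rewrite ler1n.
  have h1 : M < n%:R.
    apply: (le_lt_trans (ler_norm M)); apply: (lt_le_trans (truncnS_gt `|M|)).
    by rewrite ler_nat /n -addn2 -addnA leq_addr.
  have h2 : 2 <= gamma * n%:R ^+ 2.
    rewrite mulrC -ler_pdivrMr//; apply: (le_trans (ltW (truncnS_gt (2 / gamma)))).
    apply: (@le_trans _ _ n%:R).
      rewrite ler_nat /n.
      by apply: (leq_trans (leq_addl (Num.Def.trunc `|M|).+1 _));
        rewrite -[leqRHS]addn2 leq_addr.
    by rewrite ler_eXnr.
  apply: (lt_le_trans h1); apply: le_trans (expR_ge1Dx _).
  have h4 : n%:R <= n%:R ^+ 4 :> R by rewrite ler_eXnr.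
  have h6 : 2 * n%:R ^+ 4 <= gamma * n%:R ^+ 6 :> R.
    rewrite (_ : n%:R ^+ 6 = n%:R ^+ 2 * n%:R ^+ 4 :> R); last by rewrite -exprD.
    by rewrite mulrA ler_wpM2r// exprn_ge0// ler0n.
  lra.
by case: (Per gamma A) big => [r /(_ r)|//|/(_ 0)//]; rewrite ltxx.
Qed.

Lemma Astar_ln_moments :
  (fun N : nat => ln (\int[mu]_(x in A) x ^+ (2 * N)) - N%:R / 2 * ln N%:R)
    =O_\oo (fun N : nat => N%:R : R).
Proof.
apply/eqO_exP; exists 16 => //; exists 1%N => // N /= N1.
rewrite -moment2_Astar; have h1 := @ln_moment2_ge R N N1;
  have h2 := @ln_moment2_le R N N1.
have N0 : 0 <= N%:R :> R by [].
by rewrite (ger0_norm N0) ler_norml; apply/andP; split; lra.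
Qed.

Section Dilation.
Variable c : R.
Hypothesis c0 : 0 < c.
Local Notation B := (dilate c A).

Lemma dilate_preimage : (fun t : R => c * t + 0) @^-1` B = A.
Proof.
apply/seteqP; split => [t /= [s As]|t At /=]; last by exists t; rewrite ?addr0.
by rewrite addr0 => /(mulfI (lt0r_neq0 c0)) <-.
Qed.

Lemma measurable_dilate : measurable B.
Proof.
rewrite (_ : B = (fun x => c^-1 * x + 0) @^-1` A).
  rewrite -[X in measurable X]setTI; apply: measurable_affine => //.
  exact: measurable_Astar.
apply/seteqP; split => [_ [x Ax <-] /=|x /= Ax].
  by rewrite addr0 mulKf// gt_eqF.
by exists (c^-1 * x + 0) => //; rewrite addr0 mulVKf// gt_eqF.
Qed.

Lemma mu_dilate : (mu B < +oo)%E.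
Proof.
rewrite (lebesgue_measure_affine 0 c0 measurable_dilate) dilate_preimage.
have /andP[_ h] := mu_Astar.
rewrite -(fineK (x := mu A)); last by rewrite ge0_fin_numE.
by rewrite -EFinM ltry.
Qed.

Lemma monomial_dilate N t : monomial B N (c * t + 0) = c ^+ N * monomial A N t.
Proof.
rewrite /monomial addr0 exprMn -mulrA; congr (_ * (_ * _)).
rewrite !indicE; congr (_%:R); congr nat_of_bool; apply/idP/idP; rewrite !inE.
  by move=> [s As] /(mulfI (lt0r_neq0 c0)) <-.
by move=> At; exists t.
Qed.

(** In the exponent 2N + 1, the unit is the Jacobian of the dilation and 2N comes from the squared
    monomial. *)
Lemma sqi_monomial_dilate N : sqi (monomial B N) /\ moment2 B N = c ^+ (2 *
  N).+1 * moment2 A N.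
Proof.
have mi : measurable_fun setT (monomial B N).
  apply: measurable_funM; first exact: measurable_funX.
  by apply: measurable_indic; exact: measurable_dilate.
have s2 (x : R) : 0 <= monomial B N x ^+ 2 by exact: sqr_ge0.
have E : (\int[mu]_x (monomial B N x ^+ 2)%:E = (c ^+ (2 * N).+1 * moment2 A
  N)%:E)%E.
  have m2 : measurable_fun setT (fun x => (monomial B N x ^+ 2)%:E).
    by apply/measurable_EFinP; exact: measurable_funX.
  rewrite (@ge0_integral_affine R c 0 _ c0 m2)//.
  have -> : (c ^+ (2 * N).+1 * moment2 A N)%:E =
     (c%:E * \int[mu]_t (c ^+ (2 * N) * monomial A N t ^+ 2)%:E)%E.
    have [_ h] := @sqi_monomial_Astar R N.
    by rewrite integ_EFin ?RintZ//; [rewrite -EFinM exprS mulrA|exact: integZ].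
  congr (_ * _)%E; apply: eq_integral => t _.
  by rewrite monomial_dilate exprMn -exprM mulnC.
have ib : integ (fun x => monomial B N x ^+ 2).
  by apply: ge0_integP => //; [exact: measurable_funX|rewrite E ltry].
by split=> //; apply: EFin_inj; rewrite /moment2 -integ_EFin.
Qed.

End Dilation.
End CombSetProperties.

(** * Singular values and the main theorem *)

Section SingularDecay.
Context {R : realType}.
Local Notation A := (Astar R).

(** Lower Stirling bound by induction; the step is N (ln (N + 1) - ln N) <= 1. *)
Lemma ln_fact_ge (N : nat) : N%:R * ln N%:R - N%:R <= ln (N`!%:R) :> R.
Proof.
elim: N => [|N IH]; first by rewrite mul0r subr0 fact0 ln1.
have N1 : 0 < N.+1%:R :> R by rewrite ltr0n.
rewrite factS natrM lnM ?posrE ?ltr0n ?fact_gt0//.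
suff h : N%:R * ln N.+1%:R <= N%:R * ln N%:R + 1 :> R.
  have e : N.+1%:R = N%:R + 1 :> R by rewrite natr1.
  by rewrite {1 3}e mulrDl mul1r; lra.
case: N {IH} N1 => [|N] N1; first by rewrite !mul0r add0r.
have N0 : 0 < N.+1%:R :> R by rewrite ltr0n.
have := @le_ln1Dx R (N.+1%:R^-1).
have -> : -1 < N.+1%:R^-1 :> R by apply: (@lt_trans _ _ 0);
  rewrite ?invr_gt0 ?oppr_lt0.
move=> /(_ isT).
rewrite (_ : 1 + N.+1%:R^-1 = N.+2%:R / N.+1%:R); last first.
  by rewrite -[N.+2%:R]natr1 mulrDl mul1r divff// gt_eqF.
rewrite ln_div ?posrE// => h.
have : N.+1%:R * (ln N.+2%:R - ln N.+1%:R) <= 1 :> R.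
  by rewrite mulrC -ler_pdivlMr// mul1r.
by rewrite mulrBr lerBlDr addrC.
Qed.

Variable c : R.
Hypothesis c0 : 0 < c.
Local Notation B := (dilate c A).

(** Half of the linear terms in ln [delta]: 8 = (4 + 2 + 10) / 2, from 4 <= e^(4N), from Stirling
    and from the two moments. The coefficient 2 of |ln c| covers 3/2, as 2N + 1 <= 3N. *)
Definition decay_const : R := 8 + `|ln (2 * pi)| + 2 * `|ln c|.

Lemma delta_ge0 N : 0 <= delta A B N.
Proof.
have M0 E : 0 <= moment2 E N :> R by apply: Rint_ge0 => x; exact: sqr_ge0.
rewrite /delta; apply: mulr_ge0 (M0 _); apply: mulr_ge0 (M0 _).
by apply: mulr_ge0 => //; exact: sqr_ge0.
Qed.

Lemma delta_le N : (0 < N)%N ->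
  delta A B N <= expR (- (N%:R / 2 * ln N%:R) + decay_const * N%:R) ^+ 2.
Proof.
move=> N0; have N1 : 1 <= N%:R :> R by rewrite ler1n.
have [_ mB] := sqi_monomial_dilate c0 N.
have P0 : 0 < 2 * pi :> R by rewrite mulr_gt0// pi_gt0.
have M0 := @moment2_gt0 R N.
have F0 : 0 < N`!%:R :> R by rewrite ltr0n fact_gt0.
have powE (x : R) k : 0 < x -> x ^+ k = expR (ln x * k%:R).
  by move=> x0; rewrite expRM_natr lnK.
have kE : (2 * pi) ^+ N / N`!%:R = expR (ln (2 * pi) * N%:R - ln N`!%:R) :> R.
  by rewrite expRD expRN lnK ?posrE// powE.
rewrite /delta mB kE (powE c)// -[moment2 A N](@lnK R) ?posrE// -!expRM_natl.
have four : 4 <= expR (4 * N%:R) :> R by apply: le_trans (expR_ge1Dx _); lra.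
apply: (@le_trans _ _ (expR (4 * N%:R) * expR (2 * (ln (2 * pi) * N%:R - ln
  N`!%:R)) *
    expR (ln (moment2 A N)) * (expR (ln c * (2 * N).+1%:R) * expR (ln (moment2
      A N))))).
  by rewrite !ler_wpM2r ?mulr_ge0 ?expR_ge0.
rewrite -!expRD ler_expR /decay_const.
have h1 := ln_fact_ge N; have h2 := @ln_moment2_le R N N0.
have h3 : ln (2 * pi) * N%:R <= `|ln (2 * pi)| * N%:R :> R.
  by rewrite ler_wpM2r// ler_norm.
have h4 : ln c * (2 * N).+1%:R <= `|ln c| * (3 * N%:R).
  apply: (@le_trans _ _ (`|ln c| * (2 * N).+1%:R));
    first by rewrite ler_wpM2r// ler_norm.
  by rewrite ler_wpM2l// -natrM ler_nat; lia.
have h5 : 0 <= `|ln c| * N%:R by rewrite mulr_ge0.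
move: h1 h2 h3 h4 h5; move: (ln N`!%:R) (ln (moment2 A N)) (ln (2 * pi) * N%:R)
  (ln c * _) (`|ln c|) (`|ln (2 * pi)|) (ln N%:R) => f M a b d e g *.
nra.
Qed.

Lemma decay_const_gt0 : 0 < decay_const.
Proof.
have := normr_ge0 (ln (2 * pi) : R); have := normr_ge0 (ln c).
by rewrite /decay_const; lra.
Qed.

(** Let L = ln (1/e), y = ln L and C = [decay_const]. As delta_N <= exp (-N (ln N - 2C)), it is
    enough that N (ln N - 2C) > L. With N just above 3 L / y, ln N - 2C is at least 3y/4, and the
    product exceeds 9L/4. *)
Lemma rank_choice : exists2 e0 : R, 0 < e0 & forall e, 0 < e -> e < e0 ->
  exists N : nat, delta A B N < e /\ N%:R <= 4 * (ln e^-1 / ln (ln e^-1)).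
Proof.
have C0 := decay_const_gt0; set C := decay_const in C0 *.
have l8 : 0 <= ln 8 :> R by rewrite ln_ge0 ?ler1n.
(* y > [Y] gives ln 8 + 2C <= y/8; together with the tangent bound ln y <= y/8 + ln 8, the loss ln y
   + 2C is at most y/4. *)
pose Y := 8 * (ln 8 + 2 * C) + 1.
exists (expR (- expR Y)); first exact: expR_gt0.
move=> e e_gt0 eY; set L := ln e^-1.
have eL : e = expR (- L) by rewrite /L lnV ?posrE// opprK lnK.
have LY : expR Y < L by move: eY; rewrite eL ltr_expR ltrN2.
have L0 : 0 < L := lt_trans (expR_gt0 Y) LY.
set y := ln L; have Ly : L = expR y by rewrite /y lnK.
have yY : Y < y by move: LY; rewrite Ly ltr_expR.
have y1 : 1 < y by apply: lt_trans yY; rewrite /Y; lra.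
have y0 : 0 < y by lra.
have yL : y <= L.
  by rewrite Ly; apply: le_trans (expR_ge1Dx y); lra.
(* This absorbs the rounding of 3 L / y up to an integer: N <= 3 L / y + 1 <= 4 L / y. *)
have Ly1 : 1 <= L / y by rewrite ler_pdivlMr// mul1r.
pose x := 3 * (L / y); have x0 : 0 <= x by rewrite /x; lra.
pose N := (Num.Def.trunc x).+1; exists N.
have xN : x < N%:R := truncnS_gt x.
have Nx : N%:R <= x + 1 by rewrite /N -natr1 lerD2r truncn_le.
split; last by apply: (le_trans Nx); rewrite /x; lra.
have N0 : 0 < N%:R :> R by rewrite ltr0n.
apply: (le_lt_trans (delta_le (ltn0Sn _))).
rewrite -/N -/C -expRM_natl eL ltr_expR.
have lny : ln y <= y / 8 + ln 8.
  have := @le_ln1Dx R (y / 8 - 1).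
  rewrite (_ : 1 + (y / 8 - 1) = y / 8); last by ring.
  have -> : -1 < y / 8 - 1 by lra.
  by move=> /(_ isT); rewrite ln_div ?posrE//; lra.
have lnN : y - ln y <= ln N%:R.
  have -> : y - ln y = ln (L / y) by rewrite ln_div.
  rewrite ler_ln ?posrE ?divr_gt0//; apply: le_trans (ltW xN); rewrite /x; lra.
have key : 3 / 4 * y <= ln N%:R - 2 * C by rewrite /Y in yY; lra.
have k2 : N%:R * (3 / 4 * y) <= N%:R * (ln N%:R - 2 * C) by rewrite ler_pM2l.
have k3 : x * (3 / 4 * y) < N%:R * (3 / 4 * y) by rewrite ltr_pM2r// mulr_gt0//
  divr_gt0.
have k4 : x * (3 / 4 * y) = 9 / 4 * L by rewrite /x; field; rewrite gt_eqF.
move: k2 k3; rewrite k4; lra.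
Qed.

End SingularDecay.

Theorem theorem6p1 (R : realType) :
  [/\ [/\ ~ bounded_set (Astar R),
          (0 < lebesgue_measure (Astar R) < +oo)%E &
          forall q : R, 0 <= q ->
            (\int[lebesgue_measure]_(x in Astar R) (`|x| `^ q)%:E < +oo)%E],
      forall gamma : R, 0 < gamma -> gamma <= 1 -> Per gamma (Astar R) = +oo%E,
      (let M (N : nat) : R := \int[lebesgue_measure]_(x in Astar R) x ^+ (2 * N) in
       (fun N : nat => ln (M N) - N%:R / 2 * ln N%:R) =O_\oo (fun N : nat => N%:R : R)) &
      forall c : R, 0 < c ->
      [/\ forall f, L2 f ->
            Sop c f = Pproj (Astar R)
                        (Qproj (dilate c (Astar R)) (Pproj (Astar R) f))
              %[ae lebesgue_measure],
          exists2 r : nat -> R,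
            r =O_\oo (fun N : nat => N%:R : R) &
            \forall N \near \oo,
              (lne (singular_value (Kop c) N.+1)
                 <= (- (N%:R / 2 * ln N%:R) + r N)%:E)%E &
          exists2 r : R -> R,
            r =O_ ((0 : R)^'+) (fun eps : R => ln eps^-1 / ln (ln eps^-1)) &
            \forall eps \near (0 : R)^'+,
              trace (spectral_projection (Sop c) `]eps, 1 - eps[%classic) = (r eps)%:E]].
Proof.
split; [split| | |].
- exact: Astar_unbounded.
- exact: mu_Astar.
- exact: Astar_moment_finite.
- exact: Per_Astar.
- exact: Astar_ln_moments.
move=> c c0.
have mA := @measurable_Astar R; have mB := measurable_dilate c0.
have /andP[_ finA] := @mu_Astar R; have finB := mu_dilate c0.
have monoA N := @sqi_monomial_Astar R N.
have monomialB N := (sqi_monomial_dilate c0 N).1.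
have small N v := @Kgen_small R (Astar R) (dilate c (Astar R)) mA mB finA monoA
  monomialB N v.
split.
- move=> f fL; exact: Sgen_formula.
- exists (fun N => decay_const c * N%:R).
    apply/eqO_exP; exists (decay_const c); first exact: decay_const_gt0.
    apply: nearW => N; rewrite normrM ger0_norm//.
    exact: ltW (decay_const_gt0 _).
  exists 1%N => // N /= N1.
  have sv := singular_bound mA mB finA finB (fun j : 'I_N =>
    phi_L2 monoA j) (@small N) (delta_ge0 c N).
  set s := singular_value _ _ in sv *.
  have {}sv : (s <= (expR (- (N%:R / 2 * ln N%:R) + decay_const c * N%:R))%:E)%E.
    apply: (le_trans sv); rewrite lee_fin -[leRHS]ger0_norm ?expR_ge0// -sqrtr_sqr.
    by rewrite ler_wsqrtr// delta_le.
  (* A singular value that is not positive has extended logarithm -oo, which is below any bound. *)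
  case: s sv => [t| |]; rewrite ?lee_fin//= => ts; last by rewrite leNye.
  case: ifPn => t0; first by rewrite leNye.
  by rewrite lee_fin -ler_expR lnK// posrE ltNge.
- pose tr eps := trace (spectral_projection (Sop c) `]eps, 1 - eps[%classic).
  have [e0 e0_gt0 he0] := rank_choice c0.
  have bnd eps : 0 < eps -> eps < e0 -> exists2 r : R,
      0 <= r <= 4 * (ln eps^-1 / ln (ln eps^-1)) & tr eps = r%:E.
    move=> eps0 epse0; have [N [dN Nle]] := he0 eps eps0 epse0.
    (* The dimension is controlled through the lower end of the interval. *)
    have De (x : R) : `]eps, 1 - eps[%classic x -> eps <= x.
      by rewrite /= in_itv/= => /andP[/ltW].
    have [r /andP[r0 rN] tE] := trace_bound mA mB finA finB
      (fun j : 'I_N => phi_L2 monoA j) (@small N) (measurable_itv _) De dN.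
    by exists r => //; rewrite r0 (le_trans rN).
  (* Below [e0] the trace is a real number by [bnd], so [fine] preserves it. *)
  exists (fun eps => fine (tr eps)).
    apply/eqO_exP; exists 4 => //.
    near=> eps.
    have [||r /andP[r0 rb] ->] := bnd eps; [by near: eps; exact: nbhs_right_gt|
      by near: eps; exact: nbhs_right_lt|].
    rewrite /= ger0_norm// (le_trans rb)// ler_pM2l//; exact: ler_norm.
  near=> eps.
  have [||r _ e] := bnd eps; [by near: eps; exact: nbhs_right_gt|
    by near: eps; exact: nbhs_right_lt|].
  by rewrite -/(tr eps) e.
Unshelve. all: by end_near. Qed.
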